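(* Let $\{\alpha_n\}_{n\in\mathbb{N}}\subset(0,d)$ be such that $\alpha_n\to0^+$ as $n\to+\infty$. Let $u^\infty_0\in L^2(\Omega)$ and $\{u^n_0\}_{n\in\mathbb{N}}\subset L^2(\Omega)$ be such that $u^n_0\to u^\infty_0$ in $L^2(\Omega)$. Let $T>0$. Then, for every $n\in\mathbb{N}$ there exists a unique solution $u^n\in H^1([0,T];L^2(\Omega))$ of $$\begin{cases}u_t(t)=-\alpha_n(-\Delta)^{-\frac{\alpha_n}{2}}u(t)&\text{for a.e. }t\in(0,T),\\ u(0)=u^n_0.\end{cases}$$ Moreover, $u^n\to u^\infty$ (strongly) in $H^1([0,T];L^2(\Omega))$ as $n\to+\infty$, where $u^\infty$ is the unique solution of $$\begin{cases}u_t(t)=-2d\omega_d\,u(t)&\text{for a.e. }t\in(0,T),\\ u(0)=u^\infty_0,\end{cases}$$ and, for every $t\in[0,T]$, $$\|u^n(t)-u^\infty(t)\|_{L^2(\Omega)}\to0\qquad\text{and}\qquad-\alpha_n\mathcal{J}^{\alpha_n}(u^n(t))\to d\omega_d\|u^\infty(t)\|^2_{L^2(\Omega)}.$$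
   Context: Let $d\in\mathbb{N}$ (with $d\ge 1$) and let $\Omega\subset\mathbb{R}^d$ be a bounded open set with Lipschitz continuous boundary. $L^2(\Omega)$ is the space of real-valued square-integrable functions, and $\omega_d$ is the Lebesgue measure of the unit ball of $\mathbb{R}^d$. For $\alpha\in(0,d)$ and $u\in L^2(\Omega)$ set $$\mathcal{J}^\alpha(u):=-\int_\Omega\int_\Omega\frac{u(x)u(y)}{|x-y|^{d-\alpha}}\,dy\,dx,$$ and define the $\alpha$-Riesz potential of $u$ (extended by $0$ outside $\Omega$) by $$(-\Delta)^{-\frac\alpha2}u(x):=2\int_{\Omega}\frac{u(y)}{|x-y|^{d-\alpha}}\,dy,$$ whose restriction to $\Omega$ belongs to $L^2(\Omega)$; the evolution equations are equalities in $L^2(\Omega)$. Solutions are sought in $H^1([0,T];L^2(\Omega))$, the Sobolev space of $L^2(\Omega)$-valued functions of time, whose elements are identified with their continuous representatives. *)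

(* Defs.v *)
From HB Require Import structures.
From mathcomp Require Import all_boot all_order all_algebra.
From mathcomp Require Import all_classical all_reals all_analysis.
From mathcomp Require Import measurable_realfun.
From mathcomp Require Import lra.

Set Implicit Arguments.
Unset Strict Implicit.
Unset Printing Implicit Defensive.
Import Order.TTheory GRing.Theory Num.Theory.
Import numFieldNormedType.Exports.
Local Open Scope classical_set_scope.
Local Open Scope ring_scope.

Definition rV_display : measure_display. Proof. exact: default_measure_display. Qed.

(* The product (equivalently, Borel) sigma-algebra on row vectors *)
Section rV_measurable.
Context (R : realType) (n : nat).

Let coord (i : 'I_n) (v : 'rV[R]_n) : measurableTypeR R := v ord0 i.

Let rV_set0 : g_sigma_preimage coord set0.
Proof. exact: sigma_algebra0. Qed.

Let rV_setC A : g_sigma_preimage coord A -> g_sigma_preimage coord (~` A).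
Proof. exact: sigma_algebraC. Qed.

Let rV_bigcup (F : (set 'rV[R]_n)^nat) :
  (forall i, g_sigma_preimage coord (F i)) ->
  g_sigma_preimage coord (\bigcup_i (F i)).
Proof. exact: sigma_algebra_bigcup. Qed.

HB.instance Definition _ := @isMeasurable.Build rV_display
  'rV[R]_n (g_sigma_preimage coord) rV_set0 rV_setC rV_bigcup.

Lemma measurable_coord (i : 'I_n) :
  measurable_fun [set: 'rV[R]_n] (fun v : 'rV[R]_n => v ord0 i).
Proof.
move=> _ Y mY; rewrite setTI; apply: sub_sigma_algebra => /=.
rewrite -bigcup_seq/=; exists i => /=; first by rewrite mem_index_enum.
by exists Y => //; rewrite setTI.
Qed.

Lemma measurable_fun_rV d (T : measurableType d) (f : T -> 'rV[R]_n) :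
  (forall i, measurable_fun [set: T] (fun t => f t ord0 i)) ->
  measurable_fun [set: T] f.
Proof.
move=> mf _ A mA; rewrite setTI; move: A mA.
apply: smallest_sub => [|B].
  split=> /= [|B mB|F mF]; first by rewrite preimage_set0.
  - by rewrite setTD preimage_setC; exact: measurableC.
  - by rewrite preimage_bigcup; exact: bigcupT_measurable.
rewrite -bigcup_seq => -[i _] [C mC <-] /=.
by rewrite setTI -[X in measurable X]setTI; exact: mf.
Qed.

Lemma open_measurable_rV (A : set 'rV[R]_n) : open A -> measurable A.
Proof.
move=> oA.
pose rat_row (q : 'rV[rat]_n) : 'rV[R]_n := \row_j ratr (q ord0 j).
pose box (q : 'rV[rat]_n) (k : nat) : set 'rV[R]_n :=
  [set v | forall i, `|v ord0 i - rat_row q ord0 i| < k.+1%:R^-1].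
have mbox q k : measurable (box q k).
  rewrite (_ : box q k = \bigcap_(i in [set: 'I_n])
    (fun v : 'rV[R]_n => v ord0 i) @^-1` (ball (rat_row q ord0 i) k.+1%:R^-1)).
    apply: fin_bigcap_measurable => // i _.
    rewrite -[X in measurable X]setTI; apply: measurable_coord => //.
    exact: measurable_ball.
  apply/seteqP; split=> v /= h i; first by move=> _; rewrite /ball/= distrC.
  by have := h i I; rewrite /ball/= distrC.
pose P (z : 'rV[rat]_n * nat) := box z.1 z.2 `<=` A.
pose F z := if `[< P z >] then box z.1 z.2 else set0.
rewrite (_ : A = \bigcup_z F z).
  apply: countable_bigcupT_measurable; first exact: countableP.
  by move=> z; rewrite /F; case: ifPn.
apply/seteqP; split=> [v Av|v [z _]]; last first.
  by rewrite /F; case: ifPn => // /asboolP; exact.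
have /nbhs_ballP[e /= e0 veA] := open_nbhs_nbhs (conj oA Av).
pose k := Num.trunc (2 / e).
have ke : 2 * k.+1%:R^-1 < e.
  rewrite ltr_pdivrMr// mulrC -ltr_pdivrMr//; exact: truncnS_gt.
have k0 : 0 < k.+1%:R^-1 :> R by rewrite invr_gt0.
have [f fP] : {f : 'I_n -> rat & forall i, `|v ord0 i - ratr (f i)| < k.+1%:R^-1}.
  apply: (@boolp.choice _ _ (fun i q => `|v ord0 i - ratr q| < k.+1%:R^-1)) => i.
  have [|q] := @rat_in_itvoo R (v ord0 i - k.+1%:R^-1) (v ord0 i + k.+1%:R^-1).
    by rewrite ltrD2l gtrN.
  by rewrite in_itv/= => /andP[h1 h2]; exists q; rewrite ltr_distlC h1 h2.
exists (\row_i f i, k) => //; rewrite /F asboolT/=.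
  by move=> i; rewrite !mxE; exact: fP.
move=> w wb; apply: veA; split => // i j.
rewrite /ball/= (ord1 i).
have := wb j; rewrite !mxE => h1; have h2 := fP j.
apply: (le_lt_trans (ler_distD (ratr (f j)) _ _)).
apply: lt_trans ke; rewrite mulr_natl mulr2n; apply: ltrD => //.
by rewrite distrC.
Qed.

End rV_measurable.

Section rV_lebesgue.
Context (R : realType).

Definition rV_cons n (z : measurableTypeR R * 'rV[R]_n) : 'rV[R]_n.+1 :=
  row_mx (const_mx z.1 : 'rV_1) z.2.

Definition rV_uncons n (v : 'rV[R]_n.+1) : measurableTypeR R * 'rV[R]_n :=
  (v ord0 ord0, rsubmx (v : 'rV_(1 + n))).

Lemma rV_consK n : cancel (@rV_cons n) (@rV_uncons n).
Proof.
move=> [x v]; rewrite /rV_uncons /rV_cons/= row_mxKr; congr pair.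
by rewrite mxE; case: splitP => // j _; rewrite mxE.
Qed.

Lemma measurable_rV_cons n : measurable_fun [set: _] (@rV_cons n).
Proof.
apply: measurable_fun_rV => i; rewrite /rV_cons.
under eq_fun do rewrite mxE.
case: (@splitP 1 n i) => j _; first by under eq_fun do rewrite mxE; exact: measurable_fst.
apply: (measurableT_comp (@measurable_coord R n j)); exact: measurable_snd.
Qed.

Lemma measurable_rV_uncons n : measurable_fun [set: _] (@rV_uncons n).
Proof.
apply: measurable_fun_pair; first exact: measurable_coord.
apply: measurable_fun_rV => i; under eq_fun do rewrite mxE.
exact: measurable_coord.
Qed.

Section lebesgue_rV_succ.
Local Open Scope ereal_scope.
Context n (mu : {sigma_finite_measure set 'rV[R]_n -> \bar R}).

Definition lebesgue_rV_succ : set 'rV[R]_n.+1 -> \bar R :=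
  pushforward (@lebesgue_measure R \x mu) (@rV_cons n).

Let lebesgue0 : lebesgue_rV_succ set0 = 0.
Proof. by rewrite /lebesgue_rV_succ /pushforward preimage_set0 measure0. Qed.

Let lebesgue_ge0 A : 0 <= lebesgue_rV_succ A.
Proof. exact: (measure_ge0 (@lebesgue_measure R \x mu)). Qed.

Let lebesgue_sigma_additive : semi_sigma_additive lebesgue_rV_succ.
Proof.
move=> F mF tF mUF; rewrite /lebesgue_rV_succ /pushforward preimage_bigcup.
have mcons A : measurable A -> measurable (@rV_cons n @^-1` A).
  by move=> mA; rewrite -[X in measurable X]setTI; exact: measurable_rV_cons.
apply: (@measure_semi_sigma_additive _ _ _ (@lebesgue_measure R \x mu)).
- by move=> k; exact: mcons.
- apply/trivIsetP => /= i j _ _ ij; rewrite -preimage_setI.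
  by move/trivIsetP : tF => /(_ _ _ I I ij) ->; rewrite preimage_set0.
- by rewrite -preimage_bigcup; exact: mcons.
Qed.

HB.instance Definition _ := isMeasure.Build _ _ _ lebesgue_rV_succ
  lebesgue0 lebesgue_ge0 lebesgue_sigma_additive.

Let lebesgue_sigma_finite : sigma_finite [set: _] lebesgue_rV_succ.
Proof.
have /sigma_finiteP[F [FT ndF Foo]] := sigma_finiteT (@lebesgue_measure R).
have /sigma_finiteP[G [GT ndG Goo]] := sigma_finiteT mu.
exists (fun k => @rV_uncons n @^-1` (F k `*` G k)).
  apply/seteqP; split=> // v _.
  have [i _ Fi] : (\bigcup_i F i) (rV_uncons v).1 by rewrite -FT.
  have [j _ Gj] : (\bigcup_i G i) (rV_uncons v).2 by rewrite -GT.
  exists (maxn i j) => //; split.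
    by move: Fi; exact/subsetPset/ndF/leq_maxl.
  by move: Gj; exact/subsetPset/ndG/leq_maxr.
move=> k; have [mF Fk] := Foo k; have [mG Gk] := Goo k.
have mFG : measurable (F k `*` G k) by exact: measurableX.
split; first by rewrite -[X in measurable X]setTI; exact: measurable_rV_uncons.
rewrite /lebesgue_rV_succ /pushforward -comp_preimage.
rewrite (_ : (_ \o _) = id); last by apply/funext => z; exact: rV_consK.
by rewrite preimage_id product_measure1E// lte_mul_pinfty// ge0_fin_numE.
Qed.

HB.instance Definition _ := Measure_isSigmaFinite.Build _ _ _ lebesgue_rV_succ
  lebesgue_sigma_finite.

End lebesgue_rV_succ.

(* The n-fold product of the Lebesgue measure of R; see [lebesgue_rV_box] *)
Fixpoint lebesgue_rV n : {sigma_finite_measure set 'rV[R]_n -> \bar R} :=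
  if n is m.+1 then lebesgue_rV_succ (lebesgue_rV m) else \d_ (0 : 'rV[R]_0).

Lemma lebesgue_rV_box n (A : 'I_n -> set (measurableTypeR R)) :
  (forall i, measurable (A i)) ->
  lebesgue_rV n [set v | forall i, A i (v ord0 i)] =
  (\prod_(i < n) @lebesgue_measure R (A i))%E.
Proof.
elim: n A => [|n ih] A mA /=.
  by rewrite big_ord0 diracE mem_set// => -[].
rewrite big_ord_recl -ih; last by move=> i; exact: mA.
rewrite /lebesgue_rV_succ /pushforward -product_measure1E//; last first.
  rewrite [X in measurable X](_ : _ = \bigcap_(i in [set: 'I_n])
    (fun v : 'rV[R]_n => v ord0 i) @^-1` A (lift ord0 i)).
    apply: fin_bigcap_measurable => // i _.
    by rewrite -[X in measurable X]setTI; apply: measurable_coord => //; exact: mA.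
  by apply/seteqP; split=> v /= h i; [move=> _; exact: h|exact: (h i I)].
congr (_ _); apply/seteqP; split=> -[x v] /=.
  move=> h; split=> [|i].
    by have := h ord0; rewrite /rV_cons mxE; case: splitP => //= j _; rewrite mxE.
  have := h (lift ord0 i); rewrite /rV_cons mxE.
  case: splitP => j; first by rewrite (ord1 j).
  by move=> [/ord_inj <-].
move=> [Ax Av] i; rewrite /rV_cons mxE; case: splitP => j ij.
  by rewrite mxE; rewrite (_ : i = ord0)//; apply/val_inj; rewrite /= ij ord1.
by rewrite (_ : i = lift ord0 j)//; apply/val_inj.
Qed.

End rV_lebesgue.

(* Normed module structure on the space [LspaceType mu p1] of almost-everywhere
   equality classes of functions with finite p-norm *)
Section Lspace_normed.
Context d (T : measurableType d) (R : realType).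
Variables (mu : {measure set T -> \bar R}) (p : \bar R) (p1 : (1 <= p)%E).

Notation Lf := (LfunType mu p1).
Notation Ls := (LspaceType mu p1).
Notation mfun_ae := ({mfun_ mu, T >-> measurableTypeR R}).

HB.instance Definition _ := gen_eqMixin Ls.
HB.instance Definition _ := gen_choiceMixin Ls.

Lemma ae_eq_Lnorm (f g : T -> R) :
  measurable_fun [set: T] f -> measurable_fun [set: T] g ->
  f = g %[ae mu] -> 'N[mu]_p[EFin \o f]%E = 'N[mu]_p[EFin \o g]%E.
Proof.
move=> mf mg fg; rewrite unlock /Lnorm; case: p => [r||].
- congr (_ `^ _)%E; apply: ge0_ae_eq_integral => //.
  + apply/measurable_EFinP/(measurableT_comp (measurable_powR _)).
    exact: measurableT_comp.
  + apply/measurable_EFinP/(measurableT_comp (measurable_powR _)).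
    exact: measurableT_comp.
  + by move=> x _; exact: poweR_ge0.
  + by move=> x _; exact: poweR_ge0.
  + by apply: filterS fg => x /(_ I) /= ->.
- case: ifP => // _; apply: ess_sup_inf.eq_ess_sup.
  by apply: filterS fg => x /= /(_ I) ->.
- case: ifP => // _; apply: ess_sup_inf.eq_ess_inf.
  by apply: filterS fg => x /= /(_ I) ->.
Qed.

Lemma measurable_mfun_ae (f : mfun_ae) : measurable_fun [set: T] (f : T -> R).
Proof. exact: (measurable_funPT (repr f)). Qed.

Section Lspace_of.
Variable f : Lf.

Let g : T -> measurableTypeR R := f.
Let mg : measurable_fun [set: T] g.
Proof. exact: (measurable_funPT f). Qed.
HB.instance Definition _ := isMeasurableFun.Build _ _ _ _ g mg.

Definition Lspace_class : mfun_ae :=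
  (\pi_mfun_ae (g : {mfun T >-> measurableTypeR R}))%qT.

Lemma Lspace_class_ae : (Lspace_class : T -> R) = f %[ae mu].
Proof.
have /eqmodP/asboolP : (repr Lspace_class = g %[mod mfun_ae])%qT by rewrite reprK.
exact.
Qed.

Let Lspace_class_finite : finite_norm mu p Lspace_class.
Proof.
rewrite /finite_norm (ae_eq_Lnorm (@measurable_mfun_ae _) _ Lspace_class_ae)//.
exact: Lfunction_finite.
Qed.

HB.instance Definition _ := isFinLebesgue.Build _ _ _ mu p p1 Lspace_class Lspace_class_finite.

Definition Lspace_of : Ls := Lspace_class.

Lemma Lspace_ofE : (Lspace_of : T -> R) = f %[ae mu].
Proof. exact: Lspace_class_ae. Qed.

End Lspace_of.

Section Lfun_of.
Variable f : Ls.
Definition Lspace_rep : T -> R := f.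
Let Lspace_rep_finite : finite_norm mu p Lspace_rep.
Proof. exact: Lebesgue_finite. Qed.
Let mf : measurable_fun [set: T] Lspace_rep.
Proof. exact: measurable_mfun_ae. Qed.
HB.instance Definition _ := isMeasurableFun.Build _ _ _ _ Lspace_rep mf.
HB.instance Definition _ := isLfunction.Build _ _ _ mu p p1 Lspace_rep Lspace_rep_finite.
Definition Lfun_of : Lf := Lspace_rep.
End Lfun_of.

Lemma LspaceP (f g : Ls) : f = g <-> (f : T -> R) = g %[ae mu].
Proof.
split=> [->|fg]; first exact: ae_eq_refl.
have : (f : mfun_ae) = g.
  rewrite -[f : mfun_ae]reprK -[g : mfun_ae]reprK.
  by apply/eqmodP/asboolP.
case: f g {fg} => f [[hf]] [g [[hg]]] /= fg; rewrite fg in hf *.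
by rewrite (Prop_irrelevance hf hg).
Qed.

Lemma Lfun_ofE (f : Ls) : (Lfun_of f : T -> R) = f. Proof. by []. Qed.

Definition Lspace_zero : Ls := Lspace_of 0.
Definition Lspace_opp (f : Ls) : Ls := Lspace_of (- Lfun_of f).
Definition Lspace_add (f g : Ls) : Ls := Lspace_of (Lfun_of f + Lfun_of g).
Definition Lspace_scale (a : R) (f : Ls) : Ls := Lspace_of (a *: Lfun_of f).
Definition Lspace_norm (f : Ls) : R := fine 'N[mu]_p[EFin \o f]%E.

Lemma Lspace_zero_ae : \forall x \ae mu, (Lspace_zero : T -> R) x = 0.
Proof. by apply: filterS (Lspace_ofE 0) => x /(_ I). Qed.

Lemma Lspace_opp_ae f : \forall x \ae mu, (Lspace_opp f : T -> R) x = - f x.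
Proof. by apply: filterS (Lspace_ofE (- Lfun_of f)) => x /(_ I). Qed.

Lemma Lspace_add_ae f g :
  \forall x \ae mu, (Lspace_add f g : T -> R) x = f x + g x.
Proof. by apply: filterS (Lspace_ofE (Lfun_of f + Lfun_of g)) => x /(_ I). Qed.

Lemma Lspace_scale_ae a f :
  \forall x \ae mu, (Lspace_scale a f : T -> R) x = a * f x.
Proof. by apply: filterS (Lspace_ofE (a *: Lfun_of f)) => x /(_ I). Qed.

Lemma Lspace_ext (f g : Ls) : (\forall x \ae mu, f x = g x) -> f = g.
Proof. by move=> fg; apply/LspaceP; apply: filterS fg. Qed.

Let addA : associative Lspace_add.
Proof.
move=> f g h; apply: Lspace_ext.
have h1 := Lspace_add_ae f (Lspace_add g h); have h2 := Lspace_add_ae g h.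
have h3 := Lspace_add_ae (Lspace_add f g) h; have h4 := Lspace_add_ae f g.
near=> x.
by rewrite (near h1 x)// (near h2 x)// (near h3 x)// (near h4 x)// addrA.
Unshelve. all: by end_near. Qed.

Let addC : commutative Lspace_add.
Proof.
move=> f g; apply: Lspace_ext.
by apply: filterS2 (Lspace_add_ae f g) (Lspace_add_ae g f) => x -> ->; rewrite addrC.
Qed.

Let add0 : left_id Lspace_zero Lspace_add.
Proof.
move=> f; apply: Lspace_ext.
by apply: filterS2 (Lspace_add_ae Lspace_zero f) Lspace_zero_ae => x -> ->; rewrite add0r.
Qed.

Let addN : left_inverse Lspace_zero Lspace_opp Lspace_add.
Proof.
move=> f; apply: Lspace_ext.
have := Lspace_add_ae (Lspace_opp f) f; have := Lspace_opp_ae f.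
by have := Lspace_zero_ae; apply: filterS3 => x -> + -> => ->; rewrite addNr.
Qed.

HB.instance Definition _ := GRing.isZmodule.Build Ls addA addC add0 addN.

Let scaleA a b (f : Ls) : Lspace_scale a (Lspace_scale b f) = Lspace_scale (a * b) f.
Proof.
apply: Lspace_ext; have := Lspace_scale_ae (a * b) f.
have := Lspace_scale_ae a (Lspace_scale b f); have := Lspace_scale_ae b f.
by apply: filterS3 => x + -> => -> ->; rewrite mulrA.
Qed.

Let scale1 : left_id 1 Lspace_scale.
Proof.
move=> f; apply: Lspace_ext.
by apply: filterS (Lspace_scale_ae 1 f) => x ->; rewrite mul1r.
Qed.

Let scaleDr : right_distributive Lspace_scale +%R.
Proof.
move=> a f g; apply: Lspace_ext; have h1 := Lspace_scale_ae a (f + g).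
have h2 := Lspace_add_ae f g.
have h3 := Lspace_add_ae (Lspace_scale a f) (Lspace_scale a g).
have h4 := Lspace_scale_ae a f; have h5 := Lspace_scale_ae a g.
near=> x; rewrite (near h1 x)// (near h2 x)// (near h3 x)// (near h4 x)//.
by rewrite (near h5 x)// mulrDr.
Unshelve. all: by end_near. Qed.

Let scaleDl f : {morph Lspace_scale^~ f : a b / a + b}.
Proof.
move=> a b; apply: Lspace_ext; have h1 := Lspace_scale_ae (a + b) f.
have h2 := Lspace_add_ae (Lspace_scale a f) (Lspace_scale b f).
have h3 := Lspace_scale_ae a f; have h4 := Lspace_scale_ae b f.
near=> x; rewrite (near h1 x)// (near h2 x)// (near h3 x)// (near h4 x)//.
by rewrite mulrDl.
Unshelve. all: by end_near. Qed.

HB.instance Definition _ :=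
  GRing.Zmodule_isLmodule.Build R Ls scaleA scale1 scaleDr scaleDl.

Lemma ae_Lspace_norm (f : Ls) (g : Lf) : (\forall x \ae mu, f x = g x) ->
  Lspace_norm f = fine 'N[mu]_p[EFin \o g]%E.
Proof.
move=> fg; rewrite /Lspace_norm (@ae_eq_Lnorm f g)//.
- exact: measurable_mfun_ae.
- by apply: filterS fg.
Qed.

Let ler_Lspace_normD f g : Lspace_norm (f + g) <= Lspace_norm f + Lspace_norm g.
Proof.
rewrite (@ae_Lspace_norm (f + g) (Lfun_of f + Lfun_of g) (Lspace_add_ae _ _)).
exact: ler_LnormD.
Qed.

Let Lspace_normZ (a : R) (f : Ls) : Lspace_norm (a *: f) = `|a| * Lspace_norm f.
Proof.
rewrite (@ae_Lspace_norm (a *: f) (a *: Lfun_of f) (Lspace_scale_ae _ _)).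
rewrite LnormZ fineM// ge0_fin_numE ?Lnorm_ge0//.
exact: Lfunction_finite.
Qed.

Let Lspace_norm0_eq0 (f : Ls) : Lspace_norm f = 0 -> f = 0.
Proof.
move=> f0; apply: Lspace_ext.
have := @fine_Lnormr_eq0 _ _ _ mu p p1 (Lfun_of f) f0.
by have := Lspace_zero_ae; apply: filterS2 => x -> /(_ I).
Qed.

HB.instance Definition _ := Lmodule_isNormed.Build R Ls
  ler_Lspace_normD Lspace_normZ Lspace_norm0_eq0.

Lemma Lspace_normE (f : Ls) : `|f| = fine 'N[mu]_p[EFin \o f]%E.
Proof. by []. Qed.

End Lspace_normed.

Section bochner.
Context (R : realType) (X : normedModType R).
Notation mu := (@lebesgue_measure R).
Implicit Types (D : set R) (f s u v : R -> X).

(* Strong measurability, and integral of Bochner, for functions from (D, Lebesgue)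
   to X, by approximation with simple functions *)
Definition simple_fun s :=
  finite_set (range s) /\ forall x, measurable (s @^-1` [set x]).

(* Meaningful for [D] of finite measure, which is the only case used below *)
Definition simple_integral D s : X :=
  \sum_(x \in range s) fine (mu (D `&` s @^-1` [set x])) *: x.

Definition strongly_measurable D f := exists s_ : nat -> R -> X,
  (forall k, simple_fun (s_ k)) /\
  (forall t, D t -> s_ k t @[k --> \oo] --> f t).

Definition bochner_integral D f (w : X) := exists s_ : nat -> R -> X,
  [/\ forall k, simple_fun (s_ k),
      forall t, D t -> s_ k t @[k --> \oo] --> f t,
      (\int[mu]_(t in D) `|f t - s_ k t|%:E)%E @[k --> \oo] --> 0%E &
      simple_integral D (s_ k) @[k --> \oo] --> w].

(* C^oo functions with compact support in ]0, T[ *)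
Definition test_function (T : R) (phi : R -> R) :=
  (forall k x, derivable (derive1n k phi) x 1) /\
  closure [set x | phi x != 0] `<=` `]0, T[.

Definition weak_derivative (T : R) u v :=
  forall phi, test_function T phi -> exists w,
    bochner_integral `]0, T[ (fun t => derive1 phi t *: u t) w /\
    bochner_integral `]0, T[ (fun t => phi t *: v t) (- w).

Definition L2_time (T : R) u :=
  strongly_measurable `]0, T[ u /\
  (\int[mu]_(t in `]0%R, T[) (`|u t| ^+ 2)%:E < +oo)%E.

(* [u] is (the continuous representative of) an element of H^1([0,T];X), with
   weak derivative [v] *)
Definition H1_time (T : R) u v :=
  [/\ {within `[0, T], continuous u}, L2_time T u, L2_time T v &
      weak_derivative T u v].

Definition H1_norm (T : R) u v : \bar R :=
  ((\int[mu]_(t in `]0%R, T[) (`|u t| ^+ 2)%:E +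
    \int[mu]_(t in `]0%R, T[) (`|v t| ^+ 2)%:E) `^ 2^-1)%E.

(* Convergence in H^1([0,T];X); [v_ n] and [v] are the weak derivatives *)
Definition H1_cvg (T : R) (u_ : nat -> R -> X) u :=
  exists (v_ : nat -> R -> X) v,
  [/\ forall n, H1_time T (u_ n) (v_ n), H1_time T u v &
      H1_norm T (u_ n \- u) (v_ n \- v) @[n --> \oo] --> 0%E].

End bochner.

Section euclidean.
Context (R : realType) (d : nat).
Implicit Types (x y : 'rV[R]_d) (Omega : set 'rV[R]_d).

Definition dotp x y : R := \sum_i x ord0 i * y ord0 i.

(* Needed because [`|x|] on ['rV_d] is the sup norm *)
Definition enorm x : R := Num.sqrt (dotp x x).

(* The volume of the Euclidean unit ball *)
Definition omega : R := fine (lebesgue_rV R d [set x | enorm x < 1]).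

(* Near each boundary point, [Omega] is the part lying above the graph of a
   Lipschitz function defined on the hyperplane orthogonal to a unit vector [e];
   [lipschitz] uses the sup norm, which only affects the Lipschitz constant *)
Definition lipschitz_boundary Omega :=
  forall p, (closure Omega `\` interior Omega) p ->
  exists (e : 'rV[R]_d) (r : R) (gamma : 'rV[R]_d -> R),
  [/\ enorm e = 1, 0 < r,
      [lipschitz gamma y | y in [set y | dotp y e = 0]] &
      forall x, enorm (x - p) < r ->
        Omega x <-> gamma (x - dotp x e *: e) < dotp x e].

Definition riesz_energy Omega (alpha : R) (u : 'rV[R]_d -> R) : R :=
  - \int[lebesgue_rV R d]_(x in Omega) \int[lebesgue_rV R d]_(y in Omega)
      (u x * u y / enorm (x - y) `^ (d%:R - alpha)).

Definition riesz_potential Omega (alpha : R) (u : 'rV[R]_d -> R) x : R :=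
  2 * \int[lebesgue_rV R d]_(y in Omega)
        (u y / enorm (x - y) `^ (d%:R - alpha)).

End euclidean.
Arguments omega : clear implicits.

Section evolution.
Context (R : realType) (d : nat) (Omega : set 'rV[R]_d) (oOmega : open Omega).

Definition lebesgue_on : {measure set 'rV[R]_d -> \bar R} :=
  mrestr (lebesgue_rV R d) (open_measurable_rV oOmega).

Definition L2 : normedModType R := LspaceType2 lebesgue_on.

(* A representative of the class [u]; it is only used up to a.e. equality *)
Definition to_fun (u : L2) : 'rV[R]_d -> R := (u : LspaceType2 lebesgue_on).

(* u_t = A u in L^2(Omega) for a.e. t in (0, T), with u(0) = u0; uniqueness is that
   of the function on [0, T], values of [u] elsewhere being irrelevant *)
Definition is_solution (A : ('rV[R]_d -> R) -> 'rV[R]_d -> R) (T : R)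
    (u0 : L2) (u : R -> L2) :=
  exists v : R -> L2, [/\ H1_time T u v,
    {ae lebesgue_measure, forall t, t \in `]0, T[ ->
      to_fun (v t) = A (to_fun (u t)) %[ae lebesgue_on]} &
    u 0 = u0].

Definition has_unique_solution A T u0 :=
  exists u, is_solution A T u0 u /\
    forall w, is_solution A T u0 w -> {in `[0, T], w =1 u}.

End evolution.

(* Main.v *)
Require Import Defs.
From mathcomp Require Import all_boot all_order all_algebra.
From mathcomp Require Import all_classical all_reals all_analysis.
From mathcomp Require Import measurable_realfun ring lra.

Set Implicit Arguments.
Unset Strict Implicit.
Unset Printing Implicit Defensive.
Import Order.TTheory GRing.Theory Num.Theory.
Import numFieldNormedType.Exports.
Local Open Scope classical_set_scope.
Local Open Scope ring_scope.

(** The right-hand sides of the equations are bounded linear operators of L2(Omega), and the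
   theorem is a statement on linear evolution equations driven by bounded operators, once
   the following is known: the operators B_n, with kernel 2 alpha_n |x - y|^(alpha_n - d),
   are bounded uniformly in n and converge strongly to c = 2 d omega_d times the identity.

   Strong convergence. The integral of |x - y|^(alpha - d) over a ball of radius r is
   d omega_d r^alpha / alpha ([radial_integral], by comparison with geometric shells). So
   the mass of the kernel of B_n on Omega is at most c + O(alpha_n), and Schur's test
   ([kernel_operator]) bounds the norm of B_n by a quantity which tends to c. In the identity
     |B_n f - c f|^2 = |B_n f|^2 - 2 c <B_n f, f> + c^2 |f|^2
   it is then enough that <B_n f, f> tends to c |f|^2 ([scales_to_ip]). For the indicator
   function of an open set W this holds by dominated convergence: a ball around a point of W
   captures, in the limit, the whole mass of the kernel ([riesz_indicator_cvg]). The functions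
   f for which B_n f tends to c f form a closed subspace; as open sets generate the
   sigma-algebra, a monotone class argument ([L2_monotone_class]) shows that this subspace is
   everything. This is [riesz_operators_cvg].

   Evolution equations. A solution with operator -B_n exists as an exponential series
   ([evolves_exists]). Differences of solutions are controlled by Gronwall's lemma for weak
   derivatives ([weak_gronwall]), which gives uniqueness and, applied to u_n - u, bounds
   |u_n - u| by the difference of the initial data plus the residual |B_n u(t) - c u(t)|. As
   u(t) = exp(-ct) u(0), the residual is at most |B_n u(0) - c u(0)| and tends to 0 uniformly
   in time. The equation then gives the convergence of the derivatives, hence convergence in
   H^1 ([evolves_H1_cvg]). The energies are half of the pairings <B_n u_n, u_n>, which tend to
   c |u|^2 because B_n u_n tends to c u ([operator_cvg_seq]).

   Vector-valued integrals are handled by pairing with a fixed vector ([bochner_ip]), which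
   turns weak derivatives into identities between Lebesgue integrals ([weak_ip]). *)

(** * Integrable functions and almost everywhere properties *)

Section real_integrable.
Context d (T : measurableType d) (R : realType) (mu : {measure set T -> \bar R}).
Variables (D : set T) (mD : measurable D).
Implicit Types f g : T -> R.

Lemma eq_integrableR f g : (forall t, D t -> f t = g t) ->
  mu.-integrable D (EFin \o f) -> mu.-integrable D (EFin \o g).
Proof. by move=> fg; apply: eq_integrable => // t /set_mem Dt /=; rewrite fg. Qed.

Lemma integrableRZr f (c : R) : mu.-integrable D (EFin \o f) ->
  mu.-integrable D (EFin \o (fun t => f t * c)).
Proof. by move=> /(integrableZr mD c); apply: eq_integrable. Qed.

Lemma integrableRZl f (c : R) : mu.-integrable D (EFin \o f) ->
  mu.-integrable D (EFin \o (fun t => c * f t)).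
Proof. by move=> /(integrableZl mD c); apply: eq_integrable. Qed.

Lemma integrableRB f g : mu.-integrable D (EFin \o f) ->
  mu.-integrable D (EFin \o g) -> mu.-integrable D (EFin \o (fun t => f t - g t)).
Proof. by move=> fi gi; have := integrableB mD fi gi; apply: eq_integrable. Qed.

Lemma integrableRD f g : mu.-integrable D (EFin \o f) ->
  mu.-integrable D (EFin \o g) -> mu.-integrable D (EFin \o (fun t => f t + g t)).
Proof. by move=> fi gi; have := integrableD mD fi gi; apply: eq_integrable. Qed.

Lemma le_integrableR f g : measurable_fun D f -> (forall t, D t -> `|f t| <= g t) ->
  mu.-integrable D (EFin \o g) -> mu.-integrable D (EFin \o f).
Proof.
move=> mf fg; apply: le_integrable => //; first exact/measurable_EFinP.
by move=> t Dt; rewrite /= lee_fin (le_trans (fg _ Dt))// ler_norm.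
Qed.

(** The filter lemmas on predicates: unification finds [P] and [Q] in hypotheses on
   almost every point, where it does not find sets. *)
Lemma ae_imply (P Q : T -> Prop) : (forall x, P x -> Q x) ->
  {ae mu, forall x, P x} -> {ae mu, forall x, Q x}.
Proof. by move=> PQ; apply: filterS. Qed.

Lemma ae_imply2 (P Q S : T -> Prop) : (forall x, P x -> Q x -> S x) ->
  {ae mu, forall x, P x} -> {ae mu, forall x, Q x} -> {ae mu, forall x, S x}.
Proof. by move=> PQ; apply: filterS2. Qed.

Lemma ae_and (P Q : T -> Prop) : {ae mu, forall x, P x} -> {ae mu, forall x, Q x} ->
  {ae mu, forall x, P x /\ Q x}.
Proof. exact: ae_imply2 (fun _ a b => conj a b). Qed.

Lemma ae_integrableR f g : measurable_fun D g -> {ae mu, forall t, f t = g t} ->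
  mu.-integrable D (EFin \o f) -> mu.-integrable D (EFin \o g).
Proof.
move=> mg fg /integrableP[mf fi]; apply/integrableP; split; first exact/measurable_EFinP.
apply: le_lt_trans fi; rewrite le_eqVlt; apply/orP; left; apply/eqP.
apply: ae_eq_integral => //.
- by apply: measurableT_comp => //; exact/measurable_EFinP.
- exact: measurableT_comp.
- by apply: ae_imply fg => t /= -> .
Qed.

End real_integrable.

(** * Smooth functions of a real variable *)

Section smooth_functions.
Context {R : realType}.
Implicit Types (f g : R -> R) (P Q : {poly R}).

(** Peeling off the first derivative makes the product and chain rules give the
   closure properties by induction on the order. *)
Fixpoint Ck (k : nat) f : Prop :=
  if k is k'.+1 then (forall x, derivable f x 1) /\ Ck k' (derive1 f) else True.

Lemma Ck_derivable f : (forall k, Ck k f) -> forall k x, derivable (derive1n k f) x 1.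
Proof.
move=> fC k; have {fC} := fC k.+1; elim: k f => [f [df _]//|k IH f [_ Cf'] x].
by rewrite derive1Sn; exact: IH.
Qed.

Lemma Ck_pred k f : Ck k.+1 f -> Ck k f.
Proof. by elim: k f => // k IH f [df /IH]. Qed.

Lemma Ck_is_derive k f f' : (forall x : R, is_derive x 1 f (f' x)) -> Ck k f' -> Ck k.+1 f.
Proof.
move=> ff' Cf'; split=> [x|]; first exact: ex_derive.
by rewrite (_ : (derive1 f) = f')//; apply/funext => x; rewrite derive1E derive_val.
Qed.

Lemma Ck_is_derive1 k f (x : R) : Ck k.+1 f -> is_derive x 1 f ((derive1 f) x).
Proof. by move=> [df _]; rewrite derive1E; exact/derivableP/df. Qed.

Lemma CkD k f g : Ck k f -> Ck k g -> Ck k (f \+ g).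
Proof.
elim: k f g => // k IH f g Cf Cg.
apply: (@Ck_is_derive _ _ ((derive1 f) \+ (derive1 g))) => [x|].
  exact: is_deriveD (Ck_is_derive1 x Cf) (Ck_is_derive1 x Cg).
by apply: IH; [case: Cf|case: Cg].
Qed.

Lemma CkM k f g : Ck k f -> Ck k g -> Ck k (f \* g).
Proof.
elim: k f g => // k IH f g Cf Cg.
apply: (@Ck_is_derive _ _ ((f \* (derive1 g)) \+ (g \* (derive1 f)))) => [x|].
  exact: is_deriveM (Ck_is_derive1 x Cf) (Ck_is_derive1 x Cg).
by apply: CkD; apply: IH; do ?[exact: Ck_pred]; [case: Cg|case: Cf].
Qed.

Lemma Ck_cst k (c : R) : Ck k (cst c).
Proof.
case: k => // k; apply: (@Ck_is_derive _ _ (cst 0)) => //.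
by elim: k => // k IH; apply: (@Ck_is_derive _ _ (cst 0)).
Qed.

Lemma is_derive_affine (a b x : R) : is_derive x 1 (fun x : R => a * x + b) a.
Proof.
apply: (is_derive_eq (is_deriveD (is_deriveZ a (is_derive_id x 1)) (is_derive_cst b x 1))).
by rewrite addr0 -[_ *: _]/(a * 1) mulr1.
Qed.

Lemma Ck_affine k f (a b : R) : Ck k f -> Ck k (fun x => f (a * x + b)).
Proof.
elim: k f => // k IH f Cf.
apply: (@Ck_is_derive k (fun x => f (a * x + b)) ((fun x => (derive1 f) (a * x + b)) \* cst a)) => [x|].
  have dg := is_derive_affine a b x.
  have := @is_derive1_comp R f (fun x : R => a * x + b) x _ _ (Ck_is_derive1 (a * x + b) Cf) dg.
  exact.
by apply: CkM; [apply: IH; case: Cf|exact: Ck_cst].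
Qed.

Lemma CkV k f : (forall x, f x != 0) -> Ck k f -> Ck k (fun x => (f x)^-1).
Proof.
move=> f0; elim: k => // k IH Cf.
apply: (@Ck_is_derive _ _ (((fun x => (f x)^-1) \* (fun x => (f x)^-1)) \*
   ((derive1 f) \* cst (-1)))) => [x|].
  apply: is_derive_eq; first exact: (is_deriveV (f0 x) (Ck_is_derive1 x Cf)).
  by rewrite -[_ *: _]/(_ * _) /= mulrN1 mulrN mulNr -exprVn expr2.
have CV := IH (Ck_pred Cf).
by do 2?apply: CkM => //; [case: Cf|exact: Ck_cst].
Qed.

End smooth_functions.

Section flat_functions.
Context {R : realType}.
Implicit Types (P Q : {poly R}).

(** The derivatives of exp(-1/x) have this form, which is why the polynomial factor is
   carried along. *)
Definition flat P (x : R) : R := if 0 < x then P.[x^-1] * expR (- x^-1) else 0.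

(** The bound on a monomial of degree i comes from the term of degree i + 1 in the
   exponential series. *)
Lemma horner_expRN_bound Q :
  exists2 C : R, 0 <= C & forall y, 0 < y -> `|Q.[y] * expR (- y)| <= C * y^-1.
Proof.
exists (\sum_(i < size Q) `|Q`_i| * i.+1`!%:R).
  by apply: sumr_ge0 => i _; rewrite mulr_ge0.
move=> y y0; rewrite horner_coef mulr_suml mulr_suml.
apply: (le_trans (ler_norm_sum _ _ _)); apply: ler_sum => i _.
rewrite !normrM -!mulrA ler_wpM2l// (ger0_norm (expR_ge0 _)) ger0_norm ?exprn_ge0 ?(ltW y0)//.
rewrite expRN ler_pdivlMr// mulrAC -exprSr ler_pdivrMr ?expR_gt0// mulrC -ler_pdivrMr ?ltr0n ?fact_gt0//.
by apply: le_trans (expR_ge1Dxn i (ltW y0)); rewrite lerDr.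
Qed.

Lemma is_derive_cvg (f : R -> R) (a df : R) :
  h^-1 *: (f (h *: 1 + a) - f a) @[h --> 0^'] --> df -> is_derive a 1 f df.
Proof. by move=> H; apply: DeriveDef; [exact: cvgP H|exact: cvg_lim H]. Qed.

(** At 0 the difference quotient is (P X)(1/h) exp(-1/h) for h > 0 and 0 for h < 0;
   it tends to 0 by [horner_expRN_bound]. *)
Lemma is_derive_flat P (x : R) : is_derive x 1 (flat P) (flat ('X^2 * (P - P^`())) x).
Proof.
have [x0|x0|x0] := ltgtP x 0.
- apply: (@near_eq_is_derive _ _ _ (cst 0)).
    near=> y; rewrite /flat ifF//; apply/negbTE; rewrite -leNgt; apply: ltW.
    by near: y; exact: lt_nbhsl.
  by apply: is_derive_eq; rewrite /flat ltNge (ltW x0).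
- have xn0 : x != 0 by rewrite gt_eqF.
  apply: (@near_eq_is_derive _ _ _ (fun x : R => P.[x^-1] * expR (- x^-1))).
    near=> y; rewrite /flat ifT//; near: y; exact: lt_nbhsr.
  have dV := @is_deriveV R id x 1 1 xn0 (is_derive_id _ _).
  have dP := @is_derive1_comp R (horner P) (fun y : R => y^-1) x _ _ (is_derive_poly P x^-1) dV.
  have dE := @is_derive1_comp R expR (fun y : R => - y^-1) x _ _ (is_derive_expR _) (is_deriveN dV).
  apply: (is_derive_eq (is_deriveM dP dE)).
  rewrite /flat x0 !hornerE /= -exprVn -![_ *: _]/(_ * _); ring.
- subst x; have [C C0 hC] := horner_expRN_bound (P * 'X).
  rewrite [X in is_derive _ _ _ X](_ : _ = 0); last by rewrite /flat ltxx.
  apply: is_derive_cvg; apply/cvgr0Pnorm_le => e e0.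
  have Cp : 0 < C + 1 by rewrite ltr_wpDl.
  near=> h.
  have hn0 : h != 0 by near: h; exact: nbhs_dnbhs_neq.
  have he : `|h| <= e / (C + 1).
    near: h; apply: dnbhs0_le; exact: divr_gt0.
  rewrite /flat ltxx subr0 addr0 -![_ *: _]/(_ * _) mulr1.
  case: ifPn => [h0|_]; last by rewrite mulr0 normr0 ltW.
  rewrite mulrA (mulrC h^-1) -[P.[_] * _](_ : (P * 'X).[h^-1] = _); last by rewrite hornerMX.
  apply: (le_trans (hC _ _)); first by rewrite invr_gt0.
  rewrite invrK -(gtr0_norm h0).
  apply: (@le_trans _ _ ((C + 1) * `|h|)); first by rewrite ler_wpM2r// lerDl.
  by rewrite mulrC -ler_pdivlMr.
Unshelve. all: by end_near. Qed.

Lemma Ck_flat k P : Ck k (flat P).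
Proof.
by elim: k P => // k IH P; apply: Ck_is_derive (IH _) => x; exact: is_derive_flat.
Qed.

Lemma flat1_ge0 (x : R) : 0 <= flat 1 x.
Proof. by rewrite /flat; case: ifP; rewrite // hornerC mul1r expR_ge0. Qed.

Lemma flat1_gt0 (x : R) : 0 < x -> 0 < flat 1 x.
Proof. by rewrite /flat => ->; rewrite hornerC mul1r expR_gt0. Qed.

Lemma flat1_eq0 (x : R) : x <= 0 -> flat 1 x = 0.
Proof. by rewrite /flat leNgt => /negbTE ->. Qed.

(** The quotient of flat functions is the usual smooth transition from 0 to 1. *)
Lemma smooth_step : exists S : R -> R,
  [/\ forall k, Ck k S, forall x, x <= 0 -> S x = 0, forall x, 1 <= x -> S x = 1,
      forall x, 0 <= S x <= 1 & forall x, 0 <= derive1 S x].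
Proof.
pose f x : R := flat 1 x; pose g x : R := flat 1 (-1 * x + 1).
have fg0 x : 0 < f x + g x.
  have [x0|x0] := ltP 0 x; first by rewrite ltr_wpDr ?flat1_ge0 ?flat1_gt0.
  by rewrite ltr_wpDl ?flat1_ge0 ?flat1_gt0// mulN1r addrC subr_gt0 (le_lt_trans x0).
have Cf k : Ck k f by exact: Ck_flat.
have Cg k : Ck k g by exact/Ck_affine/Ck_flat.
have CV k : Ck k (fun x => (f x + g x)^-1).
  by apply: CkV; [move=> x; rewrite gt_eqF|exact: CkD].
exists (f \* (fun x => (f x + g x)^-1)); split.
- by move=> k; apply: CkM.
- by move=> x x0; rewrite /= /f flat1_eq0// mul0r.
- move=> x x1; have g0 : g x = 0 by rewrite /g flat1_eq0// mulN1r addrC subr_le0.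
  by have := fg0 x; rewrite /= g0 addr0 => fx0; rewrite divff// gt_eqF.
- move=> x /=; rewrite divr_ge0 ?flat1_ge0 ?(ltW (fg0 x))//=.
  by rewrite ler_pdivrMr// mul1r lerDl flat1_ge0.
move=> x.
have df : is_derive (x : R) 1 f (flat ('X^2 * (1 - (1 : {poly R})^`())) x) := is_derive_flat 1 x.
have dg := @is_derive1_comp R (flat 1) (fun x : R => -1 * x + 1) x _ _ (is_derive_flat 1 _) (is_derive_affine (-1) 1 x).
have d0 y : 0 <= flat ('X^2 * (1 - (1 : {poly R})^`())) y.
  rewrite /flat; case: ifP => // y0; rewrite !hornerE derivC.
  by rewrite !hornerE mulr_ge0 ?expR_ge0//= mulr_ge0 ?sqr_ge0//= subr0.
have fgx : f x + g x != 0 by rewrite gt_eqF.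
have := is_deriveM df (@is_deriveV R (f \+ g) x _ _ fgx (is_deriveD df dg)).
set D := (X in is_derive _ _ _ X).
move=> H; rewrite derive1E (@derive_val _ _ _ _ _ _ _ H) /D -![_ *: _]/(_ * _).
set u := flat _ x; set v := flat _ _; rewrite -/(g x).
have u0 : 0 <= u by exact: d0.
have v0 : 0 <= v by exact: d0.
have F0 : 0 <= f x by exact: flat1_ge0.
have G0 : 0 <= g x by exact: flat1_ge0.
have -> : f x * (- (f x + g x) ^- 2 * (u + v * -1)) + (f x + g x)^-1 * u =
  (f x * v + g x * u) / (f x + g x) ^+ 2 by field.
by rewrite divr_ge0 ?sqr_ge0// addr_ge0// mulr_ge0.
Qed.

End flat_functions.

(** * Test functions *)

Section test_functions.
Context {R : realType}.
Notation mu := (@lebesgue_measure R).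

Definition is_step (S : R -> R) := [/\ forall k, Ck k S,
  forall x, x <= 0 -> S x = 0, forall x, 1 <= x -> S x = 1,
  forall x, 0 <= S x <= 1 & forall x, 0 <= derive1 S x].

Lemma Ck_continuous (f : R -> R) : Ck 1 f -> continuous f.
Proof. by move=> [df _] x; apply: differentiable_continuous; exact/derivable1_diffP. Qed.

Lemma continuous_integrable_itv (f : R -> R) (a b : R) :
  {within `[a, b], continuous f} -> mu.-integrable `[a, b] (EFin \o f).
Proof. by move=> cf; apply: continuous_compact_integrable => //; exact: segment_compact. Qed.

Lemma continuous_integrable_itvoo (f : R -> R) (a b : R) :
  {within `[a, b], continuous f} -> mu.-integrable `]a, b[ (EFin \o f).
Proof.
move=> /continuous_integrable_itv fi; apply: integrableS fi => //.
exact: subset_itv_oo_cc.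
Qed.

Lemma Rintegral_itv_ooE (f : R -> R) (a b : R) :
  {within `[a, b], continuous f} ->
  (\int[mu]_(t in `]a, b[) f t)%R = (\int[mu]_(t in `[a, b]) f t)%R.
Proof.
move=> cf; have fi := continuous_integrable_itv cf.
have sub (b0 b1 : bool) : mu.-integrable [set` Interval (BSide b0 a) (BSide b1 b)] (EFin \o f).
  apply: integrableS fi => //.
  apply: subset_itv; rewrite ?bnd_simp//; by case: b0 b1 => -[].
by rewrite Rintegral_itv_bndo_bndc// Rintegral_itv_obnd_cbnd.
Qed.

Lemma continuous_withinM (A : set R) (f g : R -> R) : continuous f ->
  {within A, continuous g} -> {within A, continuous (fun t => f t * g t)}.
Proof.
move=> cf cg x; apply: continuousM; last exact: cg.
exact: (continuous_subspaceT cf).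
Qed.

Variables (S : R -> R) (stepS : is_step S).

Definition rescaled_step (a e t : R) := S (e^-1 * t + - (e^-1 * a)).

Let Ck_rescaled k a e : Ck k (rescaled_step a e).
Proof. by have [CS _ _ _ _] := stepS; exact: Ck_affine. Qed.

Lemma derive1_rescaled_step a e t :
  derive1 (rescaled_step a e) t = e^-1 * derive1 S (e^-1 * t + - (e^-1 * a)).
Proof.
have [CS _ _ _ _] := stepS; rewrite derive1E mulrC.
apply: (@derive_val _ _ _ _ _ _ _
  (@is_derive1_comp R S (fun t => e^-1 * t + - (e^-1 * a)) t _ _ _ _)).
  exact: Ck_is_derive1 (CS 1%N).
exact: is_derive_affine.
Qed.

Lemma derive1_step_eq0 x : x < 0 \/ 1 < x -> derive1 S x = 0.
Proof.
have [_ S0 S1 _ _] := stepS; rewrite derive1E => -[x0|x1].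
  rewrite (@near_eq_derive _ _ _ S (cst (0 : R))) ?derive_cst//.
  by near=> y; apply/S0/ltW; near: y; exact: lt_nbhsl.
rewrite (@near_eq_derive _ _ _ S (cst (1 : R))) ?derive_cst//.
by near=> y; apply/S1/ltW; near: y; exact: lt_nbhsr.
Unshelve. all: by end_near. Qed.

(** The derivative of a rescaled step is an approximate identity at its foot. *)
Lemma Rintegral_derive_step (T a e c r : R) (h : R -> R) :
  0 <= a -> 0 < e -> a + e <= T -> {within `[0, T], continuous h} ->
  (forall t, a <= t <= a + e -> `|h t - c| <= r) ->
  `|(\int[mu]_(t in `]0%R, T[) (derive1 (rescaled_step a e) t * h t))%R - c| <= r.
Proof.
move=> a0 e0 aeT ch hc; have [CS S0 S1 _ dS] := stepS.
have T0 : 0 < T by rewrite (lt_le_trans _ aeT)// ltr_wpDl.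
set p := derive1 _.
have cp : continuous p by apply: Ck_continuous; have [_] := Ck_rescaled 2 a e.
have p0 t : 0 <= p t by rewrite /p derive1_rescaled_step mulr_ge0// invr_ge0 ltW.
have pout t : ~~ (a <= t <= a + e) -> p t = 0.
  rewrite negb_and -!ltNge => tae; rewrite /p derive1_rescaled_step derive1_step_eq0 ?mulr0//.
  case/orP: tae => [ta|aet]; [left|right]; rewrite -mulrBr mulrC.
    by rewrite pmulr_llt0 ?invr_gt0// subr_lt0.
  by rewrite ltr_pdivlMr// mul1r ltrBrDl.
have ip : mu.-integrable `[0, T] (EFin \o p).
  by apply: continuous_integrable_itv; exact: continuous_subspaceT.
have intp : (\int[mu]_(t in `[0%R, T]) p t)%R = 1.
  rewrite /Rintegral (@continuous_FTC2 _ p (rescaled_step a e))//.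
  - rewrite -EFinB /= /rescaled_step S1 ?S0 ?subr0//.
    + by rewrite mulr0 add0r oppr_le0 mulr_ge0// invr_ge0 ltW.
    + by rewrite -mulrBr mulrC ler_pdivlMr// mul1r lerBrDl.
  - exact: continuous_subspaceT.
  - have cs : continuous (rescaled_step a e) by exact/Ck_continuous/Ck_rescaled.
    split; [by move=> x _; have [] := Ck_rescaled 1 a e| |].
      exact: (cvg_at_right_filter (cs 0)).
    exact: (cvg_at_left_filter (cs T)).
have cph : {within `[0, T], continuous (fun t => p t * h t)} by exact: continuous_withinM.
have iph := continuous_integrable_itv cph.
rewrite Rintegral_itv_ooE//.
have ipc : mu.-integrable `[0, T] (EFin \o (fun t => p t * c)).
  exact: integrableRZr.
have -> : c = (\int[mu]_(t in `[0%R, T]) (p t * c))%R by rewrite RintegralZr// intp mul1r.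
have iphc : mu.-integrable `[0, T] (EFin \o (fun t => p t * h t - p t * c)).
  exact: integrableRB.
rewrite -RintegralB//; apply: (le_trans (le_normr_Rintegral _ _)) => //.
have <- : (\int[mu]_(t in `[0%R, T]) (p t * r))%R = r by rewrite RintegralZr// intp mul1r.
apply: le_Rintegral => //.
- exact: integrable_norm.
- exact: integrableRZr.
move=> t _; rewrite -mulrBr normrM ger0_norm//.
have [tae|/pout ->] := boolP (a <= t <= a + e); last by rewrite !mul0r.
by rewrite ler_wpM2l// hc.
Qed.

(** Testing against a smoothed indicator of [a, b] recovers the increment of a
   continuous function between a and b. *)
Lemma test_function_increment (T a b r : R) (h : R -> R) :
  0 < a -> a < b -> b < T -> 0 < r -> {within `[0, T], continuous h} ->
  exists phi, [/\ test_function T phi, forall t, 0 <= phi t <= 1,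
    forall t, ~~ (a <= t <= b) -> phi t = 0 &
    `|(\int[mu]_(t in `]0%R, T[) (derive1 phi t * h t))%R - (h a - h b)| <= r].
Proof.
move=> a0 ab bT r0 ch; have [CS S0 S1 S01 dS] := stepS.
have T0 : 0 < T by rewrite (lt_trans a0)// (lt_trans ab).
have cont x : 0 < x < T -> {for x, continuous h}.
  by move=> xT; apply: (within_continuous_continuous T0 ch); rewrite in_itv/=.
have [ea ea0 hea] : exists2 e, 0 < e & forall t, a <= t <= a + e -> `|h t - h a| <= r / 2.
  have /cvgrPdist_le/(_ (r/2)) : h x @[x --> a] --> h a.
    by apply: cont; rewrite a0/= (lt_trans ab).
  rewrite divr_gt0// => /(_ isT)/nbhs_ballP[e/= e0 He].
  exists (e / 2); rewrite ?divr_gt0// => t /andP[at1 at2]; rewrite distrC; apply: He.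
  rewrite /ball/= distrC ger0_norm ?subr_ge0// ltrBlDl (le_lt_trans at2)// ltrD2l.
  by rewrite ltr_pdivrMr// ltr_pMr// ltr1n.
have [eb eb0 heb] : exists2 e, 0 < e & forall t, b - e <= t <= b -> `|h t - h b| <= r / 2.
  have /cvgrPdist_le/(_ (r/2)) : h x @[x --> b] --> h b.
    by apply: cont; rewrite bT (lt_trans a0).
  rewrite divr_gt0// => /(_ isT)/nbhs_ballP[e/= e0 He].
  exists (e / 2); rewrite ?divr_gt0// => t /andP[at1 at2]; rewrite distrC; apply: He.
  rewrite /ball/= ger0_norm ?subr_ge0// ltrBlDl -ltrBlDr (lt_le_trans _ at1)// ltrD2l ltrN2.
  by rewrite ltr_pdivrMr// ltr_pMr// ltr1n.
(* narrow enough for the two transitions not to overlap, and for h to vary by at most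
   r / 2 on each *)
pose e := Num.min ((b - a) / 2) (Num.min ea eb).
have e0 : 0 < e by rewrite !lt_min divr_gt0 ?subr_gt0// ea0 eb0.
have eab : e <= (b - a) / 2 by rewrite ge_min lexx.
have eea : e <= ea by rewrite !ge_min lexx ?orbT.
have eeb : e <= eb by rewrite !ge_min lexx ?orbT.
have eab2 : a + e <= b - e by lra.
pose phi := rescaled_step a e \+ (rescaled_step (b - e) e \* cst (-1)).
have Cphi k : Ck k phi.
  by apply: CkD; [|apply: CkM; [|exact: Ck_cst]]; exact: Ck_rescaled.
have stepl c t : t <= c -> rescaled_step c e t = 0.
  by move=> tc; apply: S0; rewrite -mulrBr pmulr_rle0 ?invr_gt0// subr_le0.
have stepr c t : c + e <= t -> rescaled_step c e t = 1.
  by move=> tc; apply: S1; rewrite -mulrBr mulrC ler_pdivlMr// mul1r lerBrDl.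
have phi0 t : ~~ (a <= t <= b) -> phi t = 0.
  rewrite negb_and -!ltNge => /orP[ta|bt]; rewrite /phi/=.
    by rewrite !stepl ?mul0r ?addr0//; lra.
  by rewrite !stepr ?mul1r ?subrr//; lra.
exists phi; split.
- split; first exact: Ck_derivable.
  apply: (@subset_trans _ `[a, b]); last first.
    by move=> t; rewrite /= !in_itv/= => /andP[? ?]; apply/andP; split; lra.
  rewrite closureE => t; apply; split; first exact: interval_closed.
  move=> x /= /eqP phix; rewrite in_itv/=; apply: contra_notT phix; exact: phi0.
- move=> t; rewrite /phi/= mulrN1.
  have [tb|tb] := leP t (b - e); first by rewrite (stepl _ _ tb) subr0; exact: S01.
  rewrite (stepr a); last by lra.
  have /andP[? ?] := S01 (e^-1 * t + - (e^-1 * (b - e))).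
  by rewrite /rescaled_step; apply/andP; split; lra.
- exact: phi0.
have dphi t : derive1 phi t = derive1 (rescaled_step a e) t - derive1 (rescaled_step (b - e) e) t.
  have da := Ck_is_derive1 t (Ck_rescaled 1 a e).
  have db := Ck_is_derive1 t (Ck_rescaled 1 (b - e) e).
  rewrite derive1E (_ : phi = rescaled_step a e - rescaled_step (b - e) e)//; last first.
    by apply/funext => u; rewrite /phi/= mulrN1.
  exact: (@derive_val _ _ _ _ _ _ _ (is_deriveB da db)).
have cda c : continuous (derive1 (rescaled_step c e)).
  by apply: Ck_continuous; have [_] := Ck_rescaled 2 c e.
have Ia c : mu.-integrable `]0, T[ (EFin \o (fun t => derive1 (rescaled_step c e) t * h t)).
  by apply: continuous_integrable_itvoo; exact: continuous_withinM.
under eq_Rintegral do rewrite dphi mulrBl.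
rewrite RintegralB//.
set A := (\int[_]_(_ in _) _)%R; set B := (\int[_]_(_ in _) _)%R.
have -> : A - B - (h a - h b) = (A - h a) - (B - h b) by ring.
apply: (le_trans (ler_normB _ _)).
rewrite [leRHS](splitr r); apply: lerD.
  apply: Rintegral_derive_step => //; [exact: ltW|lra|].
  by move=> t /andP[? ?]; apply: hea; apply/andP; split; lra.
apply: Rintegral_derive_step => //; [lra|lra|].
by move=> t /andP[? ?]; apply: heb; apply/andP; split; lra.
Qed.

End test_functions.

(** * Bochner integrals through scalar ones *)

Section inner_product.
Context {R : realType} {X : normedModType R}.

(** The Cauchy-Schwarz inequality is taken as an axiom: for L2 it is an instance of
   Hoelder's inequality. *)
Definition is_inner (ip : X -> X -> R) :=
  [/\ forall a x x' y, ip (a *: x + x') y = a * ip x y + ip x' y,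
      forall x y, `|ip x y| <= `|x| * `|y| &
      forall x, ip x x = `|x| ^+ 2].

Variables (ip : X -> X -> R) (ipP : is_inner ip).

Lemma ip0 y : ip 0 y = 0.
Proof.
have [_ cs _] := ipP.
by apply/eqP; rewrite -normr_le0 (le_trans (cs _ _))// normr0 mul0r.
Qed.

Lemma ipZ a x y : ip (a *: x) y = a * ip x y.
Proof. by have [ipl _ _] := ipP; rewrite -[a *: x]addr0 ipl ip0 addr0. Qed.

Lemma ipD x x' y : ip (x + x') y = ip x y + ip x' y.
Proof. by have [ipl _ _] := ipP; rewrite -[x]scale1r ipl mul1r scale1r. Qed.

Lemma ipN x y : ip (- x) y = - ip x y.
Proof. by rewrite -scaleN1r ipZ mulN1r. Qed.

Lemma ipB x x' y : ip (x - x') y = ip x y - ip x' y.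
Proof. by rewrite ipD ipN. Qed.

Lemma ip_sum I (r : seq I) (P : pred I) (F : I -> X) y :
  ip (\sum_(i <- r | P i) F i) y = \sum_(i <- r | P i) ip (F i) y.
Proof.
apply: (big_morph (ip^~ y)); last exact: ip0.
by move=> *; exact: ipD.
Qed.

Lemma ip_norm_le x y : `|ip x y| <= `|x| * `|y|. Proof. by have [] := ipP. Qed.

Lemma ip_eq0 x : (forall y, ip x y = 0) -> x = 0.
Proof.
move=> x0; have [_ _ ipxx] := ipP.
by apply/eqP; rewrite -normr_eq0 -sqrf_eq0 -ipxx x0.
Qed.

Lemma ip_inj x x' : (forall y, ip x y = ip x' y) -> x = x'.
Proof.
move=> xx'; apply/eqP; rewrite -subr_eq0; apply/eqP/ip_eq0 => y.
by rewrite ipB xx' subrr.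
Qed.

(** Norms are recovered by duality, which turns an estimate on vectors into one on
   scalar functions. *)
Lemma norm_le_ip x (M : R) : 0 <= M -> (forall y, `|ip x y| <= M * `|y|) -> `|x| <= M.
Proof.
move=> M0 xM; have [_ _ ipxx] := ipP.
have [->|x0] := eqVneq x 0; first by rewrite normr0.
have := xM x; rewrite ipxx ger0_norm ?sqr_ge0// expr2.
by rewrite ler_pM2r// normr_gt0.
Qed.

Lemma cvg_ip T (F : set_system T) {FF : Filter F} (u : T -> X) x y :
  u @ F --> x -> ip (u t) y @[t --> F] --> ip x y.
Proof.
move=> /cvgrPdist_le ux; apply/cvgrPdist_le => e e0.
have y0 : 0 < `|y| + 1 by rewrite ltr_wpDl.
apply: filterS (ux _ (divr_gt0 e0 y0)) => t ute.
rewrite -ipB (le_trans (ip_norm_le _ _))//.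
rewrite (le_trans (ler_wpM2r _ ute))// -mulrA ger_pMr//.
by rewrite mulrC ler_pdivrMr// mul1r lerDl.
Qed.

End inner_product.

Section simple_functions.
Context {R : realType} {X : normedModType R}.
Notation mu := (@lebesgue_measure R).
Implicit Types (s : R -> X).

(** Preimages are finite unions of intersections of level sets of the two simple
   functions, whatever the function applied to their values. *)
Lemma measurable_simple2 s s' (g : X -> X -> R) : simple_fun s -> simple_fun s' ->
  measurable_fun [set: R] (fun t => g (s t) (s' t)).
Proof.
move=> [fs ms] [fs' ms'] _ B _; rewrite setTI.
pose I := [set z : X * X | range s z.1 /\ range s' z.2 /\ B (g z.1 z.2)].
rewrite (_ : _ @^-1` B = \bigcup_(z in I) (s @^-1` [set z.1] `&` s' @^-1` [set z.2])).
  apply: fin_bigcup_measurable.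
    by apply: (sub_finite_set _ (finite_setX fs fs')) => -[x y] [/= ? []].
  by move=> z _; apply: measurableI.
apply/seteqP; split=> [t /= Bt|t [z [_ [_ Bz]] [/= h h']]]; last by rewrite /= h h'.
by exists (s t, s' t).
Qed.

Variables (D : set R) (mD : measurable (D : set (measurableTypeR R))) (Dfin : (mu D < +oo)%E).

Lemma integrable_simple2 s s' (g : X -> X -> R) : simple_fun s -> simple_fun s' ->
  mu.-integrable D (EFin \o (fun t => g (s t) (s' t))).
Proof.
move=> ss ss'; apply: measurable_bounded_integrable => //.
  exact: measurable_funTS (measurable_simple2 g ss ss').
have : finite_set ((fun z : X * X => `|g z.1 z.2|) @` (range s `*` range s')).
  by apply/finite_image/finite_setX; [case: ss|case: ss'].
move=> /finite_seqP[r rE].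
exists (\big[Num.max/0]_(x <- r) x); split; first by rewrite num_real.
move=> M ltM t _ /=; apply: (le_trans _ (ltW ltM)).
apply: (@le_bigmax_seq _ _ _ r 0 `|g (s t) (s' t)| xpredT id) => //.
by change ([set` r] `|g (s t) (s' t)|); rewrite -rE; exists (s t, s' t).
Qed.

Lemma integrable_simple s (g : X -> R) : simple_fun s ->
  mu.-integrable D (EFin \o (fun t => g (s t))).
Proof. by move=> ss; exact: (integrable_simple2 (fun x _ => g x) ss ss). Qed.

End simple_functions.

Section bochner_scalar.
Context {R : realType} {X : normedModType R}.
Notation mu := (@lebesgue_measure R).
Variables (ip : X -> X -> R) (ipP : is_inner ip).
Variables (D : set R) (mD : measurable (D : set (measurableTypeR R))) (Dfin : (mu D < +oo)%E).
Implicit Types (s f : R -> X) (y : X).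

Lemma Rintegral_sum I (r : seq I) (F : I -> R -> R) :
  (forall i, mu.-integrable D (EFin \o F i)) ->
  mu.-integrable D (EFin \o (fun t => \sum_(i <- r) F i t)) /\
  (\int[mu]_(t in D) (\sum_(i <- r) F i t))%R = \sum_(i <- r) (\int[mu]_(t in D) F i t)%R.
Proof.
move=> Fi; elim: r => [|i r [ih1 ih2]].
  split; last by rewrite big_nil; under eq_Rintegral do rewrite big_nil; rewrite Rintegral_cst// mul0r.
  by have := integrable0 mu D; apply: eq_integrable => // t _; rewrite /= big_nil.
split.
  by have := integrableRD mD (Fi i) ih1; apply: eq_integrable => // t _; rewrite /= big_cons.
by under eq_Rintegral do rewrite big_cons; rewrite RintegralD// ih2 big_cons.
Qed.

Lemma ip_simple_integral s y : simple_fun s ->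
  ip (simple_integral D s) y = (\int[mu]_(t in D) ip (s t) y)%R.
Proof.
move=> [fs ms]; rewrite /simple_integral fsbig_finite//= (ip_sum ipP).
pose F x t := ip x y * (s t == x)%:R.
have iF x : mu.-integrable D (EFin \o F x).
  by apply: integrableRZl => //; exact: (integrable_simple mD Dfin (fun z => (z == x)%:R)).
have [_ E] := Rintegral_sum (finmap.enum_fset (fset_set (range s))) iF.
transitivity (\sum_(x <- finmap.enum_fset (fset_set (range s))) (\int[mu]_(t in D) F x t)%R).
  apply: eq_bigr => x _; rewrite (ipZ ipP) mulrC /F RintegralZl//; last first.
    exact: (integrable_simple mD Dfin (fun z => (z == x)%:R)).
  congr *%R; rewrite /Rintegral; congr fine.
  transitivity (\int[mu]_(t in D) (\1_(s @^-1` [set x]) t)%:E)%E.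
    rewrite setIC; apply/esym/integral_indic => //; exact: ms.
  apply: eq_integral => t _.
  rewrite indicE; have [stx|stx] := eqVneq (s t) x; first by rewrite mem_set.
  by rewrite memNset// => /= /eqP; rewrite (negbTE stx).
rewrite -E; apply: eq_Rintegral => t _.
rewrite (bigD1_seq (s t)) ?finmap.fset_uniq//=; last by rewrite in_fset_set// inE; exists t.
by rewrite /F eqxx mulr1 big1 ?addr0// => x /negbTE; rewrite eq_sym => ->; rewrite mulr0.
Qed.

Lemma strongly_measurable_norm f s : strongly_measurable D f -> simple_fun s ->
  measurable_fun D (fun t => `|f t - s t|).
Proof.
move=> [s_ [ss_ fs_]] ss; apply: (measurable_fun_cvg (h := fun k t => `|s_ k t - s t|)).
  by move=> k; apply: measurable_funTS; exact: (measurable_simple2 (fun x x' => `|x - x'|)).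
by move=> t Dt; apply: cvg_norm; apply: cvgB; [exact: fs_|exact: cvg_cst].
Qed.

Lemma strongly_measurable2 f f' (g : X -> X -> R) :
  (forall (u u' : nat -> X) x x', u k @[k --> \oo] --> x -> u' k @[k --> \oo] --> x' ->
    g (u k) (u' k) @[k --> \oo] --> g x x') ->
  strongly_measurable D f -> strongly_measurable D f' ->
  measurable_fun D (fun t => g (f t) (f' t)).
Proof.
move=> gc [s [ss fs]] [s' [ss' fs']].
apply: (measurable_fun_cvg (h := fun k t => g (s k t) (s' k t))).
  by move=> k; apply: measurable_funTS; exact: measurable_simple2.
by move=> t Dt; apply: gc; [exact: fs|exact: fs'].
Qed.

(** Pairing with a fixed vector turns a Bochner integral into a Lebesgue integral;
   as vectors are determined by their pairings, all the identities between Bochner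
   integrals are proved on scalar functions. *)
Lemma bochner_ip f (W : X) y : bochner_integral D f W ->
  mu.-integrable D (EFin \o (fun t => ip (f t) y)) /\
  (\int[mu]_(t in D) ip (f t) y)%R = ip W y.
Proof.
move=> [s [ss fs is0 isW]].
have smf : strongly_measurable D f by exists s.
have mfs k : measurable_fun D (fun t => `|f t - s k t|) by exact: strongly_measurable_norm.
have mipf : measurable_fun D (fun t => ip (f t) y).
  apply: (strongly_measurable2 (g := fun x _ => ip x y) _ smf smf) => u _ x _ ux _.
  exact: cvg_ip.
have ifs : \forall k \near \oo, mu.-integrable D (EFin \o (fun t => `|f t - s k t|)).
  move/fine_cvgP: is0 => [+ _]; apply: filterS => k ik.
  apply/integrableP; split; first by apply/measurable_EFinP; exact: mfs.
  under eq_integral do rewrite /= normr_id.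
  by rewrite ltey_eq ik.
have iips k : mu.-integrable D (EFin \o (fun t => ip (s k t) y)).
  exact: (integrable_simple mD Dfin (fun z => ip z y)).
have iipf : mu.-integrable D (EFin \o (fun t => ip (f t) y)).
  have [k ik] := filter_ex ifs.
  apply: (eq_integrableR mD (f := fun t => ip (f t - s k t) y + ip (s k t) y)).
    by move=> t _; rewrite (ipB ipP) subrK.
  apply: integrableRD => //.
  apply: (le_integrableR mD (g := fun t => `|f t - s k t| * `|y|)).
  - apply: (eq_measurable_fun (fun t => ip (f t) y - ip (s k t) y)).
      by move=> t _; rewrite (ipB ipP).
    by apply: measurable_funB => //; move/integrableP: (iips k) => [/measurable_EFinP].
  - by move=> t _; exact: ip_norm_le.
  - exact: integrableRZr.
split=> //; have cW : ip (simple_integral D (s k)) y @[k --> \oo] --> ip W y by exact: cvg_ip.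
apply: (cvg_unique _ _ cW) => //.
have fs0 : fine (\int[mu]_(t in D) `|f t - s k t|%:E)%E * `|y| @[k --> \oo] --> 0.
  by rewrite -[X in _ --> X](mul0r `|y|); apply: cvgMl; exact: fine_cvg is0.
apply/subr_cvg0; apply: norm_cvg0; apply: (squeeze_cvgr _ (cvg_cst 0) fs0).
apply: filterS ifs => k ik; rewrite normr_ge0/= (ip_simple_integral _ (ss k)) -RintegralB//.
have ib : mu.-integrable D (EFin \o (fun t => ip (s k t) y - ip (f t) y)) by exact: integrableRB.
rewrite (le_trans (le_normr_Rintegral _ ib))//.
rewrite -[X in _ <= X * _]/(Rintegral _ _ _) -RintegralZr//.
apply: le_Rintegral => //; [exact: integrable_norm|exact: integrableRZr|].
by move=> t _; rewrite distrC -(ipB ipP); exact: ip_norm_le.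
Qed.

End bochner_scalar.

Section continuous_bochner.
Context {R : realType} {X : normedModType R}.
Notation mu := (@lebesgue_measure R).
Implicit Types (s f u v : R -> X) (y : X) (T : R).

(** Heine's theorem, from the description of compactness by neighbourhood filters. *)
Lemma uniform_continuity_itv T f e : {within `[0, T], continuous f} -> 0 < e ->
  exists2 c : R, 0 < c & forall t t', 0 <= t <= T -> 0 <= t' <= T ->
    `|t - t'| <= c -> `|f t - f t'| <= e.
Proof.
move=> cf e0; have e20 : 0 < e / 2 by rewrite divr_gt0.
have cov : near_covering_within (`[0, T]%classic : set R).
  by apply/near_covering_withinP/compact_near_coveringP/segment_compact.
have : \forall c \near (0:R)^'+, `[0, T] `<=` [set t | forall t', 0 <= t' <= T ->
    `|t - t'| <= c -> `|f t - f t'| <= e].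
  apply: (cov _ _ (fun c t => forall t', 0 <= t' <= T -> `|t - t'| <= c -> `|f t - f t'| <= e)).
  move=> t tT; move/subspace_continuousP: cf => /(_ t tT)/cvgrPdist_le/(_ _ e20).
  rewrite /within/= => /nbhs_ballP[r/= r0 hr].
  have r20 : 0 < r / 2 by rewrite divr_gt0.
  exists (ball t (r / 2), [set c | c < r / 2]) => /=.
    by split; [exact: nbhsx_ballx|exact: nbhs_right_lt].
  move=> [t1 c] /= [tt1 cr] t1T t' t'T t1t'.
  have h1 : `|f t - f t1| <= e / 2.
    by apply: hr => //; apply: (le_ball _ tt1); rewrite ler_pdivrMr// ler_pMr// ler1n.
  have h2 : `|f t - f t'| <= e / 2.
    apply: hr; last by rewrite /= in_itv.
    rewrite /ball/= (le_lt_trans (ler_distD t1 _ _))// (splitr r) ltrD//.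
    exact: le_lt_trans cr.
  by rewrite (le_trans (ler_distD (f t) _ _))// (splitr e) lerD// distrC.
move=> /(filterI (nbhs_right_gt 0))/filter_ex[c [c0 hc]].
by exists c => // t t' tT t'T; apply: hc => //; rewrite /= in_itv.
Qed.

(** Sampling a continuous function on a fine enough grid gives a simple function
   that is uniformly close to it. *)
Lemma simple_approx T f e : 0 < T -> {within `[0, T], continuous f} -> 0 < e ->
  exists2 s, simple_fun s & forall t, 0 < t < T -> `|f t - s t| <= e.
Proof.
move=> T0 cf e0; have [c c0 hc] := uniform_continuity_itv cf e0.
pose N := (Num.trunc (T / c)).+1.
pose g t := if t \in `]0, T[ then Num.trunc (t / c) else 0%N.
have gN t : (g t < N)%N.
  rewrite /g; case: ifPn => // /itvP tT; rewrite ltnS; apply: le_truncn.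
  by rewrite ler_pM2r ?invr_gt0// tT.
have mg j : measurable (g @^-1` [set j] : set (measurableTypeR R)).
  have mO : measurable (`]0, T[ : set (measurableTypeR R)) by exact: measurable_itv.
  have mj : measurable (`]0, T[ `&` `[j%:R * c, j.+1%:R * c[ : set (measurableTypeR R)).
    by apply: measurableI => //; exact: measurable_itv.
  have E t : t \in `]0, T[ -> (g t = j) <-> (j%:R * c <= t < j.+1%:R * c).
    move=> tT; rewrite /g tT; have tT' := itvP tT.
    rewrite -ler_pdivlMr// -ltr_pdivrMr//; split=> [<-|h].
      by apply: truncn_itv; rewrite divr_ge0// ?tT'// ltW.
    by apply/eqP; rewrite truncn_eq// divr_ge0 ?tT'// ltW.
  have [j0|j0] := eqVneq j 0%N.
    rewrite (_ : _ @^-1` _ = (`]0, T[ `&` `[j%:R * c, j.+1%:R * c[) `|` ~` `]0, T[).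
      by apply: measurableU => //; exact: measurableC.
    apply/seteqP; split=> t /=.
      have [tT gj|tT _] := boolP (t \in `]0, T[); last by right; exact/negP.
      by left; split => //; rewrite in_itv/=; apply/E.
    move=> [[tT]|/negP tT]; first by rewrite in_itv/= => /(E _ tT).
    by rewrite /g (negbTE tT).
  rewrite (_ : _ @^-1` _ = (`]0, T[ `&` `[j%:R * c, j.+1%:R * c[))//.
  apply/seteqP; split=> t /=; last by move=> [tT]; rewrite in_itv/= => /(E _ tT).
  have [tT gj|tT] := boolP (t \in `]0, T[); first by split => //; rewrite in_itv/=; apply/E.
  by rewrite /g (negbTE tT) => /esym/eqP; rewrite (negbTE j0).
exists (fun t => f ((g t)%:R * c)).
  split.
    apply: (@sub_finite_set _ _ ((fun j => f (j%:R * c)) @` `I_N)).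
      by move=> _ [t _ <-]; exists (g t) => //=; exact: gN.
    exact/finite_image/finite_II.
  move=> x; rewrite (_ : _ @^-1` _ =
      \bigcup_(j in [set j | f (j%:R * c) = x]) g @^-1` [set j]).
    by apply: bigcup_measurable => j _; exact: mg.
  by apply/seteqP; split=> [t /= <-|t [j /= <- <-]//]; exists (g t).
move=> t /andP[t0 tT]; have tT' : t \in `]0, T[ by rewrite in_itv/= t0.
have /andP[h1 h2] : (g t)%:R * c <= t < (g t).+1%:R * c.
  rewrite /g tT' -ler_pdivlMr// -ltr_pdivrMr//; apply: truncn_itv.
  by rewrite divr_ge0// ltW.
apply: hc; [by rewrite !ltW|by rewrite mulr_ge0 ?(ltW c0)//= ltW ?(le_lt_trans h1)|].
by rewrite ger0_norm ?subr_ge0// lerBlDr ltW// (lt_le_trans h2)// -natr1 mulrDl mul1r addrC.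
Qed.

Lemma simple_approx_seq T f : 0 < T -> {within `[0, T], continuous f} ->
  exists s : nat -> R -> X, (forall k, simple_fun (s k)) /\
    forall k t, 0 < t < T -> `|f t - s k t| <= 2 ^- k.
Proof.
move=> T0 cf.
have /choice[s sP] : forall k, exists s, simple_fun s /\ forall t, 0 < t < T -> `|f t - s t| <= 2 ^- k.
  move=> k; have k0 : 0 < (2 ^- k : R) by rewrite invr_gt0 exprn_gt0.
  by have [s ? ?] := simple_approx T0 cf k0; exists s.
by exists s; split=> k; [have [] := sP k|have [] := sP k].
Qed.

Lemma cvg_simple_approx_seq (s : nat -> X) x :
  (forall k, `|x - s k| <= 2 ^- k) -> s k @[k --> \oo] --> x.
Proof.
move=> xs; apply/subr_cvg0; apply: norm_cvg0.
apply: (squeeze_cvgr (h := fun k => 2 ^- k)) (cvg_cst 0) _.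
  by near=> k; rewrite normr_ge0/= distrC.
under eq_fun do rewrite -exprVn; apply: cvg_expr.
by rewrite ger0_norm// invf_lt1// ltr1n.
Unshelve. all: by end_near. Qed.

Lemma continuous_strongly_measurable T f : 0 < T -> {within `[0, T], continuous f} ->
  strongly_measurable `]0, T[ f.
Proof.
move=> T0 cf; have [s [ss fs]] := simple_approx_seq T0 cf; exists s; split=> // t tT.
by apply: cvg_simple_approx_seq => k; apply: fs; move: tT; rewrite /= in_itv.
Qed.

End continuous_bochner.

Section continuous_bochner_integral.
Context {R : realType} {X : normedModType R}.
Notation mu := (@lebesgue_measure R).
Variables (ip : X -> X -> R) (ipP : is_inner ip).
Hypothesis complX : forall x : nat -> X, cvgn (series (fun k => `|x k|)) -> cvgn (series x).
Variables (T : R) (T0 : 0 < T).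
Implicit Types (s f u v : R -> X) (y : X).
Notation D := (`]0, T[%classic : set (measurableTypeR R)).

Let mD : measurable D. Proof. exact: measurable_itv. Qed.

Let muD : mu D = T%:E.
Proof. by rewrite lebesgue_measure_itv/= lte_fin T0 sube0. Qed.

Let Dfin : (mu D < +oo)%E. Proof. by rewrite muD ltry. Qed.

Lemma le_norm_simple_integral s s' M : simple_fun s -> simple_fun s' -> 0 <= M ->
  (forall t, D t -> `|s t - s' t| <= M) ->
  `|simple_integral D s - simple_integral D s'| <= M * T.
Proof.
move=> ss ss' M0 ssM; apply: (norm_le_ip ipP); first by rewrite mulr_ge0// ltW.
move=> y; rewrite (ipB ipP) !(ip_simple_integral ipP mD Dfin)//.
have i1 := integrable_simple mD Dfin (fun z => ip z y) ss.
have i2 := integrable_simple mD Dfin (fun z => ip z y) ss'.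
rewrite -RintegralB//.
apply: (le_trans (le_normr_Rintegral _ _)) => //; first exact: integrableRB.
have iM : mu.-integrable D (EFin \o (fun=> M * `|y|)).
  exact: (@integrable_simple _ X D mD Dfin s (fun=> M * `|y|)).
apply: (@le_trans _ _ (\int[mu]_(t in D) (M * `|y|))%R).
  apply: le_Rintegral => //; first exact/integrable_norm/integrableRB.
  move=> t Dt; rewrite -(ipB ipP) (le_trans (ip_norm_le ipP _ _))//.
  by rewrite ler_wpM2r// ssM.
by rewrite Rintegral_cst//= muD/= mulrAC.
Qed.

(** The integrals of simple approximations at distance 2^-k have absolutely summable
   increments, so that completeness provides the integral. *)
Lemma continuous_bochner_integral f : {within `[0, T], continuous f} ->
  exists W, bochner_integral D f W.
Proof.
move=> cf; have [s [ss fs]] := simple_approx_seq T0 cf.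
have fs' k t : D t -> `|f t - s k t| <= 2 ^- k.
  by move=> tT; apply: fs; move: tT; rewrite /= in_itv.
have p0 k : 0 <= (2 ^- k : R) by rewrite invr_ge0 exprn_ge0.
have cgeo (c : R) : (2 ^- k * c : R) @[k --> \oo] --> 0.
  rewrite -[X in _ --> X](mul0r c); apply: cvgMl.
  under eq_fun do rewrite -exprVn; apply: cvg_expr.
  by rewrite ger0_norm// invf_lt1// ltr1n.
have : cvgn (series (fun k => simple_integral D (s k.+1) - simple_integral D (s k))).
  apply: complX; apply: (@series_le_cvg _ _ (geometric (2 * T) 2^-1)) => //=.
  - by move=> k; rewrite mulr_ge0// ?exprn_ge0// mulr_ge0// ltW.
  - move=> k; rewrite mulrAC; apply: le_norm_simple_integral => //.
    move=> t Dt; rewrite (le_trans (ler_distD (f t) _ _))// mulr_natl mulr2n exprVn lerD//.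
      rewrite distrC (le_trans (fs' _ _ Dt))// lef_pV2 ?posrE ?exprn_gt0//.
      by rewrite ler_eXn2l// ltr1n.
    exact: fs'.
  by apply: is_cvg_geometric_series; rewrite ger0_norm// invf_lt1// ltr1n.
rewrite (_ : series _ = fun k => simple_integral D (s k) - simple_integral D (s 0%N)); last first.
  by apply/funext => k; rewrite seriesEnat/= telescope_sumr.
move=> /cvg_ex[W HW]; exists (W + simple_integral D (s 0%N)); exists s; split=> //.
- by move=> t Dt; apply: cvg_simple_approx_seq => k; exact: fs'.
- have fsk0 k : (0 <= \int[mu]_(t in D) `|f t - s k t|%:E)%E by exact: integral_ge0.
  have cT : ((2 ^- k * T : R)%:E) @[k --> \oo] --> 0%E by apply: cvg_EFin; [exact: nearW|exact: cgeo].
  apply: (squeeze_cvge _ (cvg_cst 0%E) cT); apply: nearW => k; rewrite fsk0/=.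
  have smf : strongly_measurable D f.
    by exists s; split=> // t Dt; apply: cvg_simple_approx_seq => j; exact: fs'.
  apply: (@le_trans _ _ (\int[mu]_(t in D) (2 ^- k)%:E)%E); last by rewrite integral_cst//= muD.
  apply: ge0_le_integral => //.
  + by apply/measurable_EFinP; exact: strongly_measurable_norm.
  + by move=> t Dt; rewrite lee_fin fs'.
rewrite (_ : (fun k => simple_integral D (s k)) = (fun k => simple_integral D (s k) -
  simple_integral D (s 0%N) + simple_integral D (s 0%N))); last first.
  by apply/funext => k; rewrite subrK.
by apply: cvgD => //; exact: cvg_cst.
Qed.

(** A function whose pairings have the pairings of v as derivatives has v as its weak
   derivative: both sides of the integration by parts are paired with an arbitrary
   vector, which reduces it to the fundamental theorem of calculus. *)
Lemma weak_derivative_ip u v :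
  {within `[0, T], continuous u} -> {within `[0, T], continuous v} ->
  (forall y (t : R), is_derive t 1 (fun t : R => ip (u t) y) (ip (v t) y)) ->
  weak_derivative T u v.
Proof.
move=> cu cv duv phi [phiC phiT].
have cphi : continuous phi.
  move=> t; apply: differentiable_continuous; apply/derivable1_diffP; exact: (phiC 0%N).
have cdphi : continuous (derive1 phi).
  move=> t; apply: differentiable_continuous; apply/derivable1_diffP; exact: (phiC 1%N).
have cZ (g : R -> R) (w : R -> X) : continuous g -> {within `[0, T], continuous w} ->
    {within `[0, T], continuous (fun t => g t *: w t)}.
  by move=> cg cw t; apply: cvgZ; [exact: (continuous_subspaceT cg)|exact: cw].
have [W HW] := continuous_bochner_integral (cZ _ _ cdphi cu).
have [W' HW'] := continuous_bochner_integral (cZ _ _ cphi cv).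
exists W; split=> //; suff -> : - W = W' by [].
apply: (ip_inj ipP) => y; rewrite (ipN ipP).
have [iW <-] := bochner_ip ipP mD Dfin y HW.
have [iW' <-] := bochner_ip ipP mD Dfin y HW'.
apply/eqP; rewrite eq_sym -addr_eq0 addrC -RintegralD//.
have phi0 t : t = 0 \/ t = T -> phi t = 0.
  move=> t0T; apply/eqP; apply: contrapT => /negP phit.
  have /phiT : closure [set x | phi x != 0] t by exact: subset_closure.
  by rewrite /= in_itv/=; case: t0T => ->; rewrite ltxx// andbF.
pose F t := phi t * ip (u t) y.
pose G t := ip (derive1 phi t *: u t) y + ip (phi t *: v t) y.
have dF (t : R) : is_derive t 1 F (G t).
  have dphi : is_derive t 1 phi (derive1 phi t).
    by rewrite derive1E; apply/derivableP; exact: (phiC 0%N).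
  apply: (is_derive_eq (is_deriveM dphi (duv y t))).
  by rewrite /G !(ipZ ipP) -![_ *: _]/(_ * _) addrC mulrC; congr (_ + _); rewrite mulrC.
have cF : continuous F.
  by move=> t; apply: differentiable_continuous; apply/derivable1_diffP; exact: ex_derive.
have cG : {within `[0, T], continuous G}.
  by move=> t; apply: cvgD; apply: (cvg_ip ipP); [exact: (cZ _ _ cdphi cu)|exact: (cZ _ _ cphi cv)].
rewrite Rintegral_itv_ooE// /Rintegral (@continuous_FTC2 _ G F)//.
- by rewrite /F (phi0 _ (or_introl erefl)) (phi0 _ (or_intror erefl)) !mul0r subee.
- split; [by move=> t _; exact: ex_derive| |].
    exact: (cvg_at_right_filter (cF 0)).
  exact: (cvg_at_left_filter (cF T)).
- by move=> t _; rewrite derive1E derive_val.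
Qed.

Lemma continuous_L2_time u : {within `[0, T], continuous u} -> L2_time T u.
Proof.
move=> cu; have smu := continuous_strongly_measurable T0 cu; split => //.
have cu2 : {within `[0, T], continuous (fun t => `|u t| ^+ 2)}.
  have cn : {within `[0, T], continuous (fun t => `|u t|)}.
    by move=> t; apply: cvg_norm; exact: cu.
  by move=> t; exact: (continuousM (cn t) (cn t)).
have /integrableP[_] := continuous_integrable_itvoo cu2.
by under eq_integral do rewrite /= ger0_norm ?sqr_ge0//.
Qed.

End continuous_bochner_integral.

(** * Stability of evolution equations *)

Section weak_stability.
Context {R : realType} {X : normedModType R}.
Notation mu := (@lebesgue_measure R).
Variables (ip : X -> X -> R) (ipP : is_inner ip).
Variables (T : R) (T0 : 0 < T).
Implicit Types (u v w : R -> X) (y : X).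
Notation D := (`]0, T[%classic : set (measurableTypeR R)).

Let mD : measurable D. Proof. exact: measurable_itv. Qed.

Let Dfin : (mu D < +oo)%E.
Proof. by rewrite lebesgue_measure_itv/= lte_fin T0 sube0 ltry. Qed.

(** The weak derivative tested against a fixed vector; unlike [weak_derivative] it is
   obviously stable under differences. *)
Definition weak_ip u v := forall y phi, test_function T phi ->
  [/\ mu.-integrable D (EFin \o (fun t => derive1 phi t * ip (u t) y)),
      mu.-integrable D (EFin \o (fun t => phi t * ip (v t) y)) &
      (\int[mu]_(t in D) (derive1 phi t * ip (u t) y))%R =
      - (\int[mu]_(t in D) (phi t * ip (v t) y))%R].

Lemma weak_derivative_weak_ip u v : weak_derivative T u v -> weak_ip u v.
Proof.
move=> duv y phi tphi; have [W [HW HW']] := duv _ tphi.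
have [iW EW] := bochner_ip ipP mD Dfin y HW.
have [iW' EW'] := bochner_ip ipP mD Dfin y HW'.
split.
- by apply: eq_integrableR iW => // t _; rewrite (ipZ ipP).
- by apply: eq_integrableR iW' => // t _; rewrite (ipZ ipP).
- under eq_Rintegral do rewrite -(ipZ ipP).
  by under [in RHS]eq_Rintegral do rewrite -(ipZ ipP); rewrite EW EW' (ipN ipP) opprK.
Qed.

Lemma weak_ipB u v u' v' : weak_ip u v -> weak_ip u' v' -> weak_ip (u \- u') (v \- v').
Proof.
move=> uv uv' y phi tphi; have [i1 i2 e] := uv y _ tphi; have [i1' i2' e'] := uv' y _ tphi.
split.
- by apply: eq_integrableR (integrableRB mD i1 i1') => // t _; rewrite (ipB ipP) mulrBr.
- by apply: eq_integrableR (integrableRB mD i2 i2') => // t _; rewrite (ipB ipP) mulrBr.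
- under eq_Rintegral do rewrite (ipB ipP) mulrBr.
  under [in RHS]eq_Rintegral do rewrite (ipB ipP) mulrBr.
  by rewrite !RintegralB// e e' opprB opprK addrC.
Qed.

(** The weak formulation is tested with a smoothed indicator function of [a, b], whose
   derivative recovers the increment of w. *)
Lemma weak_increment_oo w v (a b M : R) : {within `[0, T], continuous w} ->
  weak_ip w v -> 0 < a -> a < b -> b < T -> 0 <= M ->
  {ae mu, forall t, a <= t <= b -> `|v t| <= M} -> `|w b - w a| <= (b - a) * M.
Proof.
move=> cw wv a0 ab bT M0 vM; apply: (norm_le_ip ipP); first by rewrite mulr_ge0// subr_ge0 ltW.
move=> y; have [S stepS] := @smooth_step R.
have ch : {within `[0, T], continuous (fun t => ip (w t) y)}.
  by move=> t; apply: (cvg_ip ipP); exact: cw.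
apply/ler_addgt0Pr => r r0.
have [phi [tphi phi01 phi0 hphi]] := test_function_increment stepS a0 ab bT r0 ch.
have [i1 i2 e] := wv y _ tphi.
set A := (\int[mu]_(t in D) (derive1 phi t * ip (w t) y))%R in hphi e *.
rewrite (ipB ipP) (_ : _ - _ = (A - (ip (w a) y - ip (w b) y)) - A); last by ring.
rewrite (le_trans (ler_normB _ _))// addrC lerD//.
rewrite e normrN.
rewrite (le_trans (le_normr_Rintegral mD i2))//.
have mab : measurable (`[a, b]%classic : set (measurableTypeR R)) by exact: measurable_itv.
have My : 0 <= M * `|y| by rewrite mulr_ge0.
have le1 : (\int[mu]_(t in D) `|phi t * ip (v t) y|%:E <=
    \int[mu]_(t in D) ((M * `|y|)%:E * (\1_(`[a, b]) t)%:E))%E.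
  have /integrableP[mi2 _] := i2.
  apply: ae_ge0_le_integral => //.
  - by apply/measurable_EFinP; apply: measurableT_comp => //; exact/measurable_EFinP.
  - by move=> t _; rewrite mule_ge0// lee_fin.
  - apply: measurable_funeM; apply/measurable_EFinP; exact: measurable_indic.
  apply: ae_imply vM => t vtM _; rewrite -EFinM lee_fin normrM.
  have [tab|tab] := boolP (a <= t <= b).
    rewrite indicE mem_set/= ?in_itv// mulr1.
    have /andP[p0 p1] := phi01 t.
    rewrite (ger0_norm p0) (le_trans (ler_wpM2l p0 (ip_norm_le ipP _ _)))//.
    rewrite -[leRHS]mul1r ler_pM// ?mulr_ge0// ler_wpM2r//; exact: vtM.
  by rewrite phi0// normr0 mul0r mulr_ge0.
have le2 : (\int[mu]_(t in D) ((M * `|y|)%:E * (\1_(`[a, b]) t)%:E) = (M * `|y| * (b - a))%:E)%E.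
  rewrite ge0_integralZl//; last first.
    by apply/measurable_EFinP; exact: measurable_indic.
  rewrite integral_indic// setIidl; last first.
    by move=> t; rewrite /= !in_itv/= => /andP[? ?]; apply/andP; split; lra.
  have muab : mu `[a, b]%classic = (b - a)%:E by rewrite lebesgue_measure_itv/= lte_fin ab -EFinB.
  by rewrite [X in (_ * X)%E](_ : _ = (b - a)%:E)// -EFinM.
rewrite -lee_fin /Rintegral fineK; first by rewrite (le_trans le1)// le2 lee_fin mulrC mulrA.
by apply: integrable_fin_num => //; exact: integrable_norm.
Qed.

(** The endpoints 0 and T, which no test function reaches, are recovered by continuity. *)
Lemma weak_increment w v (a b M : R) : {within `[0, T], continuous w} ->
  weak_ip w v -> 0 <= a -> a <= b -> b <= T -> 0 <= M ->
  {ae mu, forall t, a < t < b -> `|v t| <= M} -> `|w b - w a| <= (b - a) * M.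
Proof.
move=> cw wv a0; rewrite le_eqVlt => /predU1P[-> *|ab bT M0 vM]; first by rewrite !subrr normr0 mul0r.
apply/ler_addgt0Pr => e e0.
have [c c0 hc] := uniform_continuity_itv cw (divr_gt0 e0 (ltr0n _ 2)).
pose m := Num.min c ((b - a) / 3%:R).
have m0 : 0 < m by rewrite lt_min c0 divr_gt0 ?subr_gt0.
have mc : m <= c by rewrite ge_min lexx.
have mab : m <= (b - a) / 3 by rewrite ge_min lexx orbT.
have wa : `|w a - w (a + m)| <= e / 2.
  apply: hc; [apply/andP; split; lra|apply/andP; split; lra|].
  by rewrite opprD addNKr normrN gtr0_norm.
have wb : `|w b - w (b - m)| <= e / 2.
  apply: hc; [apply/andP; split; lra|apply/andP; split; lra|].
  by rewrite opprB addrC subrK gtr0_norm.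
have wab : `|w (b - m) - w (a + m)| <= (b - a) * M.
  apply: (@le_trans _ _ ((b - m - (a + m)) * M)); last by rewrite ler_wpM2r//; lra.
  apply: (weak_increment_oo cw wv) => //; [lra|lra|lra|].
  apply: ae_imply vM => t vt /andP[? ?]; apply: vt; apply/andP; split; lra.
have -> : w b - w a = (w (b - m) - w (a + m)) + ((w b - w (b - m)) - (w a - w (a + m))).
  by rewrite opprB addrACA [w (b - m) + _]addrC subrK addKr.
rewrite (le_trans (ler_normD _ _))// lerD// (le_trans (ler_normB _ _))//.
by rewrite (splitr e) lerD.
Qed.

(** The number of factors 4 is the number of intervals of length at most 1 / (2 C) in
   which [0, T] is divided. *)
Definition gronwall_constant (C : R) : R := 4 ^+ (Num.trunc (2 * C * T)).+1.

(** Gronwall's lemma in a discrete form, which only needs [weak_increment]. On an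
   interval of length dt with C dt <= 1/2, the increment of w is at most half of the
   maximum m of its norm, plus T r; so m is at most twice the sum of the norm of w at the
   left end and of T r, and bounds grow at most by a factor 4 from one interval to the
   next. *)
Lemma weak_gronwall w v (C r : R) : {within `[0, T], continuous w} ->
  weak_ip w v -> 0 <= C -> 0 <= r ->
  {ae mu, forall t, t \in `]0, T[ -> `|v t| <= C * `|w t| + r} ->
  forall t, 0 <= t <= T -> `|w t| <= gronwall_constant C * (`|w 0| + T * r).
Proof.
move=> cw wv C0 r0 vw.
set N := (Num.trunc (2 * C * T)).+1; set E := `|w 0| + T * r.
have E0 : 0 <= E by rewrite addr_ge0// mulr_ge0// ltW.
have TrE : T * r <= E by rewrite lerDr.
pose dt := T / N%:R.
have N0 : 0 < N%:R :> R by rewrite ltr0n.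
have dt0 : 0 < dt by rewrite divr_gt0.
have dtC : dt * C <= 2^-1.
  rewrite /dt mulrAC ler_pdivrMr//.
  have : 2 * C * T < N%:R by exact: truncnS_gt.
  lra.
have dtT : dt <= T.
  by rewrite ler_pdivrMr// ler_peMr ?(ltW T0)// ler1n.
have claim k : (k <= N)%N -> forall t, 0 <= t <= k%:R * dt -> `|w t| <= 4 ^+ k * E.
  elim: k => [_ t|k IH kN t tk].
    rewrite mul0r => t0; have -> : t = 0 by apply/eqP; rewrite eq_le andbC.
    by rewrite expr0 mul1r lerDl mulr_ge0// ltW.
  have {}IH := IH (ltnW kN).
  have kT : k.+1%:R * dt <= T.
    by rewrite /dt mulrCA ger_pMr// ler_pdivrMr// mul1r ler_nat.
  have kdt0 : 0 <= k%:R * dt by rewrite mulr_ge0// ltW.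
  have kS : k.+1%:R * dt = k%:R * dt + dt by rewrite -natr1 mulrDl mul1r.
  have [tk'|tk'] := leP t (k%:R * dt).
    case/andP: tk => t0 _; rewrite (le_trans (IH t _)) ?t0//.
    by rewrite ler_wpM2r// ler_weXn2l// ler1n.
  have cn : {within `[k%:R * dt, k.+1%:R * dt], continuous (fun t => `|w t|)}.
    apply: (@continuous_subspaceW _ _ _ `[0, T]).
      by move=> x /=; rewrite !in_itv/= => /andP[? ?]; apply/andP; split; lra.
    by move=> x; apply: cvg_norm; exact: cw.
  have [|c cI cmax] := EVT_max _ cn; first by rewrite kS lerDl ltW.
  move: cI; rewrite in_itv/= => /andP[ck1 ck2].
  have tc : `|w t| <= `|w c|.
    by apply: cmax; rewrite in_itv/= ltW//=; case/andP: tk.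
  apply: (le_trans tc).
  have wk : `|w (k%:R * dt)| <= 4 ^+ k * E by apply: IH; rewrite kdt0 lexx.
  have inc : `|w c - w (k%:R * dt)| <= (c - k%:R * dt) * (C * `|w c| + r).
    apply: (weak_increment cw wv) => //.
    - lra.
    - by rewrite addr_ge0// mulr_ge0.
    apply: ae_imply vw => x vx /andP[x1 x2].
    have xT : x \in `]0, T[ by rewrite in_itv/=; apply/andP; split; lra.
    rewrite (le_trans (vx xT))// lerD2r ler_wpM2l//; apply: cmax.
    by rewrite in_itv/=; apply/andP; split; lra.
  have inc2 : `|w c - w (k%:R * dt)| <= 2^-1 * `|w c| + E.
    apply: (le_trans inc); apply: (@le_trans _ _ (dt * (C * `|w c| + r))).
      rewrite ler_wpM2r ?addr_ge0 ?mulr_ge0//; lra.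
    rewrite mulrDr lerD// ?mulrA ?ler_wpM2r//.
    by apply: le_trans TrE; rewrite ler_wpM2r.
  have : `|w c| <= 4 ^+ k * E + (2^-1 * `|w c| + E).
    by rewrite -{1}(subrK (w (k%:R * dt)) (w c)) (le_trans (ler_normD _ _))// addrC lerD.
  have : 1 * E <= 4 ^+ k * E by rewrite ler_wpM2r// exprn_ege1// ler1n.
  rewrite exprS; lra.
move=> t tT; apply: (claim N) => //.
by rewrite /dt mulrC divfK// gt_eqF.
Qed.

End weak_stability.

(** * The exponential of a bounded operator *)

Section exponential_power_series.
Context {R : realType}.
Implicit Types (a : nat -> R) (A C : R).

(** Paired with a fixed vector, the exponential series of an operator of norm at most C
   becomes a real power series with such coefficients. *)
Definition exp_bounded A C a := forall k, `|a k| <= A * (C ^+ k / k`!%:R).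

Lemma is_cvg_exp_bounded A C a x : 0 <= A -> 0 <= C -> exp_bounded A C a ->
  cvgn (pseries a x).
Proof.
move=> A0 C0 aAC; apply: normed_cvg; rewrite /normed_series_of /=.
apply: (@series_le_cvg _ _ (A *: exp_coeff (C * `|x|))) => //.
- by move=> k; rewrite mulr_ge0// divr_ge0// exprn_ge0// mulr_ge0.
- move=> k; rewrite normrM normrX (le_trans (ler_wpM2r _ (aAC k)))//.
  rewrite -[leRHS]/(A * ((C * `|x|) ^+ k / k`!%:R)) exprMn.
  by rewrite -!mulrA (mulrC _^-1) !mulrA.
exact/is_cvg_seriesZ/is_cvg_series_exp_coeff.
Qed.

Lemma exp_bounded_diffs A C a : exp_bounded A C a ->
  exp_bounded (A * C) C (pseries_diffs a).
Proof.
move=> aAC k; rewrite /pseries_diffs normrM normr_nat.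
rewrite (le_trans (ler_wpM2l _ (aAC k.+1)))// factS exprS natrM.
have k1 : k.+1%:R != 0 :> R by rewrite pnatr_eq0.
have kf : k`!%:R != 0 :> R by rewrite pnatr_eq0 -lt0n fact_gt0.
rewrite le_eqVlt; apply/orP; left; apply/eqP.
by move: (k.+1%:R : R) (k`!%:R : R) k1 kf => p q p0 q0; field; rewrite ?p0 ?q0.
Qed.

Lemma is_derive_exp_bounded A C a (x : R) : 0 <= A -> 0 <= C -> exp_bounded A C a ->
  is_derive x 1 (fun x : R => limn (pseries a x)) (limn (pseries (pseries_diffs a) x)).
Proof.
move=> A0 C0 aAC; have aAC1 := exp_bounded_diffs aAC.
have aAC2 := exp_bounded_diffs aAC1.
have AC0 : 0 <= A * C by rewrite mulr_ge0.
apply: (@pseries_snd_diffs _ _ (`|x| + 1)).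
- exact: is_cvg_exp_bounded aAC.
- exact: is_cvg_exp_bounded aAC1.
- by apply: is_cvg_exp_bounded aAC2 => //; rewrite mulr_ge0.
- by rewrite [ltRHS]ger0_norm ?addr_ge0// ltrDl.
Qed.

End exponential_power_series.

Section bounded_generator.
Context {R : realType} {X : normedModType R}.
Variables (ip : X -> X -> R) (ipP : is_inner ip).
Hypothesis complX : forall x : nat -> X, cvgn (series (fun k => `|x k|)) -> cvgn (series x).
Variables (B : X -> X) (C : R).
Hypothesis Blin : forall a x y, B (a *: x + y) = a *: B x + B y.
Hypotheses (C0 : 0 <= C) (Bbound : forall x, `|B x| <= C * `|x|).

Lemma bounded_linear0 : B 0 = 0.
Proof. by apply/eqP; rewrite -normr_le0 (le_trans (Bbound _))// normr0 mulr0. Qed.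

Lemma bounded_linearZ a x : B (a *: x) = a *: B x.
Proof. by rewrite -[a *: x]addr0 Blin bounded_linear0 addr0. Qed.

Lemma bounded_linearD x y : B (x + y) = B x + B y.
Proof. by rewrite -[x in LHS]scale1r Blin scale1r. Qed.

Lemma bounded_linearB x y : B (x - y) = B x - B y.
Proof. by rewrite bounded_linearD -scaleN1r bounded_linearZ scaleN1r. Qed.

Lemma bounded_linear_sum I (r : seq I) (P : pred I) (F : I -> X) :
  B (\sum_(i <- r | P i) F i) = \sum_(i <- r | P i) B (F i).
Proof.
apply: (big_morph B); last exact: bounded_linear0.
by move=> *; exact: bounded_linearD.
Qed.

Lemma bounded_linear_cvg T (F : set_system T) {FF : Filter F} (u : T -> X) x :
  u @ F --> x -> B (u t) @[t --> F] --> B x.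
Proof.
move=> /cvgrPdist_le ux; apply/cvgrPdist_le => e e0.
have C1 : 0 < C + 1 by rewrite ltr_wpDl.
apply: filterS (ux _ (divr_gt0 e0 C1)) => t ute.
rewrite -bounded_linearB (le_trans (Bbound _))//.
rewrite (le_trans (ler_wpM2l _ ute))// mulrCA ger_pMr//.
by rewrite ler_pdivrMr// mul1r lerDl.
Qed.

Variable x0 : X.

Let c k : X := (k`!%:R)^-1 *: iter k B x0.
Let us t : nat -> X := series (fun k => t ^+ k *: c k).
Definition exp_generator t : X := limn (us t).

Let iter_bound k : `|iter k B x0| <= C ^+ k * `|x0|.
Proof.
elim: k => [|k IH]; first by rewrite expr0 mul1r.
by rewrite (le_trans (Bbound _))// exprS -mulrA ler_wpM2l.
Qed.

Let c_bound k : `|c k| <= `|x0| * (C ^+ k / k`!%:R).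
Proof.
rewrite normrZ ger0_norm ?invr_ge0// mulrC mulrA ler_wpM2r ?invr_ge0// mulrC.
exact: iter_bound.
Qed.

Let Bc k : B (c k) = k.+1%:R *: c k.+1.
Proof.
rewrite bounded_linearZ /c scalerA factS natrM invfM mulrA divff ?pnatr_eq0//.
by rewrite mul1r.
Qed.

Let cvg_us t : us t @ \oo --> exp_generator t.
Proof.
apply: complX; have := @is_cvg_exp_bounded _ `|x0| C (fun k => `|c k|) `|t| (normr_ge0 _) C0.
rewrite (_ : pseries _ _ = series (fun k => `|t ^+ k *: c k|)); first apply.
  by move=> k; rewrite normr_id.
by congr series; apply/funext => k; rewrite normrZ normrX mulrC.
Qed.

Let ip_coeff y k := ip (c k) y.

Let ip_coeff_bounded y : exp_bounded (`|x0| * `|y|) C (ip_coeff y).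
Proof.
move=> k; rewrite (le_trans (ip_norm_le ipP _ _))// mulrAC ler_wpM2r//.
Qed.

Let ip_exp y t : ip (exp_generator t) y = limn (pseries (ip_coeff y) t).
Proof.
apply/esym/cvg_lim => //.
rewrite (_ : pseries (ip_coeff y) t = (fun k => ip (us t k) y)).
  exact: (cvg_ip ipP (@cvg_us t)).
apply/funext => k; rewrite /us /pseries !seriesEnat/= (ip_sum ipP).
by apply: eq_bigr => i _; rewrite (ipZ ipP) mulrC.
Qed.

Let ip_Bexp y t : ip (B (exp_generator t)) y = limn (pseries (pseries_diffs (ip_coeff y)) t).
Proof.
apply/esym/cvg_lim => //.
rewrite (_ : pseries (pseries_diffs (ip_coeff y)) t = (fun k => ip (B (us t k)) y)).
  exact: (cvg_ip ipP (bounded_linear_cvg (@cvg_us t))).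
apply/funext => k; rewrite /us /pseries !seriesEnat/= bounded_linear_sum (ip_sum ipP).
apply: eq_bigr => i _; rewrite bounded_linearZ Bc (ipZ ipP) [in RHS](ipZ ipP).
by rewrite /pseries_diffs /ip_coeff mulrC.
Qed.

(** Only the pairings are differentiated: these are real power series, and this is
   enough for the weak derivative. *)
Lemma is_derive_exp_generator y (t : R) :
  is_derive t 1 (fun t : R => ip (exp_generator t) y) (ip (B (exp_generator t)) y).
Proof.
rewrite ip_Bexp (_ : (fun t => ip _ _) = (fun t => limn (pseries (ip_coeff y) t))).
  exact: is_derive_exp_bounded (@ip_coeff_bounded y).
by apply/funext => s; rewrite ip_exp.
Qed.

Lemma exp_generator0 : exp_generator 0 = x0.
Proof.
apply: cvg_lim => //; rewrite -(cvg_shiftn 1%N)/=.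
rewrite (_ : (fun n => _) = (fun=> x0)); first exact: cvg_cst.
apply/funext => n; rewrite addn1 /us seriesEnat/= big_nat_recl//= big1 ?addr0.
  by rewrite expr0 scale1r /c fact0 invr1 scale1r.
by move=> i _; rewrite expr0n/= scale0r.
Qed.

Lemma exp_generator_bound (L t : R) : `|t| <= L -> `|exp_generator t| <= `|x0| * expR (C * L).
Proof.
move=> tL; have cn : `|us t n| @[n --> \oo] --> `|exp_generator t| by apply: cvg_norm.
apply: (cvgr_to_le cn); near=> n; rewrite /us seriesEnat/=.
apply: (le_trans (ler_norm_sum _ _ _)).
have L0 : 0 <= L by exact: le_trans tL.
apply: (@le_trans _ _ (`|x0| * series (exp_coeff (C * L)) n)).
  rewrite seriesEnat/= mulr_sumr; apply: ler_sum => k _.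
  rewrite normrZ normrX.
  apply: (@le_trans _ _ (L ^+ k * (`|x0| * (C ^+ k / k`!%:R)))).
    by apply: ler_pM => //; rewrite ?exprn_ge0// lerXn2r// nnegrE.
  by rewrite /exp_coeff/= exprMn mulrCA !mulrA (mulrAC _ (L ^+ k)) (mulrAC _ (L ^+ k)).
rewrite ler_wpM2l// /expR; apply: nondecreasing_cvgn_le; last exact: is_cvg_series_exp_coeff.
apply: nondecreasing_series => k _ _.
by rewrite /exp_coeff/= divr_ge0// exprn_ge0// mulr_ge0.
Unshelve. all: by end_near. Qed.

(** The mean value theorem bounds the increments of all the pairings uniformly, so that
   [norm_le_ip] gives continuity for the norm. *)
Lemma continuous_exp_generator : continuous exp_generator.
Proof.
move=> t; pose L := `|t| + 1; pose M := C * (`|x0| * expR (C * L)).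
have M0 : 0 <= M by rewrite !mulr_ge0// expR_ge0.
have lip s s' : s <= s' -> `|s| <= L -> `|s'| <= L ->
    `|exp_generator s - exp_generator s'| <= M * `|s - s'|.
  move=> ss' sL s'L; apply: (norm_le_ip ipP); first by rewrite mulr_ge0.
  move=> y; rewrite (ipB ipP) distrC.
  have cip : {within `[s, s'], continuous (fun t : R => ip (exp_generator t) y)}.
    apply: continuous_subspaceT => r; apply: differentiable_continuous.
    by apply/derivable1_diffP; have := is_derive_exp_generator y r => ?; exact: ex_derive.
  have [r rss' ->] := MVT_segment ss' (fun r _ => is_derive_exp_generator y r) cip.
  rewrite normrM distrC (mulrAC M) ler_wpM2r//.
  rewrite (le_trans (ip_norm_le ipP _ _))// ler_wpM2r// (le_trans (Bbound _))//.
  rewrite ler_wpM2l//; apply: exp_generator_bound.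
  move: rss' sL s'L; rewrite in_itv/= => /andP[sr rs'] /ler_normlP[h1 h2] /ler_normlP[h3 h4].
  by apply/ler_normlP; split; lra.
apply/cvgrPdist_le => e e0.
have M1 : 0 < M + 1 by rewrite ltr_wpDl.
near=> s.
have ts : `|t - s| <= e / (M + 1).
  by near: s; apply: cvgr_dist_le; [exact: cvg_id|exact: divr_gt0].
have ts1 : `|t - s| <= 1 by near: s; apply: cvgr_dist_le; [exact: cvg_id|].
have sL : `|s| <= L.
  by rewrite -(subrK t s) (le_trans (ler_normD _ _))// addrC lerD// distrC.
have tL : `|t| <= L by rewrite lerDl.
have : `|exp_generator t - exp_generator s| <= M * `|t - s|.
  have [st|/ltW st] := leP t s; first exact: lip.
  by rewrite distrC (distrC t); exact: lip.
move/le_trans; apply; apply: (@le_trans _ _ ((M + 1) * `|t - s|)).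
  by rewrite ler_wpM2r// lerDl.
by rewrite mulrC -ler_pdivlMr.
Unshelve. all: by end_near. Qed.

Lemma bounded_generator_solution (T : R) : 0 < T ->
  H1_time T exp_generator (fun t => B (exp_generator t)).
Proof.
move=> T0; have cu : {within `[0, T], continuous exp_generator}.
  exact/continuous_subspaceT/continuous_exp_generator.
have cv : {within `[0, T], continuous (fun t => B (exp_generator t))}.
  by move=> t; apply: bounded_linear_cvg; exact: cu.
split=> //; [exact: (continuous_L2_time T0)|exact: (continuous_L2_time T0)|].
apply: (weak_derivative_ip ipP) => // y t; exact: is_derive_exp_generator.
Qed.

End bounded_generator.

(** * The Hilbert space structure of L2 *)

Section L2_space.
Context d (T : measurableType d) (R : realType) (mu : {measure set T -> \bar R}).
Notation Ls := (LspaceType2 mu).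
Implicit Types (F G : Ls) (f g : T -> R).

Definition L2_fun F : T -> R := F.

Lemma measurable_L2_fun F : measurable_fun [set: T] (L2_fun F).
Proof. exact: measurable_mfun_ae. Qed.

Let Lfun_L2 F : L2_fun F \in Lfun mu 2%:E.
Proof. exact: (LfunP (Lfun_of F)). Qed.

Lemma integrable_L2M F G : mu.-integrable setT (EFin \o (fun t => L2_fun F t * L2_fun G t)).
Proof. exact/Lfun1_integrable/Lfun2_mul_Lfun1. Qed.

Lemma norm_L2E F : (`|F : Ls| ^+ 2)%:E = (\int[mu]_t (L2_fun F t ^+ 2)%:E)%E.
Proof.
rewrite Lspace_normE.
have fin : ('N[mu]_2%:E[EFin \o L2_fun F] \is a fin_num)%E.
  by rewrite ge0_fin_numE ?Lnorm_ge0//; exact: Lebesgue_finite.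
rewrite EFin_expe fineK//.
have -> : ('N[mu]_2%:E[EFin \o L2_fun F] ^+ 2 = 'N[mu]_2%:E[EFin \o L2_fun F] `^ 2)%E.
  by rewrite -(fineK fin) -EFin_expe poweR_EFin powR_mulrn ?fine_ge0 ?Lnorm_ge0.
rewrite poweR_Lnorm//; apply: eq_integral => t _.
by rewrite [`|_|%E]/= poweR_EFin powR_mulrn// real_normK ?num_real.
Qed.

Lemma norm_L2_ae F f : measurable_fun [set: T] f -> {ae mu, forall t, L2_fun F t = f t} ->
  (`|F : Ls| ^+ 2)%:E = (\int[mu]_t (f t ^+ 2)%:E)%E.
Proof.
move=> mf Ff; rewrite norm_L2E; apply: ge0_ae_eq_integral => //.
- by apply/measurable_EFinP; apply: measurable_funX; exact: measurable_L2_fun.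
- by apply/measurable_EFinP; exact: measurable_funX.
- by move=> t _; rewrite lee_fin sqr_ge0.
- by move=> t _; rewrite lee_fin sqr_ge0.
by apply: ae_imply Ff => t /= -> .
Qed.

(** Classes are produced from functions with integrable square; operators on L2 are built
   in this way, by choice. *)
Lemma L2_exists f : measurable_fun [set: T] f -> (\int[mu]_t (f t ^+ 2)%:E < +oo)%E ->
  exists F, {ae mu, forall t, L2_fun F t = f t}.
Proof.
move=> mf f2; have fL : f \in Lfun mu 2%:E.
  rewrite inE; apply/andP; split; rewrite inE//= /finite_norm unlock /Lnorm.
  apply: poweR_lty.
  by under eq_integral do rewrite [`|_|%E]/= poweR_EFin powR_mulrn// real_normK ?num_real//.
exists (Lspace_of (Lfun_Sub (lee1n 2) fL)).
by apply: ae_imply (Lspace_ofE (Lfun_Sub (lee1n 2) fL)) => t /(_ I).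
Qed.

Lemma L2_ext F G : {ae mu, forall t, L2_fun F t = L2_fun G t} -> F = G.
Proof. exact: Lspace_ext. Qed.

Lemma L2_add_ae F G : {ae mu, forall t, L2_fun (F + G) t = L2_fun F t + L2_fun G t}.
Proof. exact: Lspace_add_ae. Qed.

Lemma L2_opp_ae F : {ae mu, forall t, L2_fun (- F) t = - L2_fun F t}.
Proof. exact: Lspace_opp_ae. Qed.

Lemma L2_sub_ae F G : {ae mu, forall t, L2_fun (F - G) t = L2_fun F t - L2_fun G t}.
Proof. by apply: ae_imply2 (L2_add_ae F (- G)) (L2_opp_ae G) => t -> ->. Qed.

Lemma L2_scale_ae (a : R) F : {ae mu, forall t, L2_fun (a *: F) t = a * L2_fun F t}.
Proof. exact: Lspace_scale_ae. Qed.

Lemma L2_zero_ae : {ae mu, forall t, L2_fun 0 t = 0}.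
Proof. exact: Lspace_zero_ae. Qed.

Lemma L2_sum_ae (F : nat -> Ls) n :
  {ae mu, forall t, L2_fun (series F n) t = series (fun k => L2_fun (F k) t) n}.
Proof.
elim: n => [|n IH].
  by apply: ae_imply L2_zero_ae => t; rewrite !seriesEnat/= !big_geq.
apply: ae_imply2 IH (L2_add_ae (series F n) (F n)) => t.
by rewrite !seriesEnat/= !big_nat_recr//= => -> ->.
Qed.

Definition L2_ip F G : R := (\int[mu]_t (L2_fun F t * L2_fun G t))%R.

(** Cauchy-Schwarz is Hoelder's inequality with both exponents equal to 2. *)
Lemma L2_inner : @is_inner R (Ls : normedModType R) L2_ip.
Proof.
split.
- move=> a F F' G; rewrite /L2_ip -RintegralZl//; last exact: integrable_L2M.
  rewrite -RintegralD//; [|exact/integrableRZl/integrable_L2M|exact: integrable_L2M].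
  congr fine; apply: ae_eq_integral => //.
  + by apply/measurable_EFinP; apply: measurable_funM; exact: measurable_L2_fun.
  + apply/measurable_EFinP; apply: measurable_funD; last first.
      by apply: measurable_funM; exact: measurable_L2_fun.
    apply: measurable_funM => //.
    by apply: measurable_funM; exact: measurable_L2_fun.
  apply: ae_imply2 (L2_add_ae (a *: F) F') (L2_scale_ae a F) => t -> -> _.
  by rewrite mulrDl mulrA.
- move=> F G; rewrite -lee_fin EFinM /L2_ip EFin_normr_Rintegral//; last exact: integrable_L2M.
  have /integrableP[mFG _] := integrable_L2M F G.
  apply: (le_trans (le_abse_integral _ _ _)) => //.
  have := hoelder mu (measurable_L2_fun F) (measurable_L2_fun G) (ltr0n _ 2) (ltr0n _ 2).
  move=> /(_ _); rewrite Lnorm1 => h.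
  have e1 : (2^-1 + 2^-1 = 1 :> R) by lra.
  rewrite !Lspace_normE !fineK ?ge0_fin_numE ?Lnorm_ge0//; try exact: Lebesgue_finite.
  exact: h.
- move=> F; apply/EFin_inj; rewrite norm_L2E /L2_ip /Rintegral fineK; last first.
    by apply: integrable_fin_num => //; exact: integrable_L2M.
  by apply: eq_integral => t _; rewrite expr2.
Qed.

(** Dominated convergence for the squares of the differences, which are at most 4 G. *)
Lemma L2_dominated_cvg (f_ : nat -> T -> R) (f G : T -> R) (Fn : nat -> Ls) (F : Ls) :
  (forall n, measurable_fun [set: T] (f_ n)) -> measurable_fun [set: T] f ->
  (forall t, f_ n t @[n --> \oo] --> f t) ->
  mu.-integrable setT (EFin \o G) -> (forall n t, f_ n t ^+ 2 <= G t) ->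
  (forall n, {ae mu, forall t, L2_fun (Fn n) t = f_ n t}) ->
  {ae mu, forall t, L2_fun F t = f t} ->
  Fn n @[n --> \oo] --> F.
Proof.
move=> mf_ mf cf iG f_G FnE FE; apply/subr_cvg0.
have fG t : f t ^+ 2 <= G t.
  have c2 : f_ n t ^+ 2 @[n --> \oo] --> f t ^+ 2.
    by rewrite expr2; under eq_fun do rewrite expr2; exact: cvgM.
  by apply: (cvgr_to_le c2); exact: nearW.
have dif n : {ae mu, forall t, L2_fun (Fn n - F) t = f_ n t - f t}.
  by apply: ae_imply (ae_and (ae_and (FnE n) FE) (L2_sub_ae (Fn n) F)) => t [[-> ->]].
have nE n : (`|Fn n - F| ^+ 2)%:E = (\int[mu]_t ((f_ n t - f t) ^+ 2)%:E)%E.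
  by apply: norm_L2_ae (dif n); exact: measurable_funB.
have lim0 : (\int[mu]_t ((f_ n t - f t) ^+ 2)%:E)%E @[n --> \oo] --> (\int[mu]_t (cst 0%E t))%E.
  apply: (@dominated_cvg _ _ _ mu setT measurableT (fun n t => ((f_ n t - f t) ^+ 2)%:E) (cst 0%E)
    (fun t => (4 * G t)%:E)) => //.
  - by move=> n; apply/measurable_EFinP; apply: measurable_funX; exact: measurable_funB.
  - move=> t _; apply: cvg_EFin; first exact: nearW.
    have d0 : f_ n t - f t @[n --> \oo] --> 0 by apply/subr_cvg0.
    rewrite -(mulr0 0); exact: (cvgM d0 d0).
  - exact: integrableRZl.
  - move=> n t _; rewrite /= lee_fin ger0_norm ?sqr_ge0//.
    have := f_G n t; have := fG t; nra.
rewrite integral0 in lim0.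
apply/cvgr0Pnorm_le => e e0.
have e2 : 0 < e ^+ 2 by rewrite exprn_gt0.
move/fine_cvgP: lim0 => [_ /cvgr0_norm_le/(_ _ e2)]; apply: filterS => n /=.
by rewrite -nE/= ger0_norm ?sqr_ge0// ler_pXn2r ?nnegrE// ltW.
Qed.

(** Riesz-Fischer: an absolutely convergent series of L2 converges. Its sum is taken
   pointwise on the set where the series of absolute values is finite, whose
   complement is null by monotone convergence. *)
Lemma L2_complete (x : nat -> Ls) :
  cvgn (series (fun k => `|x k|)) -> cvgn (series x).
Proof.
move=> cx; set M := limn (series (fun k => `|x k|)).
pose f k := L2_fun (x k); have mf k : measurable_fun [set: T] (f k) by exact: measurable_L2_fun.
pose g n t : R := series (fun k => `|f k t|) n.
have mg n : measurable_fun [set: T] (g n).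
  rewrite /g; under eq_fun do rewrite seriesEnat/=.
  by apply: measurable_sum => k; exact: measurableT_comp.
have g0 n t : 0 <= g n t by rewrite /g seriesEnat/= sumr_ge0.
have gnd t : nondecreasing_seq (g ^~ t).
  by apply: nondecreasing_series => k _ _.
have g_bound n : (\int[mu]_t (g n t ^+ 2)%:E <= (M ^+ 2)%:E)%E.
  have /choice[a aP] : forall k, exists a : Ls, {ae mu, forall t, L2_fun a t = `|f k t|}.
    move=> k; apply: L2_exists; first exact: measurableT_comp.
    under eq_integral do rewrite real_normK ?num_real//.
    by rewrite -norm_L2E ltry.
  have an k : `|a k| = `|x k|.
    apply/eqP; rewrite -(eqrXn2 (ltn0Sn 1))//; apply/eqP/EFin_inj.
    rewrite [RHS]norm_L2E (norm_L2_ae _ (aP k)); last exact: measurableT_comp.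
    by under eq_integral do rewrite real_normK ?num_real//.
  have aall : {ae mu, forall t k, L2_fun (a k) t = `|f k t|}.
    exact: ae_foralln.
  rewrite -(@norm_L2_ae (series a n))//; last first.
    apply: ae_imply2 (L2_sum_ae a n) aall => t -> h.
    by rewrite /g !seriesEnat/=; apply: eq_bigr => k _.
  rewrite lee_fin lerXn2r ?nnegrE//.
    by apply: limr_ge => //; apply: nearW => k; rewrite seriesEnat/= sumr_ge0.
  apply: (@le_trans _ _ (series (fun k => `|x k|) n)).
    rewrite !seriesEnat/= (le_trans (ler_norm_sum _ _ _))//.
    by apply: ler_sum => k _; have -> : `|a k| = `|x k| by exact: an.
  by apply: nondecreasing_cvgn_le => //; apply: nondecreasing_series => k _ _.
pose G t := limn (fun n => (g n t ^+ 2)%:E).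
have g2nd t : nondecreasing_seq (fun n => (g n t ^+ 2)%:E).
  by move=> m n mn; rewrite lee_fin lerXn2r ?nnegrE//; exact: gnd.
have cG t : (g n t ^+ 2)%:E @[n --> \oo] --> G t by exact: ereal_nondecreasing_is_cvgn.
have leG n t : ((g n t ^+ 2)%:E <= G t)%E by rewrite /G (cvg_lim _ (ereal_nondecreasing_cvgn (g2nd t)))//; apply: ereal_sup_ubound; exists n.
have mg2 n : measurable_fun [set: T] (fun t => (g n t ^+ 2)%:E).
  by apply/measurable_EFinP; exact: measurable_funX.
have mG : measurable_fun [set: T] G by apply: (emeasurable_fun_cvg (fun n t => (g n t ^+ 2)%:E)).
have G0 t : (0 <= G t)%E by rewrite (le_trans _ (leG 0%N t))// lee_fin sqr_ge0.
have iG : (\int[mu]_t G t <= (M ^+ 2)%:E)%E.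
  rewrite /G monotone_convergence//; last by move=> n t _; rewrite lee_fin sqr_ge0.
  apply: lime_le; last exact: nearW.
  apply: ereal_nondecreasing_is_cvgn => m n mn; apply: ge0_le_integral => //.
  - by move=> t _; rewrite lee_fin sqr_ge0.
  - by move=> t _; exact: g2nd.
have iGi : mu.-integrable setT G.
  apply/integrableP; split=> //; under eq_integral do rewrite gee0_abs//.
  by rewrite (le_lt_trans iG)// ltry.
pose E := [set t | G t \is a fin_num].
have mE : measurable E by rewrite -[E]setTI; exact: emeasurable_fin_num.
have aeE : {ae mu, forall t, E t} by apply: ae_imply (integrable_ae _ iGi) => // t /(_ I).
have gE n t : E t -> g n t ^+ 2 <= fine (G t).
  by move=> Et; rewrite -lee_fin fineK.
have cabs t : E t -> cvgn (series (fun k => `|f k t|)).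
  move=> Et; apply: nondecreasing_is_cvgn; first exact: gnd.
  exists (fine (G t) + 1) => _ [n _ <-].
  have := gE n t Et; have := g0 n t; rewrite -/(g n t); set z := g n t => z0 zG.
  nra.
pose h n t := series (fun k => f k t) n * \1_E t.
have mser n : measurable_fun [set: T] (fun t => series (fun k => f k t) n).
  by under eq_fun do rewrite seriesEnat/=; apply: measurable_sum => k.
have mh n : measurable_fun [set: T] (h n).
  by apply: measurable_funM => //; exact: measurable_indic.
pose s t := limn (h ^~ t).
have ch t : h n t @[n --> \oo] --> s t.
  have [Et|Et] := pselect (E t); last first.
    rewrite /s /h indicE memNset//=; under eq_fun do rewrite mulr0.
    by rewrite lim_cst//; exact: cvg_cst.
  rewrite /s /h indicE mem_set//=; under eq_fun do rewrite mulr1.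
  by apply: normed_cvg; exact: cabs.
have ms : measurable_fun [set: T] s by apply: (measurable_fun_cvg (h := h)).
have h2G n t : h n t ^+ 2 <= fine (G t).
  have [Et|Et] := pselect (E t); last first.
    by rewrite /h indicE memNset//= mulr0 expr0n/= fine_ge0.
  rewrite /h indicE mem_set//= mulr1 (le_trans _ (gE n t Et))//.
  rewrite -real_normK ?num_real// lerXn2r ?nnegrE//.
  by rewrite /g !seriesEnat/= ler_norm_sum.
have s2G t : s t ^+ 2 <= fine (G t).
  have c2 : h n t ^+ 2 @[n --> \oo] --> s t ^+ 2.
    by rewrite expr2; under eq_fun do rewrite expr2; exact: cvgM.
  by apply: (cvgr_to_le c2); exact: nearW.
have fG : (\int[mu]_t (fine (G t))%:E < +oo)%E.
  apply: (@le_lt_trans _ _ (\int[mu]_t G t)%E); last by rewrite (le_lt_trans iG)// ltry.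
  apply: ge0_le_integral => //.
  - by move=> t _; rewrite lee_fin fine_ge0.
  - by apply/measurable_EFinP; exact: measurableT_comp.
  - by move=> t _; move: (G0 t); case: (G t) => [r||]//= _; rewrite leey.
have mfG : measurable_fun [set: T] (fine \o G) by exact: measurableT_comp.
have iFG : mu.-integrable setT (EFin \o (fine \o G)).
  apply/integrableP; split; first exact/measurable_EFinP.
  by under eq_integral do rewrite /= ger0_norm ?fine_ge0//.
have [S SP] : exists S : Ls, {ae mu, forall t, L2_fun S t = s t}.
  apply: L2_exists => //; apply: le_lt_trans fG; apply: ge0_le_integral => //.
  - by move=> t _; rewrite lee_fin sqr_ge0.
  - by apply/measurable_EFinP; exact: measurable_funX.
  - exact/measurable_EFinP.
  - by move=> t _; rewrite lee_fin.
apply/cvg_ex; exists S.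
apply: (@L2_dominated_cvg h s (fine \o G)) => // n.
by apply: ae_imply (ae_and (L2_sum_ae x n) aeE) => t [-> Et]; rewrite /h indicE mem_set//= mulr1.
Qed.

End L2_space.

(** * Lebesgue measure of Euclidean balls *)

(** The push-forward packed as a measure, for use with the uniqueness theorems. *)
Definition image_measure d d' (T1 : measurableType d) (T2 : measurableType d')
    (R : realType) (m : {measure set T1 -> \bar R}) (f : T1 -> T2)
    (mf : measurable_fun [set: T1] f) : {measure set T2 -> \bar R} :=
  measure_function_pushforward__canonical__measure_function_Measure m mf.

Section affine_change.
Context {R : realType}.
Notation leb := (@lebesgue_measure R).

Lemma lebesgue_affine (x r : R) (A : set (measurableTypeR R)) : 0 < r -> measurable A ->
  leb A = (r%:E * leb ((fun t : R => (x + r * t)%R) @^-1` A))%E.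
Proof.
move=> r0 mA.
pose f : measurableTypeR R -> measurableTypeR R := fun t => x + r * t.
have mf : measurable_fun [set: measurableTypeR R] f.
  by apply: measurable_funD => //; exact: measurable_funM.
pose m : {measure set (measurableTypeR R) -> \bar R} :=
  mscale (NngNum (ltW r0)) (image_measure leb mf).
rewrite (@lebesgue_measure_unique _ m)// => _ [[a b] _ <-].
rewrite /m/= /mscale/= /pushforward/=.
rewrite (_ : f @^-1` _ = `](a - x) / r, (b - x) / r]%classic); last first.
  apply/seteqP; split=> t /=; rewrite !in_itv/= /f ltr_pdivrMr// ler_pdivlMr//;
  by rewrite ltrBlDl lerBrDl (mulrC t).
rewrite !lebesgue_measure_itv/= !lte_fin ltr_pM2r ?invr_gt0// ltrD2r.
case: ifPn => _; last by rewrite mule0.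
by rewrite -EFinB -EFinM; congr EFin; field; rewrite gt_eqF.
Qed.

Lemma measurable_rV_affine n (x : 'rV[R]_n) (r : R) :
  measurable_fun [set: 'rV[R]_n] (fun v : 'rV[R]_n => x + r *: v).
Proof.
apply: measurable_fun_rV => i; under eq_fun do rewrite !mxE.
by apply: measurable_funD => //; apply: measurable_funM => //; exact: measurable_coord.
Qed.

(** Both sides define measures which agree on products, by induction on the dimension. *)
Lemma lebesgue_rV_affine n (x : 'rV[R]_n) (r : R) (A : set 'rV[R]_n) : 0 < r -> measurable A ->
  lebesgue_rV R n A =
  ((r ^+ n)%:E * lebesgue_rV R n ((fun v : 'rV[R]_n => (x + r *: v)%R) @^-1` A))%E.
Proof.
move=> r0; elim: n x A => [|n IH] x A mA.
  have E (v w : 'rV[R]_0) : v = w by apply/rowP => -[].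
  rewrite expr0 mul1e; congr (lebesgue_rV R 0 _).
  by apply/seteqP; split=> v /=; have -> : x + r *: v = v by exact: E.
pose x0 := x ord0 ord0; pose x' : 'rV[R]_n := (rV_uncons x).2.
pose f (z : measurableTypeR R * 'rV[R]_n) : measurableTypeR R * 'rV[R]_n :=
  (x0 + r * z.1, x' + r *: z.2).
have mf : measurable_fun [set: _] f.
  apply: measurable_fun_pair.
    by apply: measurable_funD => //; apply: measurable_funM => //; exact: measurable_fst.
  by apply: (measurableT_comp (measurable_rV_affine x' r)); exact: measurable_snd.
have rn0 : 0 <= r ^+ n.+1 by rewrite exprn_ge0// ltW.
pose m : {measure set (measurableTypeR R * 'rV[R]_n)%type -> \bar R} :=
  mscale (NngNum rn0) (image_measure (leb \x lebesgue_rV R n)%E mf).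
have mcA : measurable (@rV_cons R n @^-1` A).
  by rewrite -[X in measurable X]setTI; exact: measurable_rV_cons.
rewrite [LHS](_ : _ = (leb \x lebesgue_rV R n)%E (@rV_cons R n @^-1` A))//.
rewrite (@product_measure_unique _ _ _ _ _ leb (lebesgue_rV R n) m)//; last first.
  move=> B C mB mC; rewrite /m /= /mscale/= /pushforward/=.
  rewrite (_ : f @^-1` (B `*` C) = ((fun t : R => x0 + r * t) @^-1` B) `*`
     ((fun v : 'rV[R]_n => x' + r *: v) @^-1` C)); last by [].
  have mB' : measurable ((fun t : R => x0 + r * t) @^-1` B : set (measurableTypeR R)).
    rewrite -[X in measurable X]setTI; apply: measurable_funD => //; exact: measurable_funM.
  have mC' : measurable ((fun v : 'rV[R]_n => x' + r *: v) @^-1` C).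
    by rewrite -[X in measurable X]setTI; exact: measurable_rV_affine.
  rewrite [X in (_ * X)%E](product_measure1E leb (lebesgue_rV R n) mB' mC').
  rewrite (lebesgue_affine x0 r0 mB) (IH x' C mC) exprS EFinM.
  by rewrite !muleA; congr (_ * _)%E; rewrite -!muleA; congr (_ * _)%E; rewrite muleC.
rewrite /m /= /mscale/= /pushforward/=; congr (_ * _)%E.
suff fE z : rV_cons (f z) = x + r *: rV_cons z.
  rewrite [RHS](_ : _ = (leb \x lebesgue_rV R n)%E
    (@rV_cons R n @^-1` ((fun v => x + r *: v) @^-1` A)))//.
  by congr (product_measure1 _ _ _); apply/seteqP; split=> z /=; rewrite fE.
apply/rowP => i; rewrite /rV_cons /f /x' /rV_uncons/= !mxE.
case: (@splitP 1 n i) => j ij; rewrite !mxE.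
  by rewrite (_ : i = ord0)//; apply/val_inj; rewrite /= ij ord1.
by rewrite (_ : rshift 1 j = i)//; apply/val_inj.
Qed.

End affine_change.

Section euclidean_balls.
Context {R : realType} (d : nat).
Implicit Types x y : 'rV[R]_d.

Definition edist x y : R := enorm (x - y).

Definition eball x (r : R) : set 'rV[R]_d := [set y | edist x y < r].

Lemma enorm_ge0 x : 0 <= enorm x. Proof. exact: sqrtr_ge0. Qed.

Lemma dotp_ge0 x : 0 <= dotp x x.
Proof. by apply: sumr_ge0 => i _; rewrite -expr2 sqr_ge0. Qed.

Lemma enormZ (a : R) x : 0 <= a -> enorm (a *: x) = a * enorm x.
Proof.
move=> a0; rewrite /enorm (_ : dotp _ _ = a ^+ 2 * dotp x x).
  by rewrite sqrtrM ?sqr_ge0// sqrtr_sqr ger0_norm.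
by rewrite /dotp mulr_sumr; apply: eq_bigr => i _; rewrite !mxE expr2; ring.
Qed.

Lemma enormN x : enorm (- x) = enorm x.
Proof. by rewrite /enorm /dotp; congr Num.sqrt; apply: eq_bigr => i _; rewrite !mxE mulrNN. Qed.

Lemma edistC x y : edist x y = edist y x.
Proof. by rewrite /edist -enormN opprB. Qed.

Lemma coord_le_enorm x i : `|x ord0 i| <= enorm x.
Proof.
rewrite -sqrtr_sqr ler_sqrt ?dotp_ge0// /dotp (bigD1 i)//= expr2 lerDl.
by apply: sumr_ge0 => j _; rewrite -expr2 sqr_ge0.
Qed.

Lemma norm_le_enorm x : `|x| <= enorm x.
Proof.
rewrite [`|x|](_ : _ = mx_norm x)// mx_normrE; apply: bigmax_le; first exact: enorm_ge0.
by move=> [i j] _; rewrite ord1; exact: coord_le_enorm.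
Qed.

Lemma measurable_edist d' (T : measurableType d') (f g : T -> 'rV[R]_d) :
  measurable_fun [set: T] f -> measurable_fun [set: T] g ->
  measurable_fun [set: T] (fun t => edist (f t) (g t)).
Proof.
move=> mf mg; apply: (@measurableT_comp _ _ _ _ _ _ (@Num.sqrt R)).
  by apply: continuous_measurable_fun; exact: sqrt_continuous.
apply: measurable_sum => i; under eq_fun do rewrite !mxE.
have mi : measurable_fun [set: T] (fun t => f t ord0 i - g t ord0 i).
  by apply: measurable_funB; apply: (measurableT_comp (@measurable_coord R d i)).
exact: measurable_funM.
Qed.

Lemma measurable_eball x (r : R) : measurable (eball x r).
Proof.
have mx : measurable_fun [set: 'rV[R]_d] (edist x) by exact: measurable_edist.
rewrite [X in measurable X](_ : _ = edist x @^-1` `]-oo, r[).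
  by rewrite -[X in measurable X]setTI; apply: mx => //; exact: measurable_itv.
by apply/seteqP; split=> y /=; rewrite in_itv.
Qed.

Lemma lebesgue_rV_cube_lty (a : R) :
  (lebesgue_rV R d [set v | forall i, `[(- a)%R, a]%classic (v ord0 i)] < +oo)%E.
Proof.
rewrite (@lebesgue_rV_box R d (fun=> `[(- a)%R, a]%classic)); last first.
  by move=> i; exact: measurable_itv.
rewrite ltey_eq; apply/orP; left; apply: prode_fin_num => i _.
by rewrite lebesgue_measure_itv/=; case: ifP.
Qed.

(** The ball is the image of the unit ball under an affine map. *)
Lemma lebesgue_rV_ball x (r : R) : 0 < r ->
  lebesgue_rV R d (eball x r) = (omega R d * r ^+ d)%:E.
Proof.
move=> r0.
have mB : measurable (eball x r) by exact: measurable_eball.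
rewrite (lebesgue_rV_affine x r0 mB) mulrC EFinM; congr (_ * _)%E.
rewrite (_ : _ @^-1` _ = [set v | enorm v < 1]); last first.
  apply/seteqP; split=> v; rewrite /eball/= edistC /edist addrC addKr enormZ ?ltW//;
  by rewrite gtr_pMr.
rewrite /omega fineK// ge0_fin_numE//.
apply: le_lt_trans (lebesgue_rV_cube_lty 1); apply: le_measure; rewrite ?inE.
- rewrite (_ : [set _ | _] = eball 0 1); first exact: measurable_eball.
  by apply/seteqP; split=> v; rewrite /eball/= edistC /edist subr0.
- rewrite [X in measurable X](_ : _ = \bigcap_(i in [set: 'I_d])
    (fun v : 'rV[R]_d => v ord0 i) @^-1` `[-1, 1]).
    apply: fin_bigcap_measurable => // i _.
    rewrite -[X in measurable X]setTI; apply: measurable_coord => //; exact: measurable_itv.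
  by apply/seteqP; split=> v /= h i; [move=> _; exact: h|exact: (h i I)].
- move=> v /= v1 i; rewrite in_itv/= -ler_norml.
  by rewrite (le_trans (coord_le_enorm v i))// ltW.
Qed.

End euclidean_balls.

(** * The integral of the Riesz kernel over a ball *)

Section radial_integral.
Context {R : realType} (d : nat).
Notation lam := (lebesgue_rV R d).
Notation om := (omega R d).
Implicit Types x y : 'rV[R]_d.

(** The value on the diagonal is 0, by the conventions for powers of 0 and for its
   inverse. *)
Definition riesz_kernel (a : R) x y : R := (edist x y `^ (d%:R - a))^-1.

Lemma riesz_kernel_ge0 a x y : 0 <= riesz_kernel a x y.
Proof. by rewrite invr_ge0 powR_ge0. Qed.

Lemma measurable_riesz_kernel d' (T : measurableType d') (f g : T -> 'rV[R]_d) a :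
  measurable_fun [set: T] f -> measurable_fun [set: T] g ->
  measurable_fun [set: T] (fun t => riesz_kernel a (f t) (g t)).
Proof.
move=> mf mg; rewrite /riesz_kernel; under eq_fun do rewrite -powRN.
apply: (measurableT_comp (measurable_powR _)); exact: measurable_edist.
Qed.

Variables (a : R) (a_itv : 0 < a < d%:R).
Let b := d%:R - a.
Let a0 : 0 < a. Proof. by case/andP: a_itv. Qed.
Let b0 : 0 < b. Proof. by rewrite subr_gt0; case/andP: a_itv. Qed.

Lemma omega_ge0 : 0 <= om. Proof. exact: fine_ge0. Qed.

Lemma riesz_kernel_le x y (r : R) : 0 < r -> r <= edist x y ->
  riesz_kernel a x y <= (r `^ b)^-1.
Proof.
move=> r0 rxy; have xy0 : 0 < edist x y by exact: lt_le_trans rxy.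
rewrite lef_pV2 ?posrE ?powR_gt0//.
by apply: ge0_ler_powR; rewrite ?nnegrE ?(ltW b0) ?(ltW r0) ?(ltW xy0).
Qed.

Lemma riesz_kernel_ge x y (r : R) : 0 < edist x y -> edist x y <= r ->
  (r `^ b)^-1 <= riesz_kernel a x y.
Proof.
move=> xy0 rxy; have r0 : 0 < r by exact: lt_le_trans rxy.
rewrite lef_pV2 ?posrE ?powR_gt0//.
by apply: ge0_ler_powR; rewrite ?nnegrE ?(ltW b0) ?(ltW r0) ?(ltW xy0).
Qed.

Section shells.
Variables (x : 'rV[R]_d) (r q : R).
Hypotheses (r0 : 0 < r) (q0 : 0 < q) (q1 : q < 1).

Let rq k : 0 < r * q ^+ k. Proof. by rewrite mulr_gt0// exprn_gt0. Qed.

Let shell k := [set y | r * q ^+ k.+1 <= edist x y < r * q ^+ k].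

Let shellE k : shell k =
  eball x (r * q ^+ k) `\` eball x (r * q ^+ k.+1).
Proof.
apply/seteqP; split=> y /=; first by move=> /andP[? ?]; split=> //; apply/negP; rewrite -leNgt.
by rewrite /shell/= => -[-> /negP]; rewrite -leNgt => ->.
Qed.

Let measurable_shell k : measurable (shell k).
Proof. by rewrite shellE; apply: measurableD; exact: measurable_eball. Qed.

Let lebesgue_shell k : lam (shell k) = (om * (r * q ^+ k) ^+ d * (1 - q ^+ d))%:E.
Proof.
have l1 := lebesgue_rV_ball x (rq k); have l2 := lebesgue_rV_ball x (rq k.+1).
have fin : (lam (eball x (r * q ^+ k)) < +oo)%E by rewrite l1 ltry.
rewrite shellE measureD//; [|exact: measurable_eball|exact: measurable_eball].
rewrite setIidr; last first.
  by move=> y /= /lt_le_trans; apply; rewrite ler_pM2l// exprS ger_pMl ?exprn_gt0// ltW.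
rewrite [X in (X - _)%E]l1 [X in (_ - X)%E]l2 -EFinB; congr EFin.
by rewrite exprSr mulrA (exprMn d (r * q ^+ k)); ring.
Qed.

Let trivIset_shell : trivIset [set: nat] shell.
Proof.
have lt_shell i j y : (i < j)%N -> shell i y -> shell j y -> False.
  move=> ij /andP[h1 _] /andP[_ h2]; have := le_lt_trans h1 h2.
  by rewrite ltr_pM2l// ltNge ler_wiXn2l ?ltW.
apply/trivIsetP => i j _ _; rewrite neq_ltn => /orP[ij|ij]; apply/seteqP; split=> // y [hi hj].
  exact: lt_shell ij hi hj.
exact: lt_shell ij hj hi.
Qed.

Let bigcup_shell : \bigcup_k shell k = [set y | 0 < edist x y < r].
Proof.
apply/seteqP; split=> y /=.
  move=> [k _ /andP[h1 h2]]; rewrite (lt_le_trans (rq k.+1) h1)/=.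
  by rewrite (lt_le_trans h2)// ger_pMr// exprn_ile1// ltW.
move=> /andP[xy0 xyr].
have [k hk] : exists k, r * q ^+ k.+1 <= edist x y.
  have : (r * q ^+ n.+1 : R) @[n --> \oo] --> r * 0.
    apply: cvgMr; rewrite (cvg_shiftS (fun n => q ^+ n)).
    by apply: cvg_expr; rewrite ger0_norm// ltW.
  rewrite mulr0 => /cvgr_le/(_ _ xy0)/filter_ex[n hn]; by exists n.
have exk : exists k, r * q ^+ k.+1 <= edist x y by exists k.
have [m hm mmin] := ex_minnP exk; exists m => //=; rewrite /shell/= hm/=.
case: m hm mmin => [|m] hm mmin; first by rewrite expr0 mulr1.
by rewrite ltNge; apply/negP => /mmin; rewrite ltnn.
Qed.

(** The integral over the ball of the function which, on each shell, is equal to the value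
   of the kernel on the outer sphere; this is a geometric series. *)
Definition shell_sum : R := om * r `^ a * (1 - q ^+ d) / (1 - q `^ a).

Let z := q `^ a.
Let z01 : 0 < z < 1.
Proof.
have one : (1 : R) `^ a = 1 by rewrite powR1.
by rewrite /z powR_gt0//= -[ltRHS]one gt0_ltr_powR// nnegrE ltW.
Qed.

Let term k : R := om * r `^ a * (1 - q ^+ d) * z ^+ k.

Let term_ge0 k : 0 <= term k.
Proof.
case/andP: z01 => z0 _.
rewrite !mulr_ge0 ?omega_ge0 ?powR_ge0 ?exprn_ge0 ?(ltW z0)//.
by rewrite subr_ge0 exprn_ile1// ltW.
Qed.

Let sum_term : (\sum_(0 <= k <oo) (term k)%:E = shell_sum%:E)%E.
Proof.
apply/cvg_lim => //=; rewrite (_ : (fun _ => _) = EFin \o series (geometric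
    (om * r `^ a * (1 - q ^+ d)) z)); last first.
  by apply/funext => n; rewrite /= seriesEnat/= sumEFin.
apply: cvg_EFin; first exact: nearW.
by apply: cvg_geometric_series; case/andP: z01 => z0 z1; rewrite gtr0_norm.
Qed.

Let term_shell k : term k = ((r * q ^+ k) `^ b)^-1 * (om * (r * q ^+ k) ^+ d * (1 - q ^+ d)).
Proof.
have s0 := rq k; rewrite /term /z; set s := r * q ^+ k in s0 *.
have -> : s ^+ d = s `^ a * s `^ b.
  rewrite -powRD; last by rewrite (gt_eqF s0) implybT.
  have -> : a + b = d%:R by rewrite /b addrC subrK.
  by rewrite powR_mulrn// ltW.
have -> : s `^ a = r `^ a * (q `^ a) ^+ k.
  rewrite /s powRM ?exprn_ge0 ?ltW//; congr *%R.
  by rewrite -[RHS]powR_mulrn ?powR_ge0// -powRrM mulrC powRrM powR_mulrn// ltW.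
have sb : s `^ b != 0 by rewrite gt_eqF// powR_gt0.
by field.
Qed.

Let mker : measurable_fun [set: 'rV[R]_d] (fun y => (riesz_kernel a x y)%:E).
Proof. by apply/measurable_EFinP; apply: measurable_riesz_kernel. Qed.

Let integral_ballE : (\int[lam]_(y in eball x r) (riesz_kernel a x y)%:E =
  \sum_(0 <= k <oo) \int[lam]_(y in shell k) (riesz_kernel a x y)%:E)%E.
Proof.
transitivity (\int[lam]_(y in [set y | (0 < edist x y < r)%R]) (riesz_kernel a x y)%:E)%E; last first.
  rewrite -bigcup_shell ge0_integral_bigcup//; first exact: measurable_funTS.
  by move=> y _; rewrite lee_fin riesz_kernel_ge0.
rewrite integral_mkcond [RHS]integral_mkcond; congr (integral _ _ _); apply/funext => y.
rewrite !patchE.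
have [xyr|xyr] := boolP (edist x y < r); last first.
  by rewrite !memNset//=; [rewrite (negbTE xyr) andbF|exact/negP].
rewrite mem_set//; have [xy0|xy0] := boolP (0 < edist x y).
  by rewrite mem_set//= xy0.
rewrite memNset/=; last by rewrite (negbTE xy0).
rewrite /riesz_kernel; have -> : edist x y = 0 by apply/eqP; rewrite eq_le enorm_ge0 leNgt xy0.
by rewrite powR0 ?invr0// gt_eqF.
Qed.

Let shell_lower k : ((term k)%:E <= \int[lam]_(y in shell k) (riesz_kernel a x y)%:E)%E.
Proof.
rewrite term_shell EFinM -lebesgue_shell -integral_cst//.
apply: ge0_le_integral => //.
- by move=> y _; rewrite lee_fin invr_ge0 powR_ge0.
- exact: measurable_funTS.
move=> y /andP[h1 h2]; rewrite lee_fin; apply: riesz_kernel_ge; last exact: ltW.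
by rewrite (lt_le_trans _ h1).
Qed.

Let shell_upper k :
  (\int[lam]_(y in shell k) (riesz_kernel a x y)%:E <= (q `^ b)^-1%:E * (term k)%:E)%E.
Proof.
have -> : ((q `^ b)^-1%:E * (term k)%:E = ((r * q ^+ k.+1) `^ b)^-1%:E * lam (shell k))%E.
  rewrite lebesgue_shell term_shell -!EFinM exprSr mulrA; congr EFin.
  by rewrite [in RHS](powRM _ (ltW (rq k)) (ltW q0)) invfM -!mulrA mulrCA.
rewrite -integral_cst//; apply: ge0_le_integral => //.
- by move=> y _; rewrite lee_fin riesz_kernel_ge0.
- exact: measurable_funTS.
by move=> y /andP[h1 h2]; rewrite lee_fin; exact: riesz_kernel_le.
Qed.

(** Comparison of the kernel, on each shell of a geometric sequence of radii, with its
   values on the two boundary spheres. *)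
Lemma shell_bounds :
  (shell_sum%:E <= \int[lam]_(y in eball x r) (riesz_kernel a x y)%:E
   <= (q `^ b)^-1%:E * shell_sum%:E)%E.
Proof.
rewrite integral_ballE -sum_term; apply/andP; split.
  by apply: lee_nneseries => [k _ _|k _]; [rewrite lee_fin; exact: term_ge0|exact: shell_lower].
rewrite -nneseriesZl; last by move=> k _; rewrite lee_fin; exact: term_ge0.
apply: lee_nneseries => [k _ _|k _]; last exact: shell_upper.
by apply: integral_ge0 => y _; rewrite lee_fin riesz_kernel_ge0.
Qed.

End shells.

(** When the ratio q of the radii tends to 1 in [shell_bounds], the quotient
   (1 - q^d) / (1 - q^a) tends to d / a: both terms are difference quotients at 1. *)
Lemma radial_integral x (r : R) : 0 < r ->
  (\int[lam]_(y in eball x r) (riesz_kernel a x y)%:E =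
   (a^-1 * (d%:R * om * r `^ a))%:E)%E.
Proof.
move=> r0; set I := (\int[lam]_(y in _) _)%E.
pose h (n : nat) : R := - n.+2%:R^-1.
have h0 n : h n != 0 by rewrite oppr_eq0 invr_eq0 pnatr_eq0.
have hq n : 0 < 1 + h n < 1.
  by rewrite subr_gt0 invf_lt1// ltr1n/= gtrDl oppr_lt0 invr_gt0.
have ch : h n @[n --> \oo] --> (0 : R)^'.
  move=> A /= [e /= e0 eA]; have : h n @[n --> \oo] --> - (0 : R).
    by apply: cvgN; rewrite (cvg_shiftS (fun n => n.+1%:R^-1 : R)); exact: cvg_harmonic.
  rewrite oppr0 => /cvgrPdist_lt/(_ _ e0); apply: filterS => n hn; exact: eA.
have ch0 : h n @[n --> \oo] --> 0 by apply: cvg_trans ch _; exact: nbhs_dnbhs.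
have slope (c : R) : (h n)^-1 * ((1 + h n) `^ c - 1) @[n --> \oo] --> c.
  have dc := @is_derive1_powR R c 1 ltr01.
  have : h^-1 *: (((fun y : R => y `^ c) \o shift 1) (h *: 1) - (1 : R) `^ c)
      @[h --> (0:R)^'] --> c.
    have e1 : c * (1 : R) `^ (c - 1) = c by rewrite powR1 mulr1.
    rewrite -[X in _ --> X]e1.
    by rewrite -(@derive_val _ _ _ _ _ _ _ dc); exact: (@ex_derive _ _ _ _ _ _ _ dc).
  move=> /(cvg_comp _ _ ch); apply: cvg_trans; apply: near_eq_cvg; apply: nearW => n /=.
  have -> : h n *: (1 : R^o) = h n by exact: mulr1.
  by rewrite powR1 (addrC (h n)).
pose S n := shell_sum r (1 + h n).
have SE n : S n = om * r `^ a * (((h n)^-1 * ((1 + h n) `^ d%:R - 1)) *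
    ((h n)^-1 * ((1 + h n) `^ a - 1))^-1).
  case/andP: (hq n) => q0 q1.
  have qa : (1 + h n) `^ a - 1 != 0.
    have one : (1 : R) `^ a = 1 by rewrite powR1.
    by rewrite lt_eqF// subr_lt0 -[ltRHS]one gt0_ltr_powR// nnegrE ltW.
  rewrite /S /shell_sum powR_mulrn ?(ltW q0)//.
  have qa' : 1 - (1 + h n) `^ a != 0 by rewrite -opprB oppr_eq0.
  by field; rewrite qa qa' h0.
have cS : S n @[n --> \oo] --> a^-1 * (d%:R * om * r `^ a).
  rewrite (_ : a^-1 * _ = om * r `^ a * (d%:R * a^-1)); last by ring.
  under eq_fun do rewrite SE.
  apply: cvgMr; apply: cvgM; first exact: slope.
  by apply: cvgV; [rewrite gt_eqF|exact: slope].
have cq : ((1 + h n) `^ b)^-1 @[n --> \oo] --> (1 : R).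
  have ca : (1 + h n) `^ b @[n --> \oo] --> (1 : R).
    rewrite -[X in _ --> X]addr0 -[X in _ --> _ + X](mul0r b).
    have -> : (fun n => (1 + h n) `^ b) =
        (fun n => 1 + h n * ((h n)^-1 * ((1 + h n) `^ b - 1))).
      by apply/funext => n; rewrite (mulVKf (h0 n)) [RHS]addrC subrK.
    by apply: cvgD; [exact: cvg_cst|apply: cvgM => //; exact: slope].
  by rewrite -[X in _ --> X]invr1; apply: cvgV => //; exact: oner_neq0.
have bounds n : ((S n)%:E <= I <= (((1 + h n) `^ b)^-1)%:E * (S n)%:E)%E.
  by case/andP: (hq n) => q0 q1; exact: shell_bounds.
have Ifin : I \is a fin_num.
  rewrite ge0_fin_numE; first by case/andP: (bounds 0%N) => _ /le_lt_trans; apply; rewrite -EFinM ltry.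
  by apply: integral_ge0 => y _; rewrite lee_fin riesz_kernel_ge0.
rewrite -(fineK Ifin); congr EFin; apply/eqP; rewrite eq_le; apply/andP; split.
  have cqS : ((1 + h n) `^ b)^-1 * S n @[n --> \oo] --> a^-1 * (d%:R * om * r `^ a).
    by rewrite -[X in _ --> X]mul1r; apply: cvgM.
  apply: (cvgr_to_ge cqS); apply: nearW => n.
  by rewrite -lee_fin (fineK Ifin) EFinM; case/andP: (bounds n).
apply: (cvgr_to_le cS); apply: nearW => n.
by rewrite -lee_fin (fineK Ifin); case/andP: (bounds n).
Qed.

End radial_integral.

(** * Integral operators with a symmetric kernel *)

Section finite_tonelli.
Context d (T : measurableType d) (R : realType).
Variable mu : {measure set T -> \bar R}.
Hypothesis mu_fin : (mu [set: T] < +oo)%E.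

(** The structure of finite measure is what Tonelli's theorem is stated for. *)
Lemma finite_measure_ex :
  exists m : {finite_measure set T -> \bar R}, (m : {measure set T -> \bar R}) = mu.
Proof.
exists (mfrestr measurableT mu_fin); apply: eq_measure; apply/funext => A.
by rewrite /= /mfrestr /mrestr setIT.
Qed.

Lemma finite_integrable_cst (c : R) : mu.-integrable setT (EFin \o cst c).
Proof.
apply/integrableP; split; first by apply/measurable_EFinP; exact: measurable_cst.
by rewrite (@integral_cst _ _ _ mu _ measurableT `|c%:E|%E) lte_mul_pinfty.
Qed.

Lemma measurable_integral_section (h : T * T -> \bar R) :
  measurable_fun [set: T * T] h -> (forall z, (0 <= h z)%E) ->
  measurable_fun [set: T] (fun x => \int[mu]_y h (x, y))%E.
Proof.
have [m <-] := finite_measure_ex => mh h0.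
exact: (@measurable_fun_fubini_tonelli_F _ _ _ _ _ m _ mh h0).
Qed.

Lemma finite_fubini_tonelli (h : T * T -> \bar R) :
  measurable_fun [set: T * T] h -> (forall z, (0 <= h z)%E) ->
  (\int[mu]_x \int[mu]_y h (x, y) = \int[mu]_y \int[mu]_x h (x, y))%E.
Proof.
have [m <-] := finite_measure_ex => mh h0.
exact: (@fubini_tonelli _ _ _ _ _ m m _ mh h0).
Qed.

(** Tonelli's theorem applies to the positive and negative parts. *)
Lemma measurable_Rintegral_section (h : T * T -> R) : measurable_fun [set: T * T] h ->
  measurable_fun [set: T] (fun x => \int[mu]_y h (x, y)).
Proof.
move=> mh; rewrite /Rintegral; apply: measurableT_comp => //.
have mEh : measurable_fun [set: T * T] (EFin \o h) by exact/measurable_EFinP.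
under eq_fun do rewrite integralE.
apply: emeasurable_funB.
- have := measurable_integral_section (measurable_funepos mEh) (funepos_ge0 _).
  by apply: eq_measurable_fun => x _; apply: eq_integral => y _; rewrite !funeposE.
- have := measurable_integral_section (measurable_funeneg mEh) (funeneg_ge0 _).
  by apply: eq_measurable_fun => x _; apply: eq_integral => y _; rewrite !funenegE.
Qed.

End finite_tonelli.

Section schur.
Context d (T : measurableType d) (R : realType).
Variable mu : {measure set T -> \bar R}.
Hypothesis mu_fin : (mu [set: T] < +oo)%E.
Notation Ls := (LspaceType2 mu).

Variables (k : T -> T -> R) (M : R).
Hypotheses (mk : measurable_fun [set: T * T] (fun z => k z.1 z.2))
  (k0 : forall x y, 0 <= k x y) (ksym : forall x y, k x y = k y x)
  (M0 : 0 < M) (kM : forall x, (\int[mu]_y (k x y)%:E <= M%:E)%E).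

Definition kernel_fun (f : T -> R) x : R := \int[mu]_y (k x y * f y).

Let mkx x : measurable_fun [set: T] (k x).
Proof. exact: (measurableT_comp mk (measurable_pair1 x)). Qed.

Let int_k x : mu.-integrable setT (EFin \o k x).
Proof.
apply/integrableP; split; first exact/measurable_EFinP.
rewrite (le_lt_trans _ (ltry M))//; apply: le_trans (kM x).
by under eq_integral do rewrite /= ger0_norm//.
Qed.

Lemma measurable_kernel_fun f : measurable_fun [set: T] f ->
  measurable_fun [set: T] (kernel_fun f).
Proof.
move=> mf; apply: (measurable_Rintegral_section mu_fin (h := fun z => k z.1 z.2 * f z.2)).
apply: measurable_funM => //; apply: measurableT_comp => //; exact: measurable_snd.
Qed.

Let square_fun f x := (\int[mu]_y (k x y * f y ^+ 2)%:E)%E.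

Section square.
Variables (f : T -> R) (mf : measurable_fun [set: T] f).
Hypothesis f2 : (\int[mu]_y (f y ^+ 2)%:E < +oo)%E.

Let mkf2 : measurable_fun [set: T * T] (fun z => (k z.1 z.2 * f z.2 ^+ 2)%:E).
Proof.
apply/measurable_EFinP; apply: measurable_funM => //; apply: measurable_funX.
by apply: measurableT_comp => //; exact: measurable_snd.
Qed.

Let kf2_ge0 (z : T * T) : (0 <= (k z.1 z.2 * f z.2 ^+ 2)%:E)%E.
Proof. by rewrite lee_fin mulr_ge0// sqr_ge0. Qed.

Let measurable_square : measurable_fun [set: T] (square_fun f).
Proof. exact: (measurable_integral_section mu_fin mkf2 kf2_ge0). Qed.

Let square_ge0 x : (0 <= square_fun f x)%E.
Proof. by apply: integral_ge0 => y _; rewrite lee_fin mulr_ge0// sqr_ge0. Qed.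

Let int_square : (\int[mu]_x square_fun f x <= M%:E * \int[mu]_y (f y ^+ 2)%:E)%E.
Proof.
rewrite /square_fun (finite_fubini_tonelli mu_fin mkf2 kf2_ge0)/=.
rewrite -ge0_integralZl//; first last.
- by rewrite lee_fin ltW.
- by move=> y _; rewrite lee_fin sqr_ge0.
- by apply/measurable_EFinP; exact: measurable_funX.
apply: ge0_le_integral => //.
- by move=> y _; apply: integral_ge0 => x _; rewrite lee_fin mulr_ge0// sqr_ge0.
- apply: (measurable_integral_section mu_fin (h := fun z => (k z.2 z.1 * f z.1 ^+ 2)%:E)).
    apply/measurable_EFinP; apply: measurable_funM; last first.
      by apply: measurable_funX; apply: measurableT_comp => //; exact: measurable_fst.
    by under eq_fun do rewrite ksym.
  by move=> z; rewrite lee_fin mulr_ge0// sqr_ge0.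
- by apply: measurable_funeM; apply/measurable_EFinP; exact: measurable_funX.
move=> y _.
rewrite [leLHS](_ : _ = ((f y ^+ 2)%:E * \int[mu]_x (k x y)%:E)%E); last first.
  rewrite -ge0_integralZl//; first last.
  - by rewrite lee_fin sqr_ge0.
  - by move=> x _; rewrite lee_fin.
  - by apply/measurable_EFinP; exact: (measurableT_comp mk (measurable_pair2 y)).
  by apply: eq_integral => x _; rewrite -EFinM mulrC.
rewrite muleC; apply: lee_wpmul2r; first by rewrite lee_fin sqr_ge0.
by under eq_integral do rewrite ksym; exact: kM.
Qed.

Let ae_square : {ae mu, forall x, square_fun f x \is a fin_num}.
Proof.
have /integrable_ae : mu.-integrable setT (square_fun f).
  apply/integrableP; split=> //; under eq_integral do rewrite gee0_abs//.
  by rewrite (le_lt_trans int_square)// lte_mul_pinfty// lee_fin ltW.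
by move=> /(_ measurableT); apply: ae_imply => x /(_ I).
Qed.

Let int_kf2 x : square_fun f x \is a fin_num ->
  mu.-integrable setT (EFin \o (fun y => k x y * f y ^+ 2)).
Proof.
move=> fin; apply/integrableP; split.
  by apply/measurable_EFinP; apply: measurable_funM => //; exact: measurable_funX.
rewrite (_ : integral _ _ _ = square_fun f x); first by rewrite -ge0_fin_numE ?square_ge0.
by apply: eq_integral => y _; rewrite /= ger0_norm// mulr_ge0// sqr_ge0.
Qed.

Let int_kf x : square_fun f x \is a fin_num ->
  mu.-integrable setT (EFin \o (fun y => k x y * f y)).
Proof.
move=> fin.
have ikf2 := int_kf2 fin.
apply: (@le_integrableR _ _ _ _ _ measurableT _ (fun y => k x y * f y ^+ 2 + k x y)).
- exact: measurable_funM.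
- move=> y _; rewrite normrM (ger0_norm (k0 x y)) -{3}(mulr1 (k x y)) -mulrDr ler_wpM2l//.
  rewrite -[f y ^+ 2]real_normK ?num_real//; have := normr_ge0 (f y); set u := `|f y|; nra.
- exact: integrableRD.
Qed.

Lemma ae_integrable_kernel :
  {ae mu, forall x, mu.-integrable setT (EFin \o (fun y => k x y * f y))}.
Proof. exact: ae_imply int_kf ae_square. Qed.

Let kernel_fun_sqr x : square_fun f x \is a fin_num ->
  (kernel_fun f x ^+ 2 <= M * fine (square_fun f x))%R.
Proof.
move=> fin; set g := kernel_fun f x; set K := (\int[mu]_y k x y)%R.
have KM : K <= M.
  have fK := integrable_fin_num measurableT (int_k x).
  by rewrite -lee_fin /K /Rintegral (fineK fK); exact: kM.
have ikf2 := int_kf2 fin.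
(* the discriminant inequality, at the point g / M *)
have : 0 <= (\int[mu]_y (k x y * f y ^+ 2 - (2 * (g / M)) * (k x y * f y) + (g / M) ^+ 2 * k x y))%R.
  apply: Rintegral_ge0 => y _.
  rewrite (_ : _ + _ = k x y * (f y - g / M) ^+ 2); last by ring.
  by rewrite mulr_ge0// sqr_ge0.
have ikf := int_kf fin.
rewrite RintegralD//; [|by apply: integrableRB => //; exact: integrableRZl|exact: integrableRZl].
rewrite RintegralB//; last exact: integrableRZl.
rewrite !RintegralZl// -/K -[(\int[mu]_y (k x y * f y))%R]/g.
have -> : (\int[mu]_y (k x y * f y ^+ 2))%R = fine (square_fun f x) by [].
have e : 2 * (g / M) * g - (g / M) ^+ 2 * K >= g ^+ 2 / M.
  rewrite (_ : 2 * (g / M) * g = g ^+ 2 / M + (g / M) ^+ 2 * M).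
    by rewrite -addrA lerDl subr_ge0 ler_wpM2l ?sqr_ge0.
  by field; rewrite gt_eqF.
move=> h; rewrite mulrC -ler_pdivrMr//; apply: (le_trans e); lra.
Qed.

Lemma kernel_fun_bound :
  (\int[mu]_x (kernel_fun f x ^+ 2)%:E <= (M ^+ 2)%:E * \int[mu]_y (f y ^+ 2)%:E)%E.
Proof.
apply: (@le_trans _ _ (\int[mu]_x (M%:E * square_fun f x))%E); last first.
  rewrite ge0_integralZl//; last by rewrite lee_fin ltW.
  rewrite expr2 EFinM -muleA; apply: lee_wpmul2l; last exact: int_square.
  by rewrite lee_fin ltW.
apply: ae_ge0_le_integral => //.
- by move=> x _; rewrite lee_fin sqr_ge0.
- by apply/measurable_EFinP; apply: measurable_funX; exact: measurable_kernel_fun.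
- by move=> x _; rewrite mule_ge0// lee_fin ltW.
- exact: measurable_funeM.
apply: ae_imply ae_square => x fin _.
by rewrite -(fineK fin) -EFinM lee_fin; exact: kernel_fun_sqr.
Qed.

End square.

(** Schur's test: the square of the integral of k f is at most M times the integral of
   k f^2, and Tonelli's theorem bounds the integral over x of the latter, by symmetry of
   the kernel. *)
Lemma kernel_operator : exists K : Ls -> Ls, [/\
  forall a F G, K (a *: F + G) = a *: K F + K G,
  forall F, `|K F : Ls| <= M * `|F| &
  forall F, {ae mu, forall x, L2_fun (K F) x = kernel_fun (L2_fun F) x}].
Proof.
have F2 (F : Ls) : (\int[mu]_y (L2_fun F y ^+ 2)%:E < +oo)%E by rewrite -norm_L2E ltry.
have mF (F : Ls) : measurable_fun [set: T] (L2_fun F) by exact: measurable_L2_fun.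
have /choice[K KE] : forall F : Ls, exists KF : Ls,
    {ae mu, forall x, L2_fun KF x = kernel_fun (L2_fun F) x}.
  move=> F; apply: L2_exists; first exact: measurable_kernel_fun.
  by rewrite (le_lt_trans (kernel_fun_bound (mF F) (F2 F)))// lte_mul_pinfty// lee_fin sqr_ge0.
exists K; split=> // [a F G|F].
  apply: L2_ext.
  have lin : {ae mu, forall x, kernel_fun (L2_fun (a *: F + G)) x =
      a * kernel_fun (L2_fun F) x + kernel_fun (L2_fun G) x}.
    apply: ae_imply2 (ae_integrable_kernel (mF F) (F2 F)) (ae_integrable_kernel (mF G) (F2 G)).
    move=> x iF iG; rewrite /kernel_fun -RintegralZl// -RintegralD//; last exact: integrableRZl.
    congr fine; apply: ae_eq_integral => //.
    - apply/measurable_EFinP; apply: measurable_funM => //.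
    - apply/measurable_EFinP; apply: measurable_funD; last exact: measurable_funM.
      by apply: measurable_funM => //; exact: measurable_funM.
    apply: ae_imply2 (L2_add_ae (a *: F) G) (L2_scale_ae a F) => y -> -> _.
    by rewrite mulrDr mulrCA.
  apply: ae_imply (ae_and (ae_and (KE (a *: F + G)) lin)
    (ae_and (ae_and (KE F) (KE G)) (ae_and (L2_add_ae (a *: K F) (K G)) (L2_scale_ae a (K F))))).
  by move=> x [[-> ->] [[<- <-] [-> ->]]].
rewrite -ler_sqr ?nnegrE ?mulr_ge0 ?(ltW M0)// exprMn -lee_fin.
rewrite (norm_L2_ae _ (KE F)); last exact: measurable_kernel_fun.
by rewrite EFinM norm_L2E; exact: kernel_fun_bound.
Qed.

End schur.

(** * A monotone class theorem in L2 *)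

Section L2_monotone_class.
Context d (T : measurableType d) (R : realType) (mu : {measure set T -> \bar R}).
Notation Ls := (LspaceType2 mu).
Hypothesis mu_fin : (mu [set: T] < +oo)%E.
Variables (G : set (set T)) (V : set Ls).
Hypotheses (sigmaG : d.-measurable = <<s G >>) (GI : setI_closed G)
  (Vlin : forall a F F', V F -> V F' -> V (a *: F + F'))
  (Vlim : forall (F_ : nat -> Ls) F, (forall n, V (F_ n)) -> F_ n @[n --> \oo] --> F -> V F).

Import HBSimple HBNNSimple.

Let inV (f : T -> R) := exists2 F, V F & {ae mu, forall t, L2_fun F t = f t}.

Hypotheses (VT : forall F, {ae mu, forall t, L2_fun F t = 1} -> V F)
  (VG : forall E F, G E -> {ae mu, forall t, L2_fun F t = \1_E t} -> V F).

Let inV_lin (a : R) f g : inV f -> inV g -> inV (fun t => a * f t + g t).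
Proof.
move=> [F VF Ff] [F' VF' Fg]; exists (a *: F + F'); first exact: Vlin.
apply: ae_imply (ae_and (ae_and Ff Fg) (ae_and (L2_add_ae (a *: F) F') (L2_scale_ae a F))).
by move=> t [[-> ->] [-> ->]].
Qed.

Let inV_lim (f_ : nat -> T -> R) (f h : T -> R) :
  (forall n, measurable_fun [set: T] (f_ n)) -> measurable_fun [set: T] f ->
  (forall t, f_ n t @[n --> \oo] --> f t) ->
  mu.-integrable setT (EFin \o h) -> (forall n t, f_ n t ^+ 2 <= h t) ->
  (forall n, inV (f_ n)) -> inV f.
Proof.
move=> mf_ mf cf ih f_h Vf.
have fh t : f t ^+ 2 <= h t.
  have c2 : f_ n t ^+ 2 @[n --> \oo] --> f t ^+ 2.
    by rewrite expr2; under eq_fun do rewrite expr2; exact: cvgM.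
  by apply: (cvgr_to_le c2); exact: nearW.
have /choice[F_ F_P] : forall n, exists F, V F /\ {ae mu, forall t, L2_fun F t = f_ n t}.
  by move=> n; have [F VF FE] := Vf n; exists F.
have [F FE] : exists F : Ls, {ae mu, forall t, L2_fun F t = f t}.
  apply: L2_exists => //; have /integrableP[_] := ih; apply: le_lt_trans.
  apply: ge0_le_integral => //.
  - by move=> t _; rewrite lee_fin sqr_ge0.
  - by apply/measurable_EFinP; exact: measurable_funX.
  - by apply: measurableT_comp => //; apply: measurable_int ih.
  - by move=> t _; rewrite lee_fin (le_trans (fh t))// ler_norm.
exists F => //; apply: (@Vlim F_); first by move=> n; have [] := F_P n.
by apply: (@L2_dominated_cvg _ _ _ _ f_ f h) => // n; have [] := F_P n.
Qed.

Let int_cst (c : R) : mu.-integrable setT (EFin \o cst c).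
Proof. exact: finite_integrable_cst. Qed.

Let inV1 : inV (cst 1).
Proof.
have [F FE] : exists F : Ls, {ae mu, forall t, L2_fun F t = 1}.
  apply: L2_exists; first exact: measurable_cst.
  have /integrableP[_] := int_cst 1; congr (_ < _)%E.
  by apply: eq_integral => t _; rewrite /= expr1n normr1.
by exists F => //; exact: VT.
Qed.

Let inV_ext f g : (forall t, f t = g t) -> inV f -> inV g.
Proof. by move=> fg; have -> : f = g by apply/funext. Qed.

Let inV0 : inV (cst 0).
Proof.
by apply: inV_ext (inV_lin (-1) inV1 inV1) => t; rewrite /= mulr1 addNr.
Qed.

Let inV_indic E : measurable E -> inV \1_E.
Proof.
rewrite sigmaG => sE; have mE : measurable E by rewrite sigmaG.
apply: (dynkin_induction sigmaG GI (P := fun E => inV \1_E)) sE.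
- by apply: inV_ext inV1 => t; rewrite indicT.
- move=> A GA.
  have mA : measurable A by rewrite sigmaG; exact: sub_sigma_algebra.
  have [F FE] : exists F : Ls, {ae mu, forall t, L2_fun F t = \1_A t}.
    apply: L2_exists; first exact: measurable_indic.
    have /integrableP[_] := int_cst 1; apply: le_lt_trans; apply: ge0_le_integral => //.
    + by apply/measurable_EFinP; apply: measurable_funX; exact: measurable_indic.
    + by apply: measurableT_comp => //; apply: measurable_int (int_cst 1).
    + by move=> t _; rewrite lee_fin normr1 indicE; case: (_ \in _); rewrite ?expr1n ?expr0n//= ler01.
  by exists F => //; exact: VG FE.
- move=> S mS VS; apply: inV_ext (inV_lin (-1) VS inV1) => t.
  by rewrite !indicE in_setC /=; case: (_ \in _); rewrite /=; lra.
- move=> F mF tF VF.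
  have VU n : inV \1_(\big[setU/set0]_(i < n) F i).
    elim: n => [|n IH]; first by apply: inV_ext inV0 => t; rewrite big_ord0 indic0.
    apply: inV_ext (inV_lin 1 IH (VF n)) => t.
    rewrite big_ord_recr/= mul1r !indicE in_setU.
    case: (boolP (t \in F n)) => tn; last by rewrite orbF addr0.
    rewrite orbT memNset ?add0r// => /=; rewrite -bigcup_mkord => -[i /= ilt Fi].
    have := tF i n I I; move=> /(_ _)/= h; move: ilt; rewrite h ?ltnn//.
    by exists t; split => //; exact/set_mem.
  apply: (inV_lim (f_ := fun n => \1_(\big[setU/set0]_(i < n) F i)) (h := cst 1)) => //.
  + move=> n; apply: measurable_indic; exact: bigsetU_measurable.
  + apply: measurable_indic; exact: bigcup_measurable.
  + move=> t; apply: cvg_near_cst.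
    have [[k _ Fk]|nF] := pselect ((\bigcup_k F k) t).
      apply: filterS (nbhs_infty_gt k) => n kn; rewrite !indicE.
      rewrite [in RHS]mem_set; last by exists k.
      by rewrite mem_set//; rewrite -bigcup_mkord; exists k.
    apply: nearW => n; rewrite !indicE !memNset//.
    by rewrite -bigcup_mkord => -[k _ Fk]; apply: nF; exists k.
  + move=> n t; rewrite indicE; case: (_ \in _); rewrite ?expr1n ?expr0n//= ler01.
Qed.

Let inV_ge0 (f : T -> R) : measurable_fun [set: T] f -> (forall t, 0 <= f t) ->
  mu.-integrable setT (EFin \o (fun t => f t ^+ 2)) -> inV f.
Proof.
move=> mf f0 if2.
have mEf : measurable_fun [set: T] (EFin \o f) by exact/measurable_EFinP.
pose g n := nnsfun_approx measurableT mEf n.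
have cg t : (g n t)%:E @[n --> \oo] --> (f t)%:E.
  by apply: (cvg_nnsfun_approx measurableT mEf) => // x _; rewrite lee_fin.
have cg' t : g n t @[n --> \oo] --> f t by have /fine_cvgP[] := cg t.
have gf n t : g n t <= f t.
  have nd : nondecreasing_seq (fun n => g n t : R).
    by move=> a b ab; have /lefP := nd_nnsfun_approx measurableT mEf ab; exact.
  rewrite -(cvg_lim _ (cg' t))//; apply: nondecreasing_cvgn_le => //.
  by apply/cvg_ex; exists (f t); exact: cg'.
apply: (inV_lim (f_ := fun n => g n) (h := fun t => f t ^+ 2)) => //.
- move=> n t; rewrite ler_pXn2r ?nnegrE//.
- move=> n.
  pose s : seq R := finmap.enum_fset (fset_set (range (g n))).
  suff h (s' : seq R) : inV (fun t => \sum_(y <- s') y * \1_(g n @^-1` [set y]) t).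
    apply: inV_ext (h s) => t.
    by rewrite [RHS]fimfunE fsbig_finite.
  elim: s' => [|y s' IH]; first by apply: inV_ext inV0 => t; rewrite big_nil.
  have Vy : inV \1_(g n @^-1` [set y]) by apply: inV_indic; exact: measurable_sfunP.
  by apply: inV_ext (inV_lin y Vy IH) => t; rewrite big_cons.
Qed.

(** Indicator functions of measurable sets are reached by Dynkin's theorem, then
   nonnegative functions by monotone approximation with simple functions. *)
Lemma L2_monotone_class F : V F.
Proof.
set f := L2_fun F; have mf : measurable_fun [set: T] f by exact: measurable_L2_fun.
have if2 : mu.-integrable setT (EFin \o (fun t => f t ^+ 2)).
  by apply: (eq_integrableR measurableT _ (integrable_L2M F F)) => t _; rewrite expr2.
have part (p : T -> R) : measurable_fun [set: T] p -> (forall t, 0 <= p t) ->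
    (forall t, p t <= `|f t|) -> inV p.
  move=> mp p0 pf; apply: inV_ge0 => //.
  apply: (le_integrableR measurableT _ _ if2); first exact: measurable_funX.
  move=> t _; rewrite ger0_norm ?sqr_ge0// -[leRHS]real_normK ?num_real//.
  by rewrite ler_pXn2r ?nnegrE.
have Vp : inV (fun t => Num.max (f t) 0).
  apply: part; first exact: measurable_maxr.
  - by move=> t; rewrite le_max lexx orbT.
  - by move=> t; rewrite ge_max normr_ge0 ler_norm.
have Vn : inV (fun t => Num.max (- f t) 0).
  apply: part; first by apply: measurable_maxr => //; exact: measurableT_comp.
  - by move=> t; rewrite le_max lexx orbT.
  - by move=> t; rewrite ge_max normr_ge0 -normrN ler_norm.
have [F' VF' FE] := inV_lin (-1) Vn Vp.
suff -> : F = F' by [].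
apply: L2_ext; apply: ae_imply FE => t ->; rewrite -/(f t).
have [ft|ft] := leP 0 (f t).
  by rewrite max_r ?oppr_le0// mulr0 add0r.
by rewrite max_l ?oppr_ge0 ?ltW// mulN1r opprK addr0.
Qed.

End L2_monotone_class.

(** * Strong convergence of operators to a multiple of the identity *)

Section operator_convergence.
Context {R : realType} {X : normedModType R}.
Variables (ip : X -> X -> R) (ipP : is_inner ip) (ip_sym : forall x y, ip x y = ip y x).
Variables (B : nat -> X -> X) (m : nat -> R) (c : R).
Hypotheses (Blin : forall n a x y, B n (a *: x + y) = a *: B n x + B n y)
  (Bbound : forall n x, `|B n x| <= m n * `|x|) (m_cvg : m n @[n --> \oo] --> c).

Definition scales_to : set X := [set x | B n x @[n --> \oo] --> c *: x].

Lemma norm_sub_sqr x y : `|x - y| ^+ 2 = `|x| ^+ 2 - 2 * ip x y + `|y| ^+ 2.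
Proof.
have [_ _ ipxx] := ipP.
rewrite -!ipxx (ipB ipP) (ip_sym x) (ip_sym y) !(ipB ipP) (ip_sym y x); ring.
Qed.

(** As the norms of the operators tend to c, only the angle between x and its images
   has to be controlled. *)
Lemma scales_to_ip x : ip (B n x) x @[n --> \oo] --> c * `|x| ^+ 2 -> scales_to x.
Proof.
move=> cip; have ub : (m n * `|x|) ^+ 2 - 2 * (c * ip (B n x) x) + (c * `|x|) ^+ 2
    @[n --> \oo] --> (0 : R).
  rewrite (_ : 0 = (c * `|x|) ^+ 2 - 2 * (c * (c * `|x| ^+ 2)) + (c * `|x|) ^+ 2); last by ring.
  apply: cvgD; last exact: cvg_cst.
  apply: cvgB; last by apply: cvgMr; exact: cvgMr.
  by rewrite expr2; under eq_fun do rewrite expr2; apply: cvgM; exact: cvgMl.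
apply/subr_cvg0/cvgr0Pnorm_le => e e0; have e2 : 0 < e ^+ 2 by rewrite exprn_gt0.
move/cvgr0_norm_le/(_ _ e2): ub; apply: filterS => n ubn.
rewrite -[_ <= e]ler_sqr ?nnegrE ?(ltW e0)//; apply: le_trans ubn; apply: le_trans (ler_norm _).
rewrite norm_sub_sqr ip_sym (ipZ ipP) ip_sym normrZ -[X in _ <= _ + X]real_normK ?num_real//.
rewrite normrM normr_id lerD2r lerD2r ler_sqr ?nnegrE// .
by rewrite (le_trans _ (Bbound n x)).
Qed.

Lemma scales_to_lin a x y : scales_to x -> scales_to y -> scales_to (a *: x + y).
Proof.
rewrite /scales_to/= => Bx By; under eq_fun do rewrite Blin.
rewrite scalerDr scalerA mulrC -scalerA; apply: cvgD => //; exact: cvgZr.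
Qed.

(** As the operators are bounded uniformly, strong convergence passes to the closure. *)
Lemma scales_to_lim (u : nat -> X) x :
  (forall k, scales_to (u k)) -> u k @[k --> \oo] --> x -> scales_to x.
Proof.
move=> Bu ux; apply/cvgrPdist_le => e e0.
have c0 : 0 < `|c| + 1 by rewrite ltr_wpDl.
have de : 0 < e / (3 * (`|c| + 1)) by rewrite divr_gt0// mulr_gt0.
have [k uk] : exists k, `|x - u k| <= e / (3 * (`|c| + 1)).
  by move/cvgrPdist_le/(_ _ de)/filter_ex: ux.
have e3 : 0 < e / 3 by rewrite divr_gt0.
have mc : \forall n \near \oo, m n <= `|c| + 1.
  by apply: (cvgr_le _ m_cvg); rewrite (le_lt_trans (ler_norm _))// ltrDl.
have Bk : \forall n \near \oo, `|c *: u k - B n (u k)| <= e / 3.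
  by move/cvgrPdist_le/(_ _ e3): (Bu k).
apply: filterS2 mc Bk => n mn Bn.
have Bsub : B n x - B n (u k) = B n (x - u k).
  by rewrite (addrC x (- u k)) -[in RHS]scaleN1r Blin scaleN1r addrC.
have -> : c *: x - B n x = c *: (x - u k) + (c *: u k - B n (u k)) - (B n x - B n (u k)).
  by rewrite scalerBr opprB !addrA !subrK.
rewrite Bsub; apply: (le_trans (ler_normB _ _)).
have dE : e / (3 * (`|c| + 1)) = e / 3 / (`|c| + 1) by rewrite invfM mulrA.
have h1 : `|c *: (x - u k)| <= e / 3.
  rewrite normrZ (le_trans (ler_wpM2l _ uk))//.
  by rewrite dE mulrA ler_pdivrMr// mulrC ler_wpM2l ?ltW// ltrDl.
have h2 : `|B n (x - u k)| <= e / 3.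
  rewrite (le_trans (Bbound _ _))// (le_trans (ler_wpM2r _ mn))//.
  rewrite (le_trans (ler_wpM2l (ltW c0) uk))//.
  by rewrite dE mulrC divfK// gt_eqF.
have := le_trans (ler_normD (c *: (x - u k)) (c *: u k - B n (u k))) (lerD h1 Bn).
by move: h2; set p := `|_|; set q := `|_|; lra.
Qed.

Lemma operator_cvg_seq (u : nat -> X) x : scales_to x -> u n @[n --> \oo] --> x ->
  B n (u n) @[n --> \oo] --> c *: x.
Proof.
move=> Bx ux; apply/subr_cvg0.
have Bsub n : B n (u n) - c *: x = B n (u n - x) + (B n x - c *: x).
  by rewrite (addrC (u n)) -[X in X + u n]scaleN1r Blin scaleN1r addrA
    (addrC (- B n x)) subrK.
rewrite (_ : (fun n => _) = (fun n => B n (u n - x) + (B n x - c *: x))); last exact/funext.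
rewrite -[X in _ --> X]addr0; apply: cvgD; last exact/subr_cvg0.
apply/norm_cvg0P.
have up : m n * `|u n - x| @[n --> \oo] --> (0 : R).
  rewrite -(mulr0 c); apply: cvgM => //; apply/norm_cvg0P; exact/subr_cvg0.
by apply: (squeeze_cvgr _ (cvg_cst 0) up); apply: nearW => n; rewrite normr_ge0 Bbound.
Qed.

Lemma cvg_ip_seq (u v : nat -> X) x y : u n @[n --> \oo] --> x -> v n @[n --> \oo] --> y ->
  ip (u n) (v n) @[n --> \oo] --> ip x y.
Proof.
move=> ux vy.
have E n : ip (u n) (v n) = ip (u n) y + ip (v n - y) (u n).
  by rewrite (ipB ipP) !(ip_sym _ (u n)) addrC subrK.
rewrite (_ : (fun n => _) = (fun n => ip (u n) y + ip (v n - y) (u n))); last exact/funext.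
rewrite -[X in _ --> X]addr0; apply: cvgD; first exact: (cvg_ip ipP).
apply/norm_cvg0P.
have up : `|v n - y| * `|u n| @[n --> \oo] --> (0 : R).
  rewrite -(mul0r `|x|); apply: cvgM; last exact: cvg_norm.
  by apply/norm_cvg0P; exact/subr_cvg0.
by apply: (squeeze_cvgr _ (cvg_cst 0) up); apply: nearW => n; rewrite normr_ge0 (ip_norm_le ipP).
Qed.

End operator_convergence.

(** The coordinates are continuous, and open intervals generate the Borel sets of the
   line. *)
Lemma measurable_rV_open (R : realType) (n : nat) :
  (@measurable _ 'rV[R]_n) = <<s [set A : set 'rV[R]_n | open A] >>.
Proof.
apply/seteqP; split=> A; last first.
  apply: smallest_sub; first exact: sigma_algebra_measurable.
  by move=> B; exact: open_measurable_rV.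
apply: smallest_sub; first exact: smallest_sigma_algebra.
move=> B; rewrite -bigcup_seq => -[i _] [C mC <-] /=.
pose f (v : g_sigma_algebraType [set A : set 'rV[R]_n | open A]) : R := (v : 'rV[R]_n) ord0 i.
suff mf : measurable_fun [set: _] f by exact: mf.
apply: (measurability _ (RGenOpens.measurableE R)) => _ [_ [a [b ->] <-]].
apply: sub_sigma_algebra; rewrite setTI /=.
apply: (open_comp (f := fun v : 'rV[R]_n => v ord0 i)) => [v _|]; first exact: coord_continuous.
exact: interval_open.
Qed.

(** * The Riesz operator on a bounded open set *)

Section riesz_operator.
Context {R : realType} (d : nat).
Variables (Omega : set 'rV[R]_d) (oOmega : open Omega) (bOmega : bounded_set Omega).
Notation lam := (lebesgue_rV R d).
Notation om := (omega R d).
Notation mu := (lebesgue_on oOmega).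

Let mOmega : measurable Omega. Proof. exact: open_measurable_rV. Qed.

Lemma lebesgue_rV_bounded : (lam Omega < +oo)%E.
Proof.
have [M [_ HM]] := bOmega.
have {}HM x : Omega x -> `|x| <= `|M| + 1.
  by move=> Ox; apply: (HM (`|M| + 1)) => //; rewrite (le_lt_trans (ler_norm _))// ltrDl.
apply: le_lt_trans (lebesgue_rV_cube_lty d (`|M| + 1)); apply: le_measure; rewrite ?inE//.
  rewrite [X in measurable X](_ : _ = \bigcap_(i in [set: 'I_d])
    (fun v : 'rV[R]_d => v ord0 i) @^-1` `[- (`|M| + 1), `|M| + 1]).
    apply: fin_bigcap_measurable => // i _.
    rewrite -[X in measurable X]setTI; apply: measurable_coord => //; exact: measurable_itv.
  by apply/seteqP; split=> v /= h i; [move=> _; exact: h|exact: (h i I)].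
move=> x Ox i /=; rewrite in_itv/= -ler_norml (le_trans _ (HM x Ox))//.
rewrite [leRHS](_ : _ = mx_norm x)// mx_normrE.
exact: (le_bigmax _ (fun ij => `|x ij.1 ij.2|) (ord0, i)).
Qed.

Let vol : R := fine (lam Omega).

Let volE : lam Omega = vol%:E.
Proof. by rewrite fineK// ge0_fin_numE// lebesgue_rV_bounded. Qed.

Let mu_fin : (mu [set: _] < +oo)%E.
Proof. by rewrite /lebesgue_on /= /mrestr setTI lebesgue_rV_bounded. Qed.

Lemma integral_lebesgue_on (f : 'rV[R]_d -> \bar R) : measurable_fun setT f ->
  (\int[mu]_y f y = \int[lam]_(y in Omega) f y)%E.
Proof.
move=> mf.
have -> : (\int[lam]_(y in Omega) f y = \int[mu]_(y in Omega) f y)%E.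
  apply: eq_measure_integral => A mA AO.
  by rewrite /lebesgue_on /= /mrestr setIidl.
have m0 : mu (~` Omega) = 0%E by rewrite /lebesgue_on /= /mrestr setICl measure0.
have restr g : measurable_fun setT g -> (forall y, 0 <= g y)%E ->
    (\int[mu]_y g y = \int[mu]_(y in Omega) g y)%E.
  move=> mg g0; have := ge0_negligible_integral (measurableC mOmega) measurableT mg (fun y _ => g0 y) m0.
  by rewrite setTD setCK.
rewrite integralE [RHS]integralE !restr//.
- exact: measurable_funeneg.
- exact: measurable_funepos.
Qed.

Lemma Rintegral_lebesgue_on (f : 'rV[R]_d -> R) : measurable_fun setT f ->
  (\int[mu]_y f y)%R = (\int[lam]_(y in Omega) f y)%R.
Proof. by move=> mf; rewrite /Rintegral integral_lebesgue_on//; exact/measurable_EFinP. Qed.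

(** The integral of the kernel over the unit ball, plus a bound for the integral over the
   rest of the domain, where the kernel is at most 1; the last term makes the bound
   positive for an empty domain. *)
Definition riesz_bound (a : R) := a^-1 * (d%:R * om) + vol + 1.

Lemma riesz_bound_gt0 a : 0 < a -> 0 < riesz_bound a.
Proof.
move=> a0; rewrite /riesz_bound ltr_wpDl// addr_ge0 ?fine_ge0//.
by rewrite mulr_ge0 ?invr_ge0 ?(ltW a0)// mulr_ge0// omega_ge0.
Qed.

Section kernel.
Variables (a : R) (a_itv : 0 < a < d%:R).

Let mker x : measurable_fun [set: 'rV[R]_d] (fun y => (riesz_kernel a x y)%:E).
Proof. by apply/measurable_EFinP; apply: measurable_riesz_kernel. Qed.

Lemma riesz_kernel_bound x : (\int[mu]_y (riesz_kernel a x y)%:E <= (riesz_bound a)%:E)%E.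
Proof.
have k0 y : (0 <= (riesz_kernel a x y)%:E)%E by rewrite lee_fin riesz_kernel_ge0.
have mB : measurable (eball x 1) by exact: measurable_eball.
rewrite integral_lebesgue_on//.
apply: (@le_trans _ _ (\int[lam]_(y in eball x 1 `|` (Omega `\` eball x 1)) (riesz_kernel a x y)%:E)%E).
  apply: ge0_subset_integral => //.
  - by apply: measurableU => //; exact: measurableD.
  - exact: measurable_funTS.
  - by move=> y Oy; have [?|?] := pselect (eball x 1 y); [left|right].
rewrite ge0_integral_setU//; first last.
- by apply/disj_setPS => y [? []].
- exact: measurable_funTS.
- exact: measurableD.
rewrite (radial_integral a_itv x ltr01) powR1 mulr1 /riesz_bound -addrA EFinD leeD2l//.
apply: (@le_trans _ _ (\int[lam]_(y in Omega `\` eball x 1) (cst 1%E y))%E).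
  apply: ge0_le_integral => //; [exact: measurableD|exact: measurable_funTS|].
  move=> y [_ /negP]; rewrite -leNgt lee_fin => h.
  by rewrite (le_trans (riesz_kernel_le a_itv ltr01 h))// powR1 invr1.
rewrite integral_cst ?mul1e; last exact: measurableD.
apply: (@le_trans _ _ (lam Omega)); last by rewrite volE lee_fin lerDl.
by apply: le_measure; rewrite ?inE//; exact: measurableD.
Qed.

Lemma riesz_kernel_sym (x y : 'rV[R]_d) : riesz_kernel a x y = riesz_kernel a y x.
Proof. by rewrite /riesz_kernel edistC. Qed.

Let mk2 : measurable_fun [set: 'rV[R]_d * 'rV[R]_d] (fun z => riesz_kernel a z.1 z.2).
Proof. by apply: measurable_riesz_kernel; [exact: measurable_fst|exact: measurable_snd]. Qed.

Lemma riesz_operator : exists K : L2 oOmega -> L2 oOmega, [/\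
  forall b F G, K (b *: F + G) = b *: K F + K G,
  forall F, `|K F| <= riesz_bound a * `|F| &
  forall F, {ae mu, forall x, to_fun (K F) x = kernel_fun mu (riesz_kernel a) (to_fun F) x}].
Proof.
have a0 : 0 < a by case/andP: a_itv.
exact: (kernel_operator mu_fin mk2 (riesz_kernel_ge0 a) riesz_kernel_sym
  (riesz_bound_gt0 a0) riesz_kernel_bound).
Qed.

Lemma riesz_potentialE (f : 'rV[R]_d -> R) x : measurable_fun setT f ->
  riesz_potential Omega a f x = 2 * kernel_fun mu (riesz_kernel a) f x.
Proof.
move=> mf; rewrite /riesz_potential /kernel_fun; congr (_ * _).
rewrite Rintegral_lebesgue_on; last first.
  by apply: measurable_funM => //; exact: measurable_riesz_kernel.
by apply: eq_Rintegral => y _; exact: mulrC.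
Qed.

(** The factor depending on x leaves the inner integral where the latter converges
   absolutely, which holds for almost every x only. *)
Lemma riesz_energyE (F : L2 oOmega) :
  - riesz_energy Omega a (to_fun F) =
  \int[mu]_x (to_fun F x * kernel_fun mu (riesz_kernel a) (to_fun F) x).
Proof.
set f := to_fun F; have mf : measurable_fun [set: _] f by exact: measurable_L2_fun.
have a0 : 0 < a by case/andP: a_itv.
have mh : measurable_fun [set: 'rV[R]_d * 'rV[R]_d]
    (fun z => f z.1 * f z.2 / enorm (z.1 - z.2) `^ (d%:R - a)).
  apply: measurable_funM; last exact: mk2.
  by apply: measurable_funM; apply: (measurableT_comp mf); [exact: measurable_fst|exact: measurable_snd].
have mhx x : measurable_fun [set: _] (fun y => f x * f y / enorm (x - y) `^ (d%:R - a)).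
  exact: (measurableT_comp mh (measurable_pair1 x)).
have mi := measurable_Rintegral_section mu_fin mh.
rewrite /riesz_energy opprK.
transitivity (\int[lam]_(x in Omega) \int[mu]_y (f x * f y / enorm (x - y) `^ (d%:R - a)))%R.
  by apply: eq_Rintegral => x _; rewrite Rintegral_lebesgue_on.
rewrite -Rintegral_lebesgue_on//.
congr fine; apply: ae_eq_integral => //.
- exact/measurable_EFinP.
- by apply/measurable_EFinP; apply: measurable_funM => //; exact: measurable_kernel_fun.
have f2 : (\int[mu]_y (f y ^+ 2)%:E < +oo)%E by rewrite -(norm_L2E F) ltry.
have := ae_integrable_kernel mu_fin mk2 (riesz_kernel_ge0 a) riesz_kernel_sym
  (riesz_bound_gt0 a0) riesz_kernel_bound mf f2.
apply: ae_imply => x ix _; congr EFin; rewrite -RintegralZl//.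
by apply: eq_Rintegral => y _; rewrite -mulrA [in LHS](mulrC (f y)).
Qed.

End kernel.
End riesz_operator.

(** * Convergence of the Riesz operators *)

Section riesz_convergence.
Context {R : realType} (d : nat).
Variables (Omega : set 'rV[R]_d) (oOmega : open Omega) (bOmega : bounded_set Omega).
Notation lam := (lebesgue_rV R d).
Notation om := (omega R d).
Notation mu := (lebesgue_on oOmega).
Notation vol := (fine (lam Omega)).

Let mOmega : measurable Omega. Proof. exact: open_measurable_rV. Qed.

Let mu_fin : (mu [set: _] < +oo)%E.
Proof. by rewrite /lebesgue_on /= /mrestr setTI lebesgue_rV_bounded. Qed.

Let ae_Omega : {ae mu, forall x, Omega x}.
Proof.
exists (~` Omega); split => //; first exact: measurableC.
by rewrite /lebesgue_on /= /mrestr setICl measure0.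
Qed.

Lemma open_eball (W : set 'rV[R]_d) x : open W -> W x ->
  exists2 r : R, 0 < r & eball x r `<=` W.
Proof.
move=> oW Wx; have /nbhs_ballP[e /= e0 eW] := open_nbhs_nbhs (conj oW Wx).
exists e => // y /= xy; apply: eW; rewrite -ball_normE /=.
exact: le_lt_trans (norm_le_enorm _) xy.
Qed.

Variables (alpha : nat -> R) (alpha_itv : forall n, 0 < alpha n < d%:R).
Hypothesis alpha_cvg : alpha n @[n --> \oo] --> (0 : R).
Notation c := (2 * (d%:R * om)).
Notation norm_bound n := (2 * alpha n * riesz_bound Omega (alpha n)).

Lemma norm_boundE n : norm_bound n = c + 2 * alpha n * (vol + 1).
Proof.
have a0 : alpha n != 0 by rewrite gt_eqF//; case/andP: (alpha_itv n).
by rewrite /riesz_bound; field.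
Qed.

(** The bound given by Schur's test tends to the multiplier c itself, and not to a larger
   constant: this is what makes [scales_to_ip] applicable. *)
Lemma norm_bound_cvg : norm_bound n @[n --> \oo] --> c.
Proof.
rewrite (_ : (fun n => _) = (fun n => c + 2 * alpha n * (vol + 1))); last first.
  by apply/funext => n; rewrite norm_boundE.
rewrite -[X in _ --> X]addr0 -[X in _ --> _ + X](mul0r (vol + 1)) -(mulr0 2).
apply: cvgD; first exact: cvg_cst.
by apply: cvgMl; exact: cvgMr.
Qed.

Lemma norm_bound_le n : norm_bound n <= c + 2 * d%:R * (vol + 1).
Proof.
have /andP[_ and] := alpha_itv n.
by rewrite norm_boundE lerD2l ler_wpM2r ?addr_ge0 ?fine_ge0// ler_wpM2l// ltW.
Qed.

Section indicator.
Variables (W : set 'rV[R]_d) (oW : open W) (WO : W `<=` Omega).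

Let mW : measurable W. Proof. exact: open_measurable_rV. Qed.

Let mkW a x : measurable_fun [set: 'rV[R]_d] (fun y => riesz_kernel a x y * \1_W y).
Proof. by apply: measurable_funM; [exact: measurable_riesz_kernel|exact: measurable_indic]. Qed.

Let indW01 y : 0 <= (\1_W y : R) <= 1.
Proof. by rewrite indicE; case: (_ \in _); rewrite /= ?lexx ler01. Qed.

Let kW0 a x y : (0 <= (riesz_kernel a x y * \1_W y)%:E)%E.
Proof. by rewrite lee_fin mulr_ge0 ?riesz_kernel_ge0//; case/andP: (indW01 y). Qed.

Let kernel_upper a x : 0 < a < d%:R ->
  (\int[mu]_y (riesz_kernel a x y * \1_W y)%:E <= (riesz_bound Omega a)%:E)%E.
Proof.
move=> a_itv; apply: le_trans (riesz_kernel_bound oOmega bOmega a_itv x).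
apply: ge0_le_integral => //.
- exact/measurable_EFinP.
- by apply/measurable_EFinP; exact: measurable_riesz_kernel.
- move=> y _; rewrite lee_fin ler_piMr ?riesz_kernel_ge0//; by case/andP: (indW01 y).
Qed.

Let kernel_fun_upper a x : 0 < a < d%:R ->
  0 <= kernel_fun mu (riesz_kernel a) \1_W x <= riesz_bound Omega a.
Proof.
move=> a_itv; have u := kernel_upper x a_itv.
have i0 : (0 <= \int[mu]_y (riesz_kernel a x y * \1_W y)%:E)%E by exact: integral_ge0.
rewrite fine_ge0//= -lee_fin fineK//.
by rewrite ge0_fin_numE// (le_lt_trans u)// ltry.
Qed.

Let kernel_fun_lower a x (r : R) : 0 < a < d%:R -> 0 < r -> eball x r `<=` W ->
  a^-1 * (d%:R * om * r `^ a) <= kernel_fun mu (riesz_kernel a) \1_W x.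
Proof.
move=> a_itv r0 rW; have u := kernel_upper x a_itv.
have i0 : (0 <= \int[mu]_y (riesz_kernel a x y * \1_W y)%:E)%E by exact: integral_ge0.
rewrite -lee_fin fineK; last by rewrite ge0_fin_numE// (le_lt_trans u)// ltry.
rewrite -(radial_integral a_itv x r0).
have mB : measurable (eball x r) by exact: measurable_eball.
have -> : (\int[lam]_(y in eball x r) (riesz_kernel a x y)%:E =
           \int[mu]_(y in eball x r) (riesz_kernel a x y * \1_W y)%:E)%E.
  transitivity (\int[mu]_(y in eball x r) (riesz_kernel a x y)%:E)%E.
    apply: eq_measure_integral => A mA AB; rewrite /lebesgue_on /= /mrestr setIidl//.
    by move=> y /AB /rW /WO.
  apply: eq_integral => y /set_mem yB; rewrite indicE mem_set ?mulr1//; exact: rW.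
by apply: ge0_subset_integral => //; exact/measurable_EFinP.
Qed.

Let g n x := \1_W x * (2 * alpha n * kernel_fun mu (riesz_kernel (alpha n)) \1_W x).

Let g_cvg x : g n x @[n --> \oo] --> \1_W x * c.
Proof.
have [Wx|nWx] := pselect (W x); last first.
  by rewrite /g indicE memNset//= mul0r; under eq_fun do rewrite mul0r; exact: cvg_cst.
rewrite /g indicE mem_set//= mul1r; under eq_fun do rewrite mul1r.
have [r r0 rW] := open_eball oW Wx.
have cr : c * r `^ (alpha n) @[n --> \oo] --> c.
  rewrite -[X in _ --> X]mulr1; apply: cvgMr.
  rewrite (_ : (fun n => _) = (fun n => expR (alpha n * ln r))); last first.
    by apply/funext => n; rewrite /powR gt_eqF.
  rewrite -expR0 -(mul0r (ln r)).
  apply: (cvg_comp (fun n => alpha n * ln r) expR); last exact: continuous_expR.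
  exact: cvgMl.
apply: (squeeze_cvgr _ cr norm_bound_cvg); apply: nearW => n.
have an0 : 0 < alpha n by case/andP: (alpha_itv n).
have /andP[_ u] := kernel_fun_upper x (alpha_itv n).
have l := kernel_fun_lower (alpha_itv n) r0 rW.
rewrite ler_pM2l ?mulr_gt0// u andbT.
apply: le_trans (ler_wpM2l _ l); last by rewrite mulr_ge0// ltW.
rewrite le_eqVlt; apply/orP; left; apply/eqP; field; rewrite gt_eqF//.
Qed.

(** At a point of W, 2 alpha n times the integral of the kernel over W is at least
   c r^(alpha n), with r the radius of a ball contained in W, and at most the bound of
   Schur's test: both tend to c. Dominated convergence gives the conclusion. *)
Lemma riesz_indicator_cvg :
  (\int[mu]_x (\1_W x * (2 * alpha n * kernel_fun mu (riesz_kernel (alpha n)) \1_W x)))%R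
    @[n --> \oo] --> c * fine (mu W).
Proof.
have vol0 : 0 <= vol by exact: fine_ge0.
have mg n : measurable_fun [set: 'rV[R]_d] (g n).
  apply: measurable_funM; first exact: measurable_indic.
  by apply: measurable_funM => //; apply: measurable_kernel_fun => //; exact: measurable_riesz_kernel.
pose D : R := c + 2 * d%:R * (vol + 1).
have gD n x : `|g n x| <= D.
  have /andP[an0 _] := alpha_itv n; have /andP[w0 w1] := indW01 x.
  have /andP[k0 ku] := kernel_fun_upper x (alpha_itv n).
  rewrite /g ger0_norm; last by rewrite !mulr_ge0// ltW.
  apply: le_trans (norm_bound_le n).
  rewrite -[leRHS]mul1r; apply: ler_pM => //; first by rewrite !mulr_ge0// ltW.
  by rewrite ler_wpM2l// mulr_ge0// ltW.
have lim : (\int[mu]_x (g n x)%:E)%E @[n --> \oo] --> (\int[mu]_x (\1_W x * c)%:E)%E.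
  apply: (@dominated_cvg _ _ _ mu setT measurableT (fun n x => (g n x)%:E) _ (fun=> D%:E)) => //.
  - by move=> n; exact/measurable_EFinP.
  - by move=> x _; apply: cvg_EFin; [exact: nearW|exact: g_cvg].
  - exact: (finite_integrable_cst mu_fin).
  - by move=> n x _; rewrite lee_fin.
have <- : fine (\int[mu]_x (\1_W x * c)%:E)%E = c * fine (mu W).
  under eq_integral do rewrite mulrC EFinM.
  rewrite ge0_integralZl//; first last.
  - by rewrite lee_fin !mulr_ge0// omega_ge0.
  - by apply/measurable_EFinP; exact: measurable_indic.
  rewrite integral_indic// setIT fineM//.
  by rewrite ge0_fin_numE// (le_lt_trans _ mu_fin)// le_measure ?inE.
apply: fine_cvg.
have fin : (\int[mu]_x (\1_W x * c)%:E)%E \is a fin_num.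
  have i : mu.-integrable setT (EFin \o (fun x => \1_W x * c)).
    apply: (@le_integrableR _ _ _ _ _ measurableT _ (fun=> c)).
    - by apply: measurable_funM => //; exact: measurable_indic.
    - move=> x _; have /andP[w0 w1] := indW01 x.
      by rewrite normrM !ger0_norm ?ler_piMl// !mulr_ge0// omega_ge0.
    - exact: (finite_integrable_cst mu_fin).
  exact: integrable_fin_num i.
by rewrite fineK.
Qed.

End indicator.

(** Convergence is checked on indicator functions of open sets, through the pairings of
   [riesz_indicator_cvg]; open sets are stable under intersection and generate the
   sigma-algebra, so that [L2_monotone_class] extends it to the whole space. *)
Lemma riesz_operators_cvg : exists B : nat -> L2 oOmega -> L2 oOmega, [/\
  forall n b F G, B n (b *: F + G) = b *: B n F + B n G,
  forall n F, `|B n F| <= norm_bound n * `|F|,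
  forall n F, {ae mu, forall x,
    to_fun (B n F) x = alpha n * riesz_potential Omega (alpha n) (to_fun F) x},
  forall n F, - alpha n * riesz_energy Omega (alpha n) (to_fun F) = 2^-1 * L2_ip F (B n F) &
  forall F, B n F @[n --> \oo] --> c *: F].
Proof.
have a0 n : 0 < alpha n by case/andP: (alpha_itv n).
have mF (F : L2 oOmega) : measurable_fun [set: _] (to_fun F) by exact: measurable_L2_fun.
have mker n : measurable_fun [set: 'rV[R]_d * 'rV[R]_d] (fun z => riesz_kernel (alpha n) z.1 z.2).
  by apply: measurable_riesz_kernel; [exact: measurable_fst|exact: measurable_snd].
have mK n (f : 'rV[R]_d -> R) : measurable_fun [set: _] f ->
    measurable_fun [set: _] (kernel_fun mu (riesz_kernel (alpha n)) f).
  by move=> mf; exact: measurable_kernel_fun.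
have /choice[K KP] : forall n, exists K : L2 oOmega -> L2 oOmega, [/\
    forall b F G, K (b *: F + G) = b *: K F + K G,
    forall F, `|K F| <= riesz_bound Omega (alpha n) * `|F| &
    forall F, {ae mu, forall x,
      to_fun (K F) x = kernel_fun mu (riesz_kernel (alpha n)) (to_fun F) x}].
  by move=> n; exact: riesz_operator.
pose B n F := (2 * alpha n) *: K n F.
have BE n F : {ae mu, forall x,
    to_fun (B n F) x = 2 * alpha n * kernel_fun mu (riesz_kernel (alpha n)) (to_fun F) x}.
  have [_ _ KE] := KP n.
  have sE : {ae mu, forall x, to_fun (B n F) x = 2 * alpha n * to_fun (K n F) x}.
    exact: L2_scale_ae.
  by apply: ae_imply2 sE (KE F) => x -> ->.
have Blin n b F G : B n (b *: F + G) = b *: B n F + B n G.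
  by have [Kl _ _] := KP n; rewrite /B Kl scalerDr !scalerA mulrC.
have Bbound n F : `|B n F| <= norm_bound n * `|F|.
  have [_ Kb _] := KP n; rewrite normrZ ger0_norm; last by rewrite mulr_ge0// ltW.
  by rewrite -[leRHS]mulrA ler_wpM2l// mulr_ge0// ltW.
have ipB n F : L2_ip F (B n F) = (\int[mu]_x (to_fun F x *
    (2 * alpha n * kernel_fun mu (riesz_kernel (alpha n)) (to_fun F) x)))%R.
  congr fine; apply: ae_eq_integral => //.
  - by apply/measurable_EFinP; apply: measurable_funM; exact: measurable_L2_fun.
  - apply/measurable_EFinP; apply: measurable_funM => //; apply: measurable_funM => //; exact: mK.
  by apply: ae_imply (BE n F) => x e _; have -> : L2_fun (B n F) x = _ := e.
exists B; split=> //.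
- move=> n F; apply: ae_imply (BE n F) => x ->.
  by rewrite riesz_potentialE// mulrCA mulrA.
- move=> n F; rewrite mulNr -mulrN riesz_energyE// ipB.
  have iK : mu.-integrable setT (EFin \o (fun x => to_fun F x *
      kernel_fun mu (riesz_kernel (alpha n)) (to_fun F) x)).
    have [_ _ KE] := KP n.
    apply: (ae_integrableR measurableT _ _ (integrable_L2M F (K n F))).
      by apply: measurable_funM => //; exact: mK.
    by apply: ae_imply (KE F) => x e; have -> : L2_fun (K n F) x = _ := e.
  under [in RHS]eq_Rintegral => x _ do rewrite mulrCA.
  by rewrite RintegralZl// -[2 * _ * _]mulrA mulKf.
- move=> F0.
  have c0 : 0 <= c by rewrite !mulr_ge0// omega_ge0.
  have ipP := @L2_inner _ _ R mu.
  have ip_sym (F G : L2 oOmega) : L2_ip F G = L2_ip G F.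
    by rewrite /L2_ip; apply: eq_Rintegral => x _; rewrite mulrC.
  have openV (U : set 'rV[R]_d) F : open U -> {ae mu, forall x, to_fun F x = \1_U x} ->
      scales_to B c F.
    move=> oU FU; pose W := U `&` Omega.
    have oW : open W by exact: openI.
    have WO : W `<=` Omega by exact: subIsetr.
    have FW : {ae mu, forall x, to_fun F x = \1_W x}.
      apply: ae_imply2 FU ae_Omega => x -> Ox.
      by rewrite !indicE in_setI [x \in Omega]mem_set// andbT.
    have mW : measurable W by exact: open_measurable_rV.
    have kFW n x : kernel_fun mu (riesz_kernel (alpha n)) (to_fun F) x =
        kernel_fun mu (riesz_kernel (alpha n)) \1_W x.
      congr fine; apply: ae_eq_integral => //.
      - by apply/measurable_EFinP; apply: measurable_funM => //; exact: measurable_riesz_kernel.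
      - by apply/measurable_EFinP; apply: measurable_funM; [exact: measurable_riesz_kernel|exact: measurable_indic].
      by apply: ae_imply FW => y -> _.
    apply: (scales_to_ip ipP ip_sym Bbound norm_bound_cvg).
    have -> : (fun n => L2_ip (B n F) F) = (fun n => (\int[mu]_x (\1_W x *
        (2 * alpha n * kernel_fun mu (riesz_kernel (alpha n)) \1_W x)))%R).
      apply/funext => n; rewrite ip_sym ipB; congr fine; apply: ae_eq_integral => //.
      - by apply/measurable_EFinP; apply: measurable_funM => //; apply: measurable_funM => //; exact: mK.
      - by apply/measurable_EFinP; apply: measurable_funM; [exact: measurable_indic|
          apply: measurable_funM => //; apply: mK; exact: measurable_indic].
      by apply: ae_imply FW => x -> _; rewrite kFW.
    have -> : `|F| ^+ 2 = fine (mu W).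
      apply: EFin_inj; rewrite (norm_L2_ae _ FW); last exact: measurable_indic.
      rewrite fineK; last by rewrite ge0_fin_numE// (le_lt_trans _ mu_fin)// le_measure ?inE.
      rewrite -[in RHS](setIT W) -integral_indic//; apply: eq_integral => x _.
      by rewrite indicE; case: (_ \in _); rewrite ?expr1n ?expr0n.
    exact: riesz_indicator_cvg.
  apply: (L2_monotone_class mu_fin (@measurable_rV_open R d) _ (V := scales_to B c)).
  + by move=> U V oU oV; exact: openI.
  + move=> b F G; exact: (scales_to_lin Blin).
  + move=> F_ F; exact: (scales_to_lim Blin Bbound norm_bound_cvg).
  + by move=> F F1; apply: (openV setT); [exact: openT|apply: ae_imply F1 => x; rewrite indicT].
  + by move=> E F oE; exact: openV.
Qed.

End riesz_convergence.

(** * Evolution equations driven by bounded operators *)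

Section bounded_evolution.
Context {R : realType} {X : normedModType R}.
Notation mu := (@lebesgue_measure R).
Variables (ip : X -> X -> R) (ipP : is_inner ip).
Hypothesis complX : forall x : nat -> X, cvgn (series (fun k => `|x k|)) -> cvgn (series x).
Variables (T : R) (T0 : 0 < T).
Implicit Types (A : X -> X) (u v w : R -> X) (x y : X).
Notation D := (`]0, T[%classic : set (measurableTypeR R)).

Let mD : measurable D. Proof. exact: measurable_itv. Qed.

Let muD : mu D = T%:E.
Proof. by rewrite lebesgue_measure_itv/= lte_fin T0 sube0. Qed.

Definition evolves A x u := exists v, [/\ H1_time T u v,
  {ae mu, forall t, t \in `]0, T[ -> v t = A (u t)} & u 0 = x].

Definition lipschitz_linear A C :=
  (forall a x y, A (a *: x + y) = a *: A x + A y) /\ (forall x, `|A x| <= C * `|x|).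

Lemma lipschitz_linearB A C x y : lipschitz_linear A C -> A (x - y) = A x - A y.
Proof.
by move=> [Al _]; rewrite (addrC x) -scaleN1r Al scaleN1r addrC.
Qed.

(** Gronwall's lemma for the difference of the two solutions. *)
Lemma evolves_stability A A' C r x x' u u' : 0 <= C -> 0 <= r ->
  lipschitz_linear A C -> evolves A x u -> evolves A' x' u' ->
  (forall t, 0 < t < T -> `|A (u' t) - A' (u' t)| <= r) ->
  forall t, 0 <= t <= T -> `|u t - u' t| <= gronwall_constant T C * (`|x - x'| + T * r).
Proof.
move=> C0 r0 AC [v [[cu _ _ wu] vA ux]] [v' [[cu' _ _ wu'] v'A ux']] Ar t tT.
rewrite -ux -ux'; apply: (@weak_gronwall _ _ _ ipP _ T0 (u \- u') (v \- v')) => //.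
- by move=> s; apply: cvgB; [exact: cu|exact: cu'].
- by apply: (weak_ipB ipP); exact: (weak_derivative_weak_ip ipP).
apply: ae_imply2 vA v'A => s vs v's sT; rewrite /= (vs sT) (v's sT).
have -> : A (u s) - A' (u' s) = A (u s - u' s) + (A (u' s) - A' (u' s)).
  by rewrite (lipschitz_linearB _ _ AC) addrA subrK.
rewrite (le_trans (ler_normD _ _))// lerD//; first by case: AC.
by apply: Ar; move: sT; rewrite in_itv.
Qed.

Lemma evolves_unique A C x u u' : 0 <= C -> lipschitz_linear A C ->
  evolves A x u -> evolves A x u' -> {in `[0, T], u =1 u'}.
Proof.
move=> C0 AC hu hu' t; rewrite in_itv/= => tT.
have h s : 0 < s < T -> `|A (u' s) - A (u' s)| <= 0 by rewrite subrr normr0.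
have := evolves_stability C0 (lexx 0) AC hu hu' h tT.
rewrite subrr normr0 mulr0 addr0 mulr0 normr_le0 subr_eq0 => /eqP; exact.
Qed.

Lemma evolves_exists A C x : 0 <= C -> lipschitz_linear A C -> exists u, evolves A x u.
Proof.
move=> C0 [Al AC]; exists (exp_generator A x); exists (fun t => A (exp_generator A x t)); split.
- exact: (bounded_generator_solution ipP complX Al C0 AC).
- exact: nearW.
- exact: exp_generator0.
Qed.

Lemma lipschitz_linear_scale (a : R) : lipschitz_linear ( *:%R a) `|a|.
Proof.
split=> [b x y|x]; last by rewrite normrZ.
by rewrite scalerDr !scalerA mulrC.
Qed.

(** The explicit form of the solution is needed to control the residual of the limit
   solution: it stays on the line spanned by its initial value. *)
Lemma evolves_scale (a : R) x : evolves ( *:%R a) x (fun t => expR (a * t) *: x).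
Proof.
have cu : continuous (fun t : R => expR (a * t) *: x).
  move=> t; apply: cvgZl.
  have ca : a * s @[s --> t] --> a * t by apply: cvgMr; exact: cvg_id.
  by apply: (cvg_comp (fun s => a * s) expR ca); exact: continuous_expR.
have cv : continuous (fun t : R => a *: (expR (a * t) *: x)).
  by move=> t; apply: cvgZr; exact: cu.
exists (fun t => a *: (expR (a * t) *: x)); split; last by rewrite mulr0 expR0 scale1r.
- have cu' : {within `[0, T], continuous (fun t : R => expR (a * t) *: x)}.
    exact: continuous_subspaceT.
  have cv' : {within `[0, T], continuous (fun t : R => a *: (expR (a * t) *: x))}.
    exact: continuous_subspaceT.
  split=> //; [exact: (continuous_L2_time T0)|exact: (continuous_L2_time T0)|].
  apply: (weak_derivative_ip ipP complX T0) => // y t.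
  rewrite !(ipZ ipP).
  rewrite (_ : (fun t : R => _) = (fun t => expR (a * t) * ip x y)); last first.
    by apply/funext => s; rewrite (ipZ ipP).
  apply: is_derive_eq.
  have -> : a *: (1 : R^o) = a by exact: mulr1.
  by rewrite scaler0 add0r; transitivity (ip x y * (expR (a * t) * a)); [by []|ring].
- exact: nearW.
Qed.

Variables (A : nat -> X -> X) (a C : R).
Hypotheses (C0 : 0 <= C) (AC : forall n, lipschitz_linear (A n) C)
  (A_cvg : forall x, A n x @[n --> \oo] --> a *: x).
Variables (x_ : nat -> X) (x : X) (x_cvg : x_ n @[n --> \oo] --> x).
Variables (u_ : nat -> R -> X) (u : R -> X).
Hypotheses (u_sol : forall n, evolves (A n) (x_ n) (u_ n)) (u_lim : evolves ( *:%R a) x u).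

(** A bound, uniform in time, for the residual of the limit solution in the n-th
   equation. *)
Let r n := expR (`|a| * T) * `|A n x - a *: x|.

(** The resulting bound for the distance between the two solutions. *)
Let e n := gronwall_constant T C * (`|x_ n - x| + T * r n).

Let r0 n : 0 <= r n. Proof. by rewrite mulr_ge0// expR_ge0. Qed.

Let residual n t : 0 < t < T -> `|A n (u t) - a *: u t| <= r n.
Proof.
move=> /andP[t0 tT]; have tT' : t \in `[0, T] by rewrite in_itv/= !ltW.
have := evolves_unique (normr_ge0 a) (lipschitz_linear_scale a) u_lim (evolves_scale a x) tT'.
move=> ->.
have [Al _] := AC n; have Az : A n 0 = 0.
  by rewrite -(subrr x) (lipschitz_linearB _ _ (AC n)) !subrr.
set b := expR (a * t); have -> : A n (b *: x) = b *: A n x.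
  by rewrite -[b *: x]addr0 Al Az addr0.
have -> : a *: (b *: x) = b *: (a *: x) by rewrite !scalerA mulrC.
rewrite -scalerBr normrZ ger0_norm ?expR_ge0//.
rewrite ler_wpM2r// ler_expR (le_trans (ler_norm _))// normrM ler_wpM2l//.
by rewrite gtr0_norm// ltW.
Qed.

Let u_e n t : 0 <= t <= T -> `|u_ n t - u t| <= e n.
Proof. exact: (evolves_stability C0 (r0 n) (AC n) (u_sol n) u_lim (residual n)). Qed.

Let r_cvg : r n @[n --> \oo] --> (0 : R).
Proof.
rewrite -(mulr0 (expR (`|a| * T))); apply: cvgMr.
by apply/norm_cvg0P/subr_cvg0; exact: A_cvg.
Qed.

Let e_cvg : e n @[n --> \oo] --> (0 : R).
Proof.
rewrite -(mulr0 (gronwall_constant T C)); apply: cvgMr.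
rewrite -[X in _ --> X]addr0; apply: cvgD.
  by apply/norm_cvg0P/subr_cvg0.
by rewrite -(mulr0 T); apply: cvgMr.
Qed.

Lemma evolves_cvg t : t \in `[0, T] -> `|u_ n t - u t| @[n --> \oo] --> (0 : R).
Proof.
rewrite in_itv/= => tT.
apply: (squeeze_cvgr _ (cvg_cst 0) e_cvg); apply: nearW => n.
by rewrite normr_ge0 u_e.
Qed.

(** The derivatives converge uniformly too, as they are the images of the solutions under
   uniformly bounded operators, up to the residual. *)
Lemma evolves_H1_cvg : H1_cvg T u_ u.
Proof.
have /choice[v_ v_P] := u_sol; have [v [Hv vA _]] := u_lim.
exists v_, v; split=> //; first by move=> n; have [] := v_P n.
pose q n := (T + 1) * (e n + (C * e n + r n)).
have e0 n : 0 <= e n.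
  by apply: le_trans (@u_e n 0 _); rewrite // lexx ltW.
have q_cvg : (q n)%:E @[n --> \oo] --> 0%E.
  apply: cvg_EFin; first exact: nearW.
  rewrite -(mulr0 (T + 1)); apply: cvgMr.
  rewrite -[X in _ --> X]addr0; apply: cvgD => //.
  rewrite -[X in _ --> X]addr0; apply: cvgD => //.
  by rewrite -(mulr0 C); apply: cvgMr.
apply: (squeeze_cvge _ (cvg_cst 0%E) q_cvg); apply: nearW => n.
rewrite poweR_ge0/=.
have [[_ [smu_ _] [smv_ _] _] v_A _] := v_P n.
have [_ [smu _] [smv _] _] := Hv.
have int_le (f g : R -> X) (M : R) : 0 <= M -> strongly_measurable D f -> strongly_measurable D g ->
    {ae mu, forall t, t \in `]0, T[ -> `|f t - g t| <= M} ->
    (\int[mu]_(t in `]0%R, T[) (`|(f \- g) t| ^+ 2)%:E <= (M ^+ 2 * T)%:E)%E.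
  move=> M0 mf mg fgM.
  rewrite EFinM -muD -integral_cst//; apply: ae_ge0_le_integral => //.
  - apply/measurable_EFinP.
    apply: (strongly_measurable2 (g := fun x y => `|x - y| ^+ 2) _ mf mg) => u1 u2 x1 x2 h1 h2.
    by rewrite expr2; under eq_fun do rewrite expr2; apply: cvgM; apply: cvg_norm; exact: cvgB.
  - by move=> t _; rewrite lee_fin sqr_ge0.
  apply: ae_imply fgM => t h tD; rewrite lee_fin ler_pXn2r ?nnegrE//; exact: h.
have M0 : 0 <= C * e n + r n.
  by apply: addr_ge0; [apply: mulr_ge0 => //; exact: e0|exact: r0].
have Iu : (\int[mu]_(t in `]0%R, T[) (`|(u_ n \- u) t| ^+ 2)%:E <= (e n ^+ 2 * T)%:E)%E.
  apply: int_le => //; apply: nearW => t; rewrite in_itv/= => /andP[t0 tT].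
  by apply: u_e; rewrite !ltW.
have Iv : (\int[mu]_(t in `]0%R, T[) (`|(v_ n \- v) t| ^+ 2)%:E <=
    ((C * e n + r n) ^+ 2 * T)%:E)%E.
  apply: int_le => //; apply: ae_imply2 v_A vA => t h h' tD; rewrite (h tD) (h' tD).
  have tT : 0 < t < T by move: tD; rewrite in_itv.
  have -> : A n (u_ n t) - a *: u t = A n (u_ n t - u t) + (A n (u t) - a *: u t).
    by rewrite (lipschitz_linearB _ _ (AC n)) addrA subrK.
  rewrite (le_trans (ler_normD _ _))// lerD//; last exact: residual.
  have [_ Ab] := AC n; rewrite (le_trans (Ab _))// ler_wpM2l// u_e//.
  by case/andP: tT => t0 tT; rewrite !ltW.
have q0 : 0 <= q n by rewrite mulr_ge0// addr_ge0// ltW.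
have -> : (q n)%:E = ((q n ^+ 2)%:E `^ 2^-1)%E.
  by rewrite poweR_EFin -powR_mulrn// -powRrM mulfV// powRr1.
apply: gt0_ler_poweR => //.
- by rewrite in_itv/= leey andbT adde_ge0//; apply: integral_ge0 => t _; rewrite lee_fin sqr_ge0.
- by rewrite in_itv/= leey andbT lee_fin sqr_ge0.
apply: (le_trans (leeD Iu Iv)); rewrite -EFinD lee_fin /q.
move: (e0 n) M0; move: (e n) (C * e n + r n) => p p' p0 p'0.
rewrite -mulrDl exprMn mulrC; apply: ler_pM; rewrite ?addr_ge0 ?sqr_ge0 ?(ltW T0)//.
  by have := T0; nra.
by have := mulr_ge0 p0 p'0; nra.
Qed.

End bounded_evolution.

(** * Solutions in L2 of the domain *)

Section solutions.
Context {R : realType} (d : nat) (Omega : set 'rV[R]_d) (oOmega : open Omega).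
Notation mu := (lebesgue_on oOmega).

(** Equalities almost everywhere between representatives are equalities of classes. *)
Lemma is_solution_evolves (A : ('rV[R]_d -> R) -> 'rV[R]_d -> R) (A' : L2 oOmega -> L2 oOmega) T u0 u :
  (forall F, {ae mu, forall x, to_fun (A' F) x = A (to_fun F) x}) ->
  is_solution A T u0 u <-> evolves T A' u0 u.
Proof.
move=> AA'; split=> -[v [Hv vA u0E]]; exists v; split=> //.
  apply: ae_imply vA => t h tT; apply: L2_ext.
  have : {ae mu, forall x, to_fun (v t) x = to_fun (A' (u t)) x}; last by [].
  by apply: ae_imply2 (h tT) (AA' (u t)) => x /(_ I) -> ->.
apply: ae_imply vA => t h tT; rewrite (h tT).
by apply: ae_imply (AA' (u t)) => x e _.
Qed.

Lemma has_unique_solution_evolves (A : ('rV[R]_d -> R) -> 'rV[R]_d -> R)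
    (A' : L2 oOmega -> L2 oOmega) C T (u0 : L2 oOmega) : 0 < T -> 0 <= C -> lipschitz_linear A' C ->
  (forall F, {ae mu, forall x, to_fun (A' F) x = A (to_fun F) x}) ->
  has_unique_solution A T u0.
Proof.
move=> T0 C0 A'C AA'; have ipP := @L2_inner _ _ R mu.
have [u uA] := evolves_exists ipP (@L2_complete _ _ R mu) T0 u0 C0 A'C.
exists u; split; first exact/(is_solution_evolves _ _ _ AA').
move=> w /(is_solution_evolves _ _ _ AA') wA.
exact: (evolves_unique ipP T0 C0 A'C wA uA).
Qed.

End solutions.

Theorem theorem4p2 (R : realType) (d : nat) (d_gt0 : (0 < d)%N)
    (Omega : set 'rV[R]_d) (oOmega : open Omega)
    (bOmega : bounded_set Omega) (lOmega : lipschitz_boundary Omega)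
    (alpha : nat -> R) (alpha_itv : forall n, 0 < alpha n < d%:R)
    (alpha_cvg : alpha n @[n --> \oo] --> 0^'+)
    (u0 : nat -> L2 oOmega) (u0oo : L2 oOmega)
    (u0_cvg : u0 n @[n --> \oo] --> u0oo)
    (T : R) (T_gt0 : 0 < T) :
  let An n u x := - alpha n * riesz_potential Omega (alpha n) u x in
  let Aoo u x := - (2 * d%:R * omega R d) * u x in
  [/\ forall n, has_unique_solution (An n) T (u0 n),
      has_unique_solution Aoo T u0oo &
      forall (u : nat -> R -> L2 oOmega) (uoo : R -> L2 oOmega),
        (forall n, is_solution (An n) T (u0 n) (u n)) ->
        is_solution Aoo T u0oo uoo ->
        H1_cvg T u uoo /\
        forall t, t \in `[0, T] ->
          (`|u n t - uoo t| @[n --> \oo] --> 0) /\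
          (- alpha n * riesz_energy Omega (alpha n) (to_fun (u n t))
             @[n --> \oo] --> d%:R * omega R d * `|uoo t| ^+ 2)].
Proof.
move=> An Aoo.
have a_cvg : alpha n @[n --> \oo] --> (0 : R).
  by apply: cvg_trans alpha_cvg _; exact: cvg_within.
set om := omega R d in Aoo *.
have [B [Blin Bbound BE Benergy Bcvg]] := riesz_operators_cvg oOmega bOmega alpha_itv a_cvg.
have Bn_cvg := norm_bound_cvg Omega alpha_itv a_cvg.
set c := 2 * (d%:R * om).
have c0 : 0 <= c by rewrite !mulr_ge0// omega_ge0.
pose C := c + 2 * d%:R * (fine (lebesgue_rV R d Omega) + 1).
have C0 : 0 <= C by rewrite addr_ge0// !mulr_ge0// addr_ge0// fine_ge0.
pose A' n (F : L2 oOmega) := - B n F.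
have A'C n : lipschitz_linear (A' n) C.
  split=> [b x y|x]; first by rewrite /A' Blin opprD scalerN.
  rewrite normrN (le_trans (Bbound n x))// ler_wpM2r//.
  exact: norm_bound_le.
have A'E n F : {ae lebesgue_on oOmega, forall x, to_fun (A' n F) x = An n (to_fun F) x}.
  apply: ae_imply2 (BE n F) (L2_opp_ae (B n F)) => x e e'.
  by rewrite /An mulNr -e; exact: e'.
have AooE (F : L2 oOmega) : {ae lebesgue_on oOmega, forall x, to_fun (- c *: F) x = Aoo (to_fun F) x}.
  have sE : {ae lebesgue_on oOmega, forall x, to_fun (- c *: F) x = - c * to_fun F x}.
    exact: L2_scale_ae.
  by apply: ae_imply sE => x ->; rewrite /Aoo -mulrA.
split.
- move=> n; exact: (has_unique_solution_evolves _ T_gt0 C0 (A'C n) (A'E n)).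
- exact: (has_unique_solution_evolves _ T_gt0 (normr_ge0 _) (lipschitz_linear_scale _) AooE).
move=> u uoo uA uooA.
have uA' n : evolves T (A' n) (u0 n) (u n) by exact/(is_solution_evolves _ _ _ (A'E n)).
have uooA' : evolves T ( *:%R (- c)) u0oo uoo by exact/(is_solution_evolves _ _ _ AooE).
have ipP := @L2_inner _ _ R (lebesgue_on oOmega).
have ip_sym (F G : L2 oOmega) : L2_ip F G = L2_ip G F.
  by rewrite /L2_ip; apply: eq_Rintegral => x _; rewrite mulrC.
have complX := @L2_complete _ _ R (lebesgue_on oOmega).
have A'cvg F : A' n F @[n --> \oo] --> - c *: F by rewrite scaleNr; exact: cvgN.
have u_cvg := evolves_cvg ipP complX T_gt0 C0 A'C A'cvg u0_cvg uA' uooA'.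
split; first exact: (evolves_H1_cvg ipP complX T_gt0 C0 A'C A'cvg u0_cvg uA' uooA').
move=> t tT; split; first exact: u_cvg.
have ut : u n t @[n --> \oo] --> uoo t.
  by apply/subr_cvg0/norm_cvg0P; exact: u_cvg.
have But := operator_cvg_seq Blin Bbound Bn_cvg (Bcvg (uoo t)) ut.
under eq_fun do rewrite Benergy.
have -> : d%:R * om * `|uoo t| ^+ 2 = 2^-1 * L2_ip (uoo t) (c *: uoo t).
  have [_ _ ipxx] := ipP.
  by rewrite ip_sym (ipZ ipP) ipxx /c; field.
by apply: cvgMr; exact: (cvg_ip_seq ipP ip_sym ut But).
Qed.
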